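(* Let $Z>0$, $a=Z/2$, $b=Z/4$, and let $$\phi_2(x)=x_1\,e^{-b|x|+a\chi(|x|)|x|},\qquad x=(x_1,x_2,x_3)\in\mathbb R^3,$$ be the cut-off Jastrow quotient $\phi_2=e^{-F_{\rm cut}}\psi_2$ of the hydrogen-like eigenfunction $\psi_2(x)=x_1e^{-b|x|}$, where $F_{\rm cut}(x)=-a\chi(|x|)|x|$. Then $$\phi_2\in\mathcal B^s_{\rm sp}(\mathbb R^3)\quad\text{for every }0\le s<2,\qquad \phi_2\notin\mathcal B^2_{\rm sp}(\mathbb R^3).$$
   Context: $\chi\in C_c^\infty([0,\infty))$ is a fixed cut-off with $0\le\chi\le1$, $\chi(r)=1$ for $0\le r\le1$, $\chi(r)=0$ for $r\ge2$. The function $\psi_2$ is an eigenfunction of $H_Z=-\Delta-\frac{Z}{|x|}$ on $L^2(\mathbb R^3)$ with eigenvalue $-Z^2/16$. Fourier transform: $\widehat u(\xi)=\int_{\mathbb R^d}e^{-ix\cdot\xi}u(x)\,dx$, extended to tempered distributions by duality; $\langle\xi\rangle=(1+|\xi|^2)^{1/2}$. For $s\ge0$, the spectral Barron space $\mathcal B^s_{\rm sp}(\mathbb R^d)$ is the set of $u\in\mathcal S'(\mathbb R^d)$ such that $\widehat u\in L^1_{\rm loc}(\mathbb R^d)$ and $\int_{\mathbb R^d}\langle\xi\rangle^s|\widehat u(\xi)|\,d\xi<\infty$. *)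

(* Defs.v *)
From HB Require Import structures.
From mathcomp Require Import all_boot all_order all_algebra.
From mathcomp Require Import all_classical all_reals all_analysis.
From mathcomp Require Import complex.

Set Implicit Arguments.
Unset Strict Implicit.
Unset Printing Implicit Defensive.

Import Order.TTheory GRing.Theory Num.Theory.
Import numFieldNormedType.Exports.
Import Normc.

Local Open Scope classical_set_scope.
Local Open Scope ring_scope.
Local Open Scope complex_scope.

(* R^d is 'rV[R]_d with its library topology. Its sigma-algebra is generated by
   the coordinates, i.e., it is the Borel one. *)
Section measurable_rV.
Context (R : realType) (d : nat).

Definition rV_coord (i : 'I_d) (x : 'rV[R]_d) : R := x 0 i.

Let rV_set0 : g_sigma_preimage rV_coord set0.
Proof. exact: sigma_algebra0. Qed.

Let rV_setC A : g_sigma_preimage rV_coord A -> g_sigma_preimage rV_coord (~` A).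
Proof. exact: sigma_algebraC. Qed.

Let rV_bigcup (F : (set 'rV[R]_d)^nat) :
  (forall i, g_sigma_preimage rV_coord (F i)) ->
  g_sigma_preimage rV_coord (\bigcup_i F i).
Proof. exact: sigma_algebra_bigcup. Qed.

HB.instance Definition _ := @isMeasurable.Build default_measure_display
  'rV[R]_d (g_sigma_preimage rV_coord) rV_set0 rV_setC rV_bigcup.

Lemma measurable_rV_coord (i : 'I_d) : measurable_fun setT (rV_coord i).
Proof.
move=> _ Y mY; rewrite setTI; apply: sub_sigma_algebra => /=.
rewrite -bigcup_seq/=; exists i => /=; first by rewrite mem_index_enum.
by exists Y => //; rewrite setTI.
Qed.

Lemma measurable_fun_rV d' (T : measurableType d') (f : T -> 'rV[R]_d) :
  (forall i, measurable_fun setT (rV_coord i \o f)) -> measurable_fun setT f.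
Proof.
move=> mf; suff H : g_sigma_preimage rV_coord `<=`
    [set A | measurable (f @^-1` A)].
  by move=> _ A mA; rewrite setTI; exact: H.
apply: smallest_sub.
  split => /=.
  - by rewrite preimage_set0.
  - by move=> A mA; rewrite setTD preimage_setC; exact: measurableC.
  - by move=> F mF; rewrite preimage_bigcup; exact: bigcup_measurable.
move=> A; rewrite -bigcup_seq/= => -[i _ [B mB <-]] /=.
by rewrite setTI -comp_preimage -[X in measurable X]setTI; exact: mf.
Qed.

End measurable_rV.

Section lebesgue_rV.
Context (R : realType).

Definition cons_rV d (p : 'rV[R]_d * R) : 'rV[R]_d.+1 :=
  \row_i (if unlift ord0 i is Some j then p.1 0 j else p.2).

Lemma measurable_cons_rV d : measurable_fun setT (@cons_rV d).
Proof.
apply: measurable_fun_rV => i.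
have -> : rV_coord i \o @cons_rV d =
    fun p => if unlift ord0 i is Some j then rV_coord j p.1 else p.2.
  by apply/funext => p; rewrite /rV_coord /= mxE.
case: unlift => [j|]; last exact: measurable_snd.
by apply: measurableT_comp; [exact: measurable_rV_coord|exact: measurable_fst].
Qed.

Section lebesgue_rVS.
Context d (m : {measure set 'rV[R]_d -> \bar R}).

Definition lebesgue_rVS : set 'rV[R]_d.+1 -> \bar R :=
  pushforward (m \x (@lebesgue_measure R))%E (@cons_rV d).

Let lebesgue_rVS0 : lebesgue_rVS set0 = 0%E.
Proof. by rewrite /lebesgue_rVS /pushforward preimage_set0 measure0. Qed.

Let lebesgue_rVS_ge0 A : (0 <= lebesgue_rVS A)%E.
Proof. by rewrite /lebesgue_rVS /pushforward; exact: measure_ge0. Qed.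

Let lebesgue_rVS_sigma_additive : semi_sigma_additive lebesgue_rVS.
Proof.
move=> F mF tF mUF; rewrite /lebesgue_rVS /pushforward preimage_bigcup.
have mcons A : measurable A -> measurable (@cons_rV d @^-1` A).
  by move=> mA; rewrite -[X in measurable X]setTI; exact: measurable_cons_rV.
apply: measure_semi_sigma_additive.
- by move=> n; exact: mcons.
- apply/trivIsetP => /= i j _ _ ij; rewrite -preimage_setI.
  by move/trivIsetP : tF => /(_ _ _ _ _ ij) ->//; rewrite preimage_set0.
- by rewrite -preimage_bigcup; exact: mcons.
Qed.

HB.instance Definition _ := isMeasure.Build _ _ _ lebesgue_rVS
  lebesgue_rVS0 lebesgue_rVS_ge0 lebesgue_rVS_sigma_additive.

End lebesgue_rVS.

Fixpoint lebesgue_rV d : {measure set 'rV[R]_d -> \bar R} :=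
  if d is d'.+1 then lebesgue_rVS (lebesgue_rV d') else dirac (0 : 'rV[R]_0).

Lemma lebesgue_rV_box d (A : 'I_d -> set R) : (forall i, measurable (A i)) ->
  lebesgue_rV d [set x | forall i, A i (x 0 i)] =
  (\prod_(i < d) @lebesgue_measure R (A i))%E.
Proof.
elim: d A => [|d IH] A mA.
  rewrite big_ord0 /= diracE mem_set //= => i; by case: i.
rewrite /= /lebesgue_rVS /pushforward.
have -> : @cons_rV d @^-1` [set x | forall i, A i (x 0 i)] =
    [set x : 'rV[R]_d | forall i, A (lift ord0 i) (x 0 i)] `*` A ord0.
  apply/seteqP; split => [[x y] /= h|[x y] /= [h1 h2] i].
    split; first by move=> i; have := h (lift ord0 i); rewrite mxE liftK.
    by have := h ord0; rewrite mxE unlift_none.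
  rewrite mxE /=; case: unliftP => [j ->|->] //; exact: h1.
have mB : measurable [set x : 'rV[R]_d | forall i, A (lift ord0 i) (x 0 i)].
  rewrite [X in measurable X](_ : _ =
      \bigcap_(i in [set: 'I_d]) (rV_coord i @^-1` A (lift ord0 i))); last first.
    by apply/seteqP; split => x /= h i; [move=> _; exact: h|exact: (h i I)].
  apply: fin_bigcap_measurable => // i _.
  by rewrite -[X in measurable X]setTI; exact: measurable_rV_coord.
rewrite product_measure1E //; last exact: mA.
rewrite [LHS]muleC big_ord_recl; congr (_ * _)%E.
exact: (IH (fun i => A (lift ord0 i))).
Qed.

End lebesgue_rV.

Section distributions.
Context (R : realType) (d : nat).
Local Notation rV := 'rV[R]_d.
Local Notation leb := (@lebesgue_rV R d).
Local Notation Re := (@complex.Re R).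
Local Notation Im := (@complex.Im R).
Implicit Types (x xi : rV) (f : rV -> R) (phi psi g u : rV -> R[i])
  (T : (rV -> R[i]) -> R[i]).

Definition dot x xi : R := \sum_(i < d) x 0 i * xi 0 i.

(* The library norm of 'rV[R]_d is the sup norm; this is the Euclidean one. *)
Definition enorm x : R := Num.sqrt (dot x x).

Definition japanese xi : R := Num.sqrt (1 + enorm xi ^+ 2).

Definition cintegral phi : R[i] :=
  (\int[leb]_x Re (phi x)) +i* (\int[leb]_x Im (phi x)).

Definition cexpi (t : R) : R[i] := cos t +i* sin t.

Definition fourier phi : rV -> R[i] :=
  fun xi => cintegral (fun x => cexpi (- dot x xi) * phi x).

(* [:: i1; ..; ik] stands for the iterated partial d_i1 .. d_ik f. *)
Definition partial (s : seq 'I_d) f : rV -> R :=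
  foldr (fun i h => (fun x => 'D_(delta_mx 0 i) h x)) f s.

Definition smooth f := forall s x, differentiable (partial s f) x.

Definition csmooth phi :=
  smooth (Re \o phi) /\ smooth (Im \o phi).

Definition cpartial s phi : rV -> R[i] := fun x =>
  partial s (Re \o phi) x +i* partial s (Im \o phi) x.

Definition schwartz phi := csmooth phi /\
  forall k s, exists C : R, forall x,
    (1 + enorm x) ^+ k * normc (cpartial s phi x) <= C.

Definition test_function phi := csmooth phi /\
  exists K : set rV, compact K /\ forall x, ~ K x -> phi x = 0.

(* A functional on the Schwartz space is represented by a function on
   rV -> R[i] of which only the values on Schwartz functions matter. Continuity
   is the usual bound by finitely many seminorms
   sup_x (1 + |x|)^k |d^s phi(x)|, k <= N, size s <= N. *)
Definition tempered_distribution T :=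
  (forall (a : R[i]) phi psi, schwartz phi -> schwartz psi ->
    T (fun x => a * phi x + psi x) = a * T phi + T psi) /\
  exists (N : nat) (C : R), forall phi (M : R), schwartz phi ->
    (forall k s x, (k <= N)%N -> (size s <= N)%N ->
      (1 + enorm x) ^+ k * normc (cpartial s phi x) <= M) ->
    normc (T phi) <= C * M.

Definition regular_distribution u : (rV -> R[i]) -> R[i] :=
  fun phi => cintegral (fun x => u x * phi x).

Definition fourier_distribution T : (rV -> R[i]) -> R[i] :=
  fun phi => T (fourier phi).

Definition L1loc g :=
  [/\ measurable_fun setT (Re \o g),
      measurable_fun setT (Im \o g) &
      forall K : set rV, compact K ->
        (\int[leb]_(x in K) (normc (g x))%:E < +oo)%E].

(* T coincides with the function g as a distribution, i.e., on C_c^oo(R^d);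
   pairings with arbitrary Schwartz functions need not converge for g in L1loc. *)
Definition represents g T := forall phi, test_function phi ->
  T phi = regular_distribution g phi.

Definition spectral_barron (s : R) T := tempered_distribution T /\
  exists g, [/\ L1loc g, represents g (fourier_distribution T) &
    (\int[leb]_xi (japanese xi `^ s * normc (g xi))%:E < +oo)%E].

End distributions.

Section jastrow.
Context (R : realType).
Implicit Types (chi : R -> R) (a b : R) (x : 'rV[R]_3).

(* C_c^oo([0, +oo)): restrictions to [0, +oo) of smooth functions on R, with
   compact support; the values of chi on the negative reals are irrelevant. *)
Definition smooth_compact_halfline chi :=
  (exists h : R -> R, (forall n r, derivable (derive1n n h) r 1) /\
    forall r, 0 <= r -> chi r = h r) /\
  exists M : R, forall r, M <= r -> chi r = 0.

Definition cutoff chi :=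
  [/\ smooth_compact_halfline chi,
      forall r, 0 <= r -> 0 <= chi r <= 1,
      forall r, 0 <= r <= 1 -> chi r = 1 &
      forall r, 2 <= r -> chi r = 0].

Definition psi2 b x : R := x 0 0 * expR (- b * enorm x).

Definition Fcut a chi x : R := - a * chi (enorm x) * enorm x.

Definition phi2 a b chi x : R :=
  x 0 0 * expR (- b * enorm x + a * chi (enorm x) * enorm x).

Lemma phi2_quotient a b chi x :
  phi2 a b chi x = expR (- Fcut a chi x) * psi2 b x.
Proof. by rewrite /phi2 /Fcut /psi2 !mulNr opprK expRD mulrA [RHS]mulrC. Qed.

End jastrow.

(* Main.v *)
(** The function phi2 is real, so its Fourier transform is carried by the integrals
    I(xi, th) = int phi2(x) cos(x.xi + th) dx with th = 0 and th = pi / 2.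
    They are O(<xi>^-5): after a permutation of the coordinates let k = |xi_i| be
    the largest |xi_j|, and split phi2 into (1) x_1 chi(|x|), whose second derivative in
    x_i vanishes near the origin, (2) the rest cut off to |x| <= 2 / k, and
    (3) the rest cut off to |x| >= 1 / k. The rest is a symbol of order 2 at the
    origin, so (2) is O(k^-5) by size, and (1) and (3) by integrating by parts
    eight times in x_i, off the line where the other coordinates vanish. Hence
    <xi>^s I(xi, th) is integrable for s < 2.

    If some g representing the Fourier transform had <xi>^2 g integrable, then
    F(t) = int Im g(xi) sin(t xi_1) dxi would satisfy F(2t) - 2 F(t) = o(t^2) by
    dominated convergence. But Fourier inversion, regularized by e^(- e |xi_j|) whose
    transform is a Poisson kernel, yields F(t) = - (2 pi)^3 phi2(t e_1), that is,
    - (2 pi)^3 t e^((a - b) t) for 0 <= t <= 1, with a second difference of exact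
    order t^2. *)

(* The singularity of |x| at the origin is met by only one line parallel to the chosen axis. On
   every other such line |x| is smooth, the boundary terms sit at infinity, and the exceptional line
   is null; so pointwise bounds off that line suffice. Powers of |x| are integrated without polar
   coordinates: a product of Poisson kernels at scale e has integral pi^3 for every e and dominates,
   up to explicit powers of e, constants on |x| <= 2e and |x|^-6 on |x| >= e. The exponent -6
   dictates eight integrations by parts, as 2 - 8 = -6. Removing x_1 chi makes the remaining factor
   vanish at the origin, which raises the order from 1 to 2: size k^-2 times volume k^-3 is the
   fifth power, and <xi>^(s-5) is integrable on R^3 for s < 2.

   In the negative half, g is known only against test functions, so it is compared with the explicit
   transform through cut-off sines. Since phi2 is odd in x_1, sines and Im g carry all that is
   needed, F(0) = 0, and F(2t) - 2 F(t) is the second difference of F at 0, t, 2t; it detects the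
   kink of t e^((a-b)|t|) at t = 0. *)
Require Import Defs.
From HB Require Import structures.
From mathcomp Require Import all_boot all_order all_algebra perm.
From mathcomp Require Import all_classical all_reals all_analysis.
From mathcomp Require Import measurable_realfun complex ring lra zify.
Set Implicit Arguments.
Unset Strict Implicit.
Unset Printing Implicit Defensive.
Import Order.TTheory GRing.Theory Num.Theory.
Import numFieldNormedType.Exports.
Import Normc.
Local Open Scope classical_set_scope.
Local Open Scope ring_scope.
Local Open Scope complex_scope.

(** * Borel sets, boxes and permutations of coordinates in R^d *)

Section rV_measurable.
Context (R : realType) (d : nat).
Implicit Types (A : 'I_d -> set R) (U K : set 'rV[R]_d).

Lemma measurable_rV_box A : (forall i, measurable (A i)) ->
  measurable [set x : 'rV[R]_d | forall i, A i (x 0 i)].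
Proof.
move=> mA; rewrite [X in measurable X](_ : _ =
    \bigcap_(i in [set: 'I_d]) (@rV_coord R d i @^-1` A i)); last first.
  by apply/seteqP; split => x /= h i; [move=> _; exact: h|exact: (h i I)].
apply: fin_bigcap_measurable => // i _.
by rewrite -[X in measurable X]setTI; exact: measurable_rV_coord.
Qed.

(** The sigma-algebra comes from the coordinates and the topology from the sup norm; they meet
    because an open set is the countable union of the rational cubes that it contains. *)
Lemma open_measurable_rV U : open U -> measurable U.
Proof.
move=> oU.
pose box (p : 'rV[rat]_d * nat) : set 'rV[R]_d :=
  [set x | forall i, ball (ratr (p.1 0 i) : R) p.2.+1%:R^-1 (x 0 i)].
have -> : U = \bigcup_p (if `[< box p `<=` U >] then box p else set0).
  apply/seteqP; split => [x Ux|x [p _]]; last by case: ifPn => [/asboolP bU /bU|_ []].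
  have /nbhs_ballP[e /= e0 xeU] : nbhs x U by exact: open_nbhs_nbhs.
  (* The cube is centred near [x], not at [x]: two of its points differ by less than twice its
     radius in each coordinate, so a radius below [e / 2] keeps it in the ball. *)
  have [n ne] : exists n : nat, n.+1%:R^-1 < e / 2.
    have e20 : 0 < e / 2 by rewrite divr_gt0.
    by have [n _ /(_ n (leqnn n))] := near_infty_natSinv_lt (PosNum e20); exists n.
  have /choice[q xq] (i : 'I_d) : exists q : rat, ball (ratr q : R) n.+1%:R^-1 (x 0 i).
    have [q] := @rat_in_itvoo R (x 0 i - n.+1%:R^-1) (x 0 i + n.+1%:R^-1)
       ltac:(by rewrite ltrBlDr -addrA ltrDl addr_gt0// invr_gt0).
    rewrite in_itv /= => /andP[h1 h2]; exists q.
    by rewrite -ball_normE /= ltr_distl h2 h1.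
  exists (\row_i q i, n) => //=; rewrite asboolT.
    by move=> i; rewrite mxE; exact: xq.
  move=> y /= yq; apply: xeU; split => // k i; rewrite (ord1 k).
  have := xq i; have := yq i; rewrite mxE -!ball_normE /= !ltr_distlC => /andP[+ +] /andP[+ +].
  by move: ne; move: (n.+1%:R^-1) => c ne h1 h2 h3 h4; apply/andP; split; lra.
apply: countable_bigcupT_measurable => // p; case: ifP => // _.
apply: (@measurable_rV_box (fun i => ball (ratr (p.1 0 i) : R) p.2.+1%:R^-1)) => i.
exact: measurable_ball.
Qed.

Lemma compact_measurable_rV K : compact K -> measurable K.
Proof.
move=> cK; rewrite -[K]setCK; apply: measurableC; apply: open_measurable_rV.
by rewrite openC; apply: compact_closed => //; exact: norm_hausdorff.
Qed.

Lemma continuous_measurable_rV (f : 'rV[R]_d -> R) :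
  continuous f -> measurable_fun setT f.
Proof.
move=> cf; apply: (measurability _ (RGenOpens.measurableE R)) => _ -[_ [a [b ->]] <-].
rewrite setTI; apply: open_measurable_rV.
by apply: open_comp => //; exact: interval_open.
Qed.

End rV_measurable.

Section lebesgue_rV_sigma_finite.
Context (R : realType).
Local Notation mu := (@lebesgue_measure R).

Lemma lebesgue_rV_sigma_finite d : measure_function.sigma_finite setT (lebesgue_rV R d).
Proof.
exists (fun n => [set x : 'rV[R]_d | forall i, `[- n%:R, n%:R]%classic (x 0 i)]).
  apply/esym/seteqP; split => // x _.
  exists (Num.truncn (\sum_i `|x 0 i|)).+1 => //= i.
  rewrite in_itv /= -ler_norml; apply/ltW.
  apply: le_lt_trans (truncnS_gt _) => /=.
  by rewrite (bigD1 i) //= lerDl sumr_ge0.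
move=> n; split.
  exact: (@measurable_rV_box _ _ (fun=> `[- n%:R, n%:R]%classic)).
rewrite (@lebesgue_rV_box _ _ (fun=> `[- n%:R, n%:R]%classic)) //.
under eq_bigr do rewrite lebesgue_measure_itv /=.
set p := (X in (X < _)%E); suff pfin : p \is a fin_num by rewrite -(fineK pfin) ltry.
rewrite /p; elim/big_ind: _ => [|x y x0 y0|i _] //; first exact: fin_numM.
by case: ifP.
Qed.

(** A copy of [lebesgue_rV] that carries the sigma-finite structure required by product measures and
    Fubini; the two are convertible and are mixed freely. *)
Definition leb_rV (d : nat) : set 'rV[R]_d -> \bar R := lebesgue_rV R d.
HB.instance Definition _ d := Measure.copy (@leb_rV d) (lebesgue_rV R d).
HB.instance Definition _ d := Measure_isSigmaFinite.Build _ _ _ (@leb_rV d)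
  (lebesgue_rV_sigma_finite d).

Lemma ge0_integral_rVS d (f : 'rV[R]_d.+1 -> \bar R) :
  measurable_fun setT f -> (forall x, 0 <= f x)%E ->
  (\int[lebesgue_rV R d.+1]_x f x =
   \int[mu]_t \int[lebesgue_rV R d]_y f (cons_rV (y, t)))%E.
Proof.
move=> mf f0.
transitivity (\int[@leb_rV d \x mu]_z f (cons_rV z))%E.
  apply: (@ge0_integral_pushforward _ _ _ _ _ _ _ (@leb_rV d \x mu)%E) => //.
  exact: measurable_cons_rV.
rewrite (@fubini_tonelli2 _ _ _ _ _ (@leb_rV d) mu) //.
  exact: measurableT_comp (@measurable_cons_rV R d).
Qed.

End lebesgue_rV_sigma_finite.

Section measure_uniqueness.
Context (R : realType) (d : nat).
Local Notation rV := 'rV[R]_d.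
Implicit Types (a b : 'I_d -> R) (A : set rV).

Definition closed_box a b : set rV := [set x | forall i, a i <= x 0 i <= b i].

Lemma closed_boxE a b : closed_box a b = [set x | forall i, `[a i, b i]%classic (x 0 i)].
Proof. by apply/seteqP; split => x /= xab i; have := xab i; rewrite in_itv. Qed.

Lemma measurable_closed_box a b : measurable (closed_box a b).
Proof.
by rewrite closed_boxE; apply: (@measurable_rV_box _ _ (fun i => `[a i, b i]%classic)).
Qed.

Lemma lebesgue_rV_closed_box a b : (forall i, a i <= b i) ->
  lebesgue_rV R d (closed_box a b) = (\prod_(i < d) (b i - a i))%:E.
Proof.
move=> ab; rewrite closed_boxE (@lebesgue_rV_box _ _ (fun i => `[a i, b i]%classic)) //.
rewrite -prodEFin; apply: eq_bigr => i _; rewrite lebesgue_measure_itv /= lte_fin EFinB.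
by case: ltgtP (ab i) => // ->; rewrite subee.
Qed.

Lemma lebesgue_rV_closed_box_lty a b : (lebesgue_rV R d (closed_box a b) < +oo)%E.
Proof.
have [ab|] := pselect (forall i, a i <= b i).
  by rewrite lebesgue_rV_closed_box // ltry.
move=> /existsNP[i abi]; rewrite (_ : closed_box a b = set0) ?measure0 ?ltry //.
apply/seteqP; split => // x /(_ i) /andP[xa xb]; apply: abi; exact: le_trans xb.
Qed.

Let boxes : set (set rV) := [set A | exists a b, A = closed_box a b].
Let centered n := closed_box (fun=> - (n%:R : R)) (fun=> n%:R).

Let centered_cover : \bigcup_n centered n = setT.
Proof.
apply/seteqP; split => // x _.
exists (Num.truncn (\sum_i `|x 0 i|)).+1 => //= i; rewrite -ler_norml; apply/ltW.
by apply: le_lt_trans (truncnS_gt _); rewrite (bigD1 i) //= lerDl sumr_ge0.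
Qed.

Let boxes_setI : setI_closed boxes.
Proof.
move=> _ _ [a [b ->]] [a' [b' ->]].
exists (fun i => Num.max (a i) (a' i)), (fun i => Num.min (b i) (b' i)).
apply/seteqP; split => [x [xab xab'] i|x xab].
  by rewrite ge_max le_min; have /andP[-> ->] := xab i; have /andP[-> ->] := xab' i.
by split => i; have := xab i; rewrite ge_max le_min => /andP[/andP[? ?] /andP[? ?]];
  apply/andP.
Qed.

(** It is enough to treat half-spaces [r <= x 0 i], since half-lines generate the Borel sets of R;
    intersected with the centred cubes, a half-space becomes a countable union of closed boxes. *)
Let measurable_boxes : @measurable _ rV = <<s boxes >>.
Proof.
apply/seteqP; split; last first.
  by apply: smallest_sub; [exact: sigma_algebra_measurable|
    move=> _ [a [b ->]]; exact: measurable_closed_box].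
apply: smallest_sub; first exact: smallest_sigma_algebra.
move=> A; rewrite -bigcup_seq /= => -[i _ [B mB <-]]; rewrite setTI.
have : <<s @measurable_realfun.RGenCInfty.G R >> B.
  by have := mB; rewrite [X in X B]measurable_realfun.RGenCInfty.measurableE.
suff : <<s @measurable_realfun.RGenCInfty.G R >> `<=`
    [set B | <<s boxes >> (@rV_coord R d i @^-1` B)] by apply.
have [b0 bD bU] := smallest_sigma_algebra setT boxes.
apply: smallest_sub.
  split => /=.
  - by rewrite preimage_set0.
  - by move=> C; rewrite setTD preimage_setC => /bD; rewrite setTD.
  - by move=> F mF; rewrite preimage_bigcup; exact: bU.
move=> _ [r ->] /=.
have -> : @rV_coord R d i @^-1` `[r, +oo[ =
    \bigcup_n (@rV_coord R d i @^-1` `[r, +oo[ `&` centered n).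
  by rewrite -setI_bigcupr centered_cover setIT.
apply: bU => n; apply: sub_sigma_algebra.
exists (fun j => if j == i then Num.max r (- n%:R) else - n%:R), (fun=> n%:R).
apply/seteqP; split => [x [/= xr xn] j|x xn].
  have := xn j; case: eqP => [->|_ //]; rewrite ge_max => /andP[-> ->].
  by move: xr; rewrite /rV_coord in_itv /= andbT => ->.
split => [|j]; first by have := xn i; rewrite eqxx ge_max /= in_itv /= => /andP[/andP[->]].
by have := xn j; case: eqP => // _; rewrite ge_max => /andP[/andP[_ ->] ->].
Qed.

Lemma measure_rV_unique (m1 m2 : {measure set rV -> \bar R}) :
  (forall a b, m1 (closed_box a b) = m2 (closed_box a b)) ->
  (forall a b, m1 (closed_box a b) < +oo)%E ->
  forall A, measurable A -> m1 A = m2 A.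
Proof.
move=> m12 m1oo A mA; apply: (measure_unique boxes centered) => //.
- by move=> n; exists (fun=> - n%:R), (fun=> n%:R).
- by move=> _ [a [b ->]].
- by move=> n; exact: m1oo.
Qed.

End measure_uniqueness.

Section coordinate_permutation.
Context (R : realType) (d : nat).
Local Notation mu := (lebesgue_rV R d).
Local Notation rV := 'rV[R]_d.
Implicit Types (s : 'S_d) (f : rV -> \bar R).

Lemma measurable_col_perm s : measurable_fun setT (col_perm s : rV -> rV).
Proof.
apply: measurable_fun_rV => i.
rewrite [X in measurable_fun _ X](_ : _ = @rV_coord R d (s i)).
  exact: measurable_rV_coord.
by apply/funext => x; rewrite /rV_coord /= mxE.
Qed.

(** On boxes this is a reindexing of the product of side lengths, and boxes determine the measure.
    It later moves the largest frequency into the distinguished coordinate. *)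
Lemma lebesgue_rV_col_perm s A : measurable A ->
  pushforward mu (col_perm s : rV -> rV) A = mu A.
Proof.
move=> mA; apply/esym.
apply: measure_rV_unique => //; first exact: measurable_col_perm; last first.
  by move=> a b; exact: lebesgue_rV_closed_box_lty.
move=> mp a b; rewrite closed_boxE (@lebesgue_rV_box _ _ (fun i => `[a i, b i]%classic)) //.
rewrite /= /pushforward [X in mu X](_ : _ = [set x : rV |
    forall i, (fun i => `[a ((s^-1)%g i), b ((s^-1)%g i)]%classic) i (x 0 i)]); last first.
  apply/seteqP; split => x /= xab i; last by have := xab (s i); rewrite permK mxE.
  by have := xab ((s^-1)%g i); rewrite mxE permKV.
rewrite (@lebesgue_rV_box _ _ (fun i => `[a ((s^-1)%g i), b ((s^-1)%g i)]%classic)) //=.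
rewrite [RHS](reindex_inj (@perm_inj _ s)) /=.
by apply: eq_bigr => i _; rewrite permK.
Qed.

Lemma ge0_integral_rV_col_perm s f : measurable_fun setT f -> (forall x, 0 <= f x)%E ->
  (\int[mu]_x f (col_perm s x) = \int[mu]_x f x)%E.
Proof.
move=> mf f0; rewrite -(@ge0_integral_pushforward _ _ _ _ _ (col_perm s) _ mu setT) //.
  apply: (eq_measure_integral mu); first exact: measurable_col_perm.
  by move=> mp A mA _; exact: lebesgue_rV_col_perm.
exact: measurable_col_perm.
Qed.

Lemma Rintegral_rV_col_perm s (g : rV -> R) : measurable_fun setT g ->
  \int[mu]_x g (col_perm s x) = \int[mu]_x g x.
Proof.
move=> mg; rewrite /Rintegral [in LHS]integralE [in RHS]integralE; congr fine.
have mg' : measurable_fun setT (EFin \o g) by exact/measurable_EFinP.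
congr (_ - _)%E.
- rewrite -(ge0_integral_rV_col_perm s (measurable_funepos mg')) //.
  by apply: eq_integral => x _; rewrite !funeposE.
- rewrite -(ge0_integral_rV_col_perm s (measurable_funeneg mg')) //.
  by apply: eq_integral => x _; rewrite !funenegE.
Qed.

End coordinate_permutation.

(** * Integrals over the line, Poisson kernels and tensor products *)

Section integral_line.
Context (R : realType).
Local Notation mu := (@lebesgue_measure R).
Implicit Types (f F G : R -> R) (a b l m x : R).

Let symitv (n : nat) : set R := `[- n%:R, n%:R]%classic.

Let symitv_cover : \bigcup_n symitv n = setT.
Proof.
apply/seteqP; split => // x _; exists (Num.truncn `|x|).+1 => //=.
by rewrite /symitv /= in_itv /= -ler_norml; apply/ltW; exact: truncnS_gt.
Qed.

Let measurable_symitv n : measurable (symitv n).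
Proof. exact: measurable_itv. Qed.

Let FTC_itv f F a b : a < b -> continuous f ->
  (forall x, a <= x <= b -> derivable F x 1 /\ 'D_1 F x = f x) ->
  (\int[mu]_(x in `[a, b]) (f x)%:E = (F b)%:E - (F a)%:E)%E.
Proof.
move=> ab cf dF.
have cF x : a <= x <= b -> {for x, continuous F}.
  by move=> /dF[dFx _]; apply: differentiable_continuous; apply/derivable1_diffP.
apply: continuous_FTC2 => //.
- exact: continuous_subspaceT.
- split => [x|/=|/=].
  + by rewrite in_itv /= => /andP[ax xb]; have [] := dF x; rewrite ?(ltW ax) ?(ltW xb).
  + by apply: cvg_at_right_filter; apply: cF; rewrite lexx ltW.
  + by apply: cvg_at_left_filter; apply: cF; rewrite lexx ltW.
move=> x; rewrite in_itv /= => /andP[ax xb]; rewrite derive1E.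
by have [] := dF x; rewrite ?(ltW ax) ?(ltW xb).
Qed.

(** Separate primitives, [F] to the right of 0 and [G] to the left, suit integrands built from |x|.
    They need not agree at 0, hence the terms [F 0] and [G 0]. *)
Let FTC_symitv f F G n : continuous f ->
  (forall x, 0 <= x -> derivable F x 1 /\ 'D_1 F x = f x) ->
  (forall x, x <= 0 -> derivable G x 1 /\ 'D_1 G x = f x) ->
  (\int[mu]_(x in symitv n.+1) (f x)%:E =
   (F n.+1%:R - F 0 + (G 0 - G (- n.+1%:R)))%:E)%E.
Proof.
move=> cf dF dG; rewrite /symitv.
have mf : measurable_fun setT (EFin \o f).
  by apply/measurable_EFinP; exact: continuous_measurable_fun.
have itvE : `[(- n.+1%:R)%R, n.+1%:R]%classic =
    `[(- n.+1%:R)%R, 0%R[%classic `|` `[0%R, n.+1%:R]%classic :> set R.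
  by rewrite -itv_bndbnd_setU // bnd_simp ?oppr_le0.
rewrite itvE integral_setU //; last 2 first.
- exact: measurable_funS mf.
- rewrite disj_set2E; apply/eqP/seteqP; split => // x [] /=.
  by rewrite !in_itv /= => /andP[_ /lt_geF ->].
rewrite integral_itv_bndo_bndc; last by apply: measurable_funS mf.
have -> : (\int[mu]_(x in `[0%R, n.+1%:R]) (f x)%:E = (F n.+1%:R)%:E - (F 0)%:E)%E.
  by apply: FTC_itv => // x /andP[? _]; exact: dF.
have -> : (\int[mu]_(x in `[(- n.+1%:R)%R, 0%R]) (f x)%:E =
    (G 0)%:E - (G (- n.+1%:R))%:E)%E.
  by apply: FTC_itv => // x /andP[_ ?]; exact: dG.
by rewrite -!EFinB -EFinD addrC.
Qed.

Let FTC_symitv_cvg f F G l m : continuous f ->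
  (forall x, 0 <= x -> derivable F x 1 /\ 'D_1 F x = f x) ->
  (forall x, x <= 0 -> derivable G x 1 /\ 'D_1 G x = f x) ->
  F x @[x --> +oo] --> l -> G x @[x --> -oo] --> m ->
  (\int[mu]_(x in symitv n) (f x)%:E @[n --> \oo] --> (l - F 0 + (G 0 - m))%:E)%E.
Proof.
move=> cf dF dG Fl Gm; rewrite -(cvg_shiftS (fun n => \int[mu]_(x in symitv n) (f x)%:E)%E).
under eq_fun do rewrite (FTC_symitv _ cf dF dG).
have nSy : (n.+1%:R : R) @[n --> \oo] --> +oo.
  by rewrite (cvg_shiftS (fun n => n%:R : R)); exact: cvgr_idn.
apply: cvg_EFin; first by near=> n.
apply: cvgD.
  apply: cvgB; last exact: cvg_cst.
  exact: cvg_comp nSy Fl.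
apply: cvgB; first exact: cvg_cst.
by apply: cvg_comp Gm; exact/cvgNrNy.
Unshelve. all: by end_near. Qed.

Let nd_symitv : nondecreasing_seq symitv.
Proof.
move=> n k nk; apply/subsetPset => x; rewrite /symitv /= !in_itv /= -!ler_norml.
by move=> /le_trans; apply; rewrite ler_nat.
Qed.

Lemma ge0_integral_FTC2_line f F G l m : continuous f -> (forall x, 0 <= f x) ->
  (forall x, 0 <= x -> derivable F x 1 /\ 'D_1 F x = f x) ->
  (forall x, x <= 0 -> derivable G x 1 /\ 'D_1 G x = f x) ->
  F x @[x --> +oo] --> l -> G x @[x --> -oo] --> m ->
  (\int[mu]_x (f x)%:E = (l - F 0 + (G 0 - m))%:E)%E.
Proof.
move=> cf f0 dF dG Fl Gm.
have mf : measurable_fun setT (EFin \o f).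
  by apply/measurable_EFinP; exact: continuous_measurable_fun.
have := FTC_symitv_cvg cf dF dG Fl Gm.
apply: cvg_unique => //.
rewrite -symitv_cover; apply: ge0_nondecreasing_set_cvg_integral => //.
  by move=> n; exact: measurable_funS mf.
by move=> n x _; rewrite lee_fin.
Qed.

(** For integrands of varying sign, dominated convergence along the symmetric intervals replaces
    monotone convergence. *)
Lemma integral_FTC2_line f F G l m : continuous f ->
  mu.-integrable setT (EFin \o f) ->
  (forall x, 0 <= x -> derivable F x 1 /\ 'D_1 F x = f x) ->
  (forall x, x <= 0 -> derivable G x 1 /\ 'D_1 G x = f x) ->
  F x @[x --> +oo] --> l -> G x @[x --> -oo] --> m ->
  (\int[mu]_x (f x)%:E = (l - F 0 + (G 0 - m))%:E)%E.
Proof.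
move=> cf intf dF dG Fl Gm.
have := FTC_symitv_cvg cf dF dG Fl Gm.
apply: cvg_unique => //.
rewrite /= (_ : (fun n => _) = (fun n => \int[mu]_x ((EFin \o f) \_ (symitv n)) x)%E);
  last first.
  by apply/funext => n; rewrite integral_mkcond.
have mf := measurable_int _ intf.
have [//|||_ _] := @dominated_convergence _ _ _ mu setT measurableT
  (fun n => (EFin \o f) \_ (symitv n)) (EFin \o f) (fun x => `|f x|%:E) _ mf _
    (integrable_abse intf).
- by move=> n; apply/(measurable_restrictT (EFin \o f)) => //; exact: measurable_funS mf.
- apply: aeW => x _; apply: cvg_near_cst.
  have : (\bigcup_n symitv n) x by rewrite symitv_cover.
  move=> [n _ xn]; exists n => // k /= nk; rewrite patchE mem_set //.
  by have /subsetPset := nd_symitv nk; apply.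
- apply: aeW => x n _; rewrite patchE; case: ifP => _ //=.
  by rewrite normr0 lee_fin.
exact.
Qed.

End integral_line.

Lemma cvg0_le {R : realFieldType} {T : Type} {F : set_system T} {FF : Filter F}
    (f g : T -> R) : (forall x, `|f x| <= g x) -> g x @[x --> F] --> 0 ->
  f x @[x --> F] --> 0.
Proof.
move=> fg g0; apply: (squeeze_cvgr (f := fun x => - g x) (h := g)) => //.
  by apply: nearW => x; rewrite -ler_norml.
by rewrite -oppr0; exact: cvgN.
Qed.

Section poisson_kernel.
Context (R : realType).
Local Notation mu := (@lebesgue_measure R).
Implicit Types (e t x th k : R).

(** The Poisson kernel of the half-plane without its factor 1 / pi: the integral is pi at every
    scale [e]. *)
Definition poisson e x : R := e / (e ^+ 2 + x ^+ 2).

Lemma poisson_denom_gt0 e x : 0 < e -> 0 < e ^+ 2 + x ^+ 2.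
Proof. by move=> e0; rewrite ltr_wpDr ?sqr_ge0 ?exprn_gt0. Qed.

Lemma poisson_ge0 e x : 0 < e -> 0 <= poisson e x.
Proof. by move=> e0; rewrite divr_ge0 ?ltW // poisson_denom_gt0. Qed.

Lemma continuous_poisson e t : 0 < e -> continuous (fun x => poisson e (x - t)).
Proof.
move=> e0 x; apply: cvgM; first exact: cvg_cst.
apply: cvgV; first by rewrite gt_eqF // poisson_denom_gt0.
apply: cvgD; first exact: cvg_cst.
under eq_fun do rewrite expr2.
rewrite expr2.
by apply: cvgM; apply: cvgB; (exact: cvg_id || exact: cvg_cst).
Qed.

Lemma integral_poisson e t : 0 < e ->
  (\int[mu]_x (poisson e (x - t))%:E = (pi : R)%:E)%E.
Proof.
move=> e0; pose F x := atan ((x - t) / e).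
have dF x : is_derive x (1 : R) F (poisson e (x - t)).
  apply: is_derive_eq.
  rewrite /poisson /GRing.scale /=; field.
  by rewrite !gt_eqF // poisson_denom_gt0.
have Fy u : atan ((x + u) / e) @[x --> +oo] --> (pi : R) / 2.
  have := @cvgy_atan R; apply: cvg_comp; apply: gt0_cvgMly; first by rewrite invr_gt0.
  exact: cvg_addrr.
apply: etrans; first apply: (@ge0_integral_FTC2_line R _ F F (pi / 2) (- (pi / 2))).
- exact: continuous_poisson.
- by move=> x; exact: poisson_ge0.
- by move=> x _; have [] := dF x.
- by move=> x _; have [] := dF x.
- exact: Fy.
- apply/cvgNy_compNP; rewrite (_ : F \o -%R = fun x => - atan ((x + t) / e)).
    by apply: cvgN; exact: Fy.
  by apply/funext => x; rewrite /F /= -atanN; congr atan; field; rewrite gt_eqF.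
by congr EFin; lra.
Qed.

Let expR_decay e : 0 < e -> expR (- e * x) @[x --> +oo] --> (0 : R).
Proof.
move=> e0; under eq_fun do rewrite mulNr.
have := @cvgr_expR R; apply: (@cvg_comp _ _ _ (fun x => e * x) (fun x => expR (- x))).
by apply: gt0_cvgMry => //; exact: cvg_id.
Qed.

Let derive_pair (F : R -> R) x df : is_derive x 1 F df -> derivable F x 1 /\ 'D_1 F x = df.
Proof. by case. Qed.

Lemma continuous_expN_abs e : continuous (fun x => expR (- e * `|x|)).
Proof.
move=> x; apply: (@cvg_comp _ _ _ (fun x => - e * `|x|) expR); last exact: continuous_expR.
by apply: cvgM; [exact: cvg_cst|exact: norm_continuous].
Qed.

Lemma integral_expN_abs e : 0 < e -> (\int[mu]_x (expR (- e * `|x|))%:E = (2 / e)%:E)%E.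
Proof.
move=> e0; have e_neq0 : e != 0 by rewrite gt_eqF.
have decay : expR (- e * x) / e @[x --> +oo] --> (0 : R).
  by rewrite -(mul0r e^-1); apply: cvgM; [exact: expR_decay|exact: cvg_cst].
apply: etrans; first apply: (@ge0_integral_FTC2_line R _ (fun x => - expR (- e * x) / e)
   (fun x => expR (e * x) / e) 0 0).
- exact: continuous_expN_abs.
- by move=> x; exact: expR_ge0.
- move=> x x0; rewrite ger0_norm //; apply: derive_pair; apply: is_derive_eq.
  by rewrite /GRing.scale /=; field.
- move=> x x0; rewrite ler0_norm // mulrNN; apply: derive_pair; apply: is_derive_eq.
  by rewrite /GRing.scale /=; field.
- under eq_fun do rewrite mulNr.
  by rewrite -oppr0; apply: cvgN; exact: decay.
- apply/cvgNy_compNP; rewrite (_ : _ \o _ = fun x => expR (- e * x) / e).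
    exact: decay.
  by apply/funext => x /=; rewrite mulrN mulNr.
by rewrite /= !mulr0 expR0; congr EFin; field.
Qed.

Lemma integrable_expN_abs e : 0 < e -> mu.-integrable setT (fun x => (expR (- e * `|x|))%:E).
Proof.
move=> e0; apply/integrableP; split.
  by apply/measurable_EFinP; apply: continuous_measurable_fun; exact: continuous_expN_abs.
under eq_integral do rewrite gee0_abs ?lee_fin ?expR_ge0 //.
by rewrite integral_expN_abs // ltry.
Qed.

Lemma continuous_cos_affine k th : continuous (fun x => cos (x * k + th)).
Proof.
move=> x; apply: (@cvg_comp _ _ _ (fun x => x * k + th) cos); last exact: continuous_cos.
by apply: cvgD; [apply: cvgM; [exact: cvg_id|exact: cvg_cst]|exact: cvg_cst].
Qed.

(** The primitives are the real parts of e^((ik - e)x + i th) / (ik - e) for x >= 0 and of e^((ik +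
    e)x + i th) / (ik + e) for x <= 0. Their sine terms cancel at 0, so the phase survives only as
    the factor [cos th]. *)
Lemma integral_cos_expN_abs e k th : 0 < e ->
  (\int[mu]_x (cos (x * k + th) * expR (- e * `|x|))%:E =
   (cos th * (2 * poisson e k))%:E)%E.
Proof.
move=> e0; have D0 := poisson_denom_gt0 k e0; have Dn0 := gt_eqF D0.
pose D := e ^+ 2 + k ^+ 2.
have cf : continuous (fun x => cos (x * k + th) * expR (- e * `|x|)).
  by move=> x; apply: cvgM; [exact: continuous_cos_affine|exact: continuous_expN_abs].
have bounded u v x : `|expR (- e * x) * (u * sin v + e * cos v) / D| <=
    expR (- e * x) * ((`|u| + e) / D).
  rewrite -mulrA normrM (ger0_norm (expR_ge0 _)) ler_wpM2l ?expR_ge0 //.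
  rewrite normrM [`|D^-1|]ger0_norm ?invr_ge0 ?(ltW D0) //.
  apply: ler_wpM2r; first by rewrite invr_ge0 ltW.
  apply: (le_trans (ler_normD _ _)); rewrite !normrM (gtr0_norm e0) lerD //.
    by rewrite ler_piMr ?sin_max.
  by rewrite ler_piMr ?cos_max ?ltW.
have decay (u : R) : expR (- e * x) * ((`|u| + e) / D) @[x --> +oo] --> (0 : R).
  by rewrite -(mul0r ((`|u| + e) / D)); apply: cvgM; [exact: expR_decay|exact: cvg_cst].
apply: etrans; first apply: (@integral_FTC2_line R _
    (fun x => expR (- e * x) * (k * sin (x * k + th) - e * cos (x * k + th)) / D)
    (fun x => expR (e * x) * (k * sin (x * k + th) + e * cos (x * k + th)) / D) 0 0).
- exact: cf.
- apply: (le_integrable measurableT _ _ (integrable_expN_abs e0)).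
    by apply/measurable_EFinP; exact: continuous_measurable_fun.
  move=> x _ /=; rewrite lee_fin normrM ler_piMl // cos_max //.
- move=> x x0; rewrite ger0_norm //; apply: derive_pair; apply: is_derive_eq.
  by rewrite /GRing.scale /= /D; field; rewrite Dn0.
- move=> x x0; rewrite ler0_norm // mulrNN; apply: derive_pair; apply: is_derive_eq.
  by rewrite /GRing.scale /= /D; field; rewrite Dn0.
- apply: (cvg0_le _ (decay (- k))) => x.
  have := bounded (- k) (x * k + th) x.
  rewrite (_ : - k * sin _ + _ = - (k * sin (x * k + th) - e * cos (x * k + th))); last by ring.
  by rewrite mulrN mulNr normrN.
- apply/cvgNy_compNP; apply: (cvg0_le _ (decay k)) => x /=.
  by rewrite [e * - x]mulrN -[- (e * x)]mulNr; exact: bounded.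
rewrite /= !mulr0 mul0r !add0r expR0 /poisson -/D; congr EFin; field.
by rewrite Dn0.
Qed.

End poisson_kernel.

Section rV_integral.
Context (R : realType).
Local Notation mu := (@lebesgue_measure R).
Local Notation leb d := (lebesgue_rV R d).

Lemma integrable_rVS d (f : 'rV[R]_d.+1 -> R) : (leb d.+1).-integrable setT (EFin \o f) ->
  (@leb_rV R d \x mu)%E.-integrable setT (EFin \o (f \o @cons_rV R d)).
Proof.
move=> /integrableP[mf foo]; apply/integrableP; split.
  apply/measurable_EFinP; apply: measurableT_comp; last exact: measurable_cons_rV.
  exact/measurable_EFinP.
rewrite (_ : (\int[_]_x _)%E = (\int[leb d.+1]_x `|(EFin \o f) x|)%E) //; apply/esym.
apply: (@ge0_integral_pushforward _ _ _ _ _ _ _ (@leb_rV R d \x mu)%E setT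
  (fun x => `|(f x)%:E|%E)) => //; first exact: measurable_cons_rV.
exact/measurableT_comp.
Qed.

Lemma integral_rVS d (f : 'rV[R]_d.+1 -> R) : (leb d.+1).-integrable setT (EFin \o f) ->
  (\int[leb d.+1]_x (f x)%:E = \int[leb d]_y \int[mu]_t (f (cons_rV (y, t)))%:E)%E.
Proof.
move=> fi; have fi' := integrable_rVS fi.
transitivity (\int[@leb_rV R d \x mu]_z (f (cons_rV z))%:E)%E.
  apply: (@integral_pushforward _ _ _ _ _ _ _ (@leb_rV R d \x mu)%E setT (EFin \o f)) => //.
    exact: measurable_cons_rV.
  exact: measurable_int fi.
by rewrite -integral12_prod_meas1.
Qed.

Lemma ge0_integral_tensor d (f : 'I_d -> R -> R) :
  (forall i, measurable_fun setT (f i)) -> (forall i t, 0 <= f i t) ->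
  (\int[leb d]_x (\prod_(i < d) f i (x 0 i))%:E = \prod_(i < d) \int[mu]_t (f i t)%:E)%E.
Proof.
move=> mf f0; elim: d f mf f0 => [|d IH] f mf f0.
  rewrite big_ord0 /=; under eq_integral do rewrite big_ord0.
  by rewrite integral_dirac // diracE mem_set ?mul1e.
have mprod k (g : 'I_k -> R -> R) : (forall i, measurable_fun setT (g i)) ->
    measurable_fun setT (fun x : 'rV[R]_k => \prod_(i < k) g i (x 0 i)).
  by move=> mg; apply: measurable_prod => i _; apply: measurableT_comp => //;
    exact: measurable_rV_coord.
rewrite ge0_integral_rVS; last 2 first.
- by apply/measurable_EFinP; exact: mprod.
- by move=> x; rewrite lee_fin prodr_ge0.
rewrite big_ord_recl -IH //.
rewrite -ge0_integralZr //=; last 3 first.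
- by apply/measurable_EFinP; exact: mf.
- by move=> t _; rewrite lee_fin.
- by apply: integral_ge0 => y _; rewrite lee_fin prodr_ge0.
apply: eq_integral => t _; rewrite -ge0_integralZl_EFin //=; last 2 first.
- by move=> y _; rewrite lee_fin prodr_ge0.
- by apply/measurable_EFinP; exact: (mprod _ (fun i => f (lift ord0 i))).
apply: eq_integral => y _; rewrite -EFinM big_ord_recl mxE unlift_none; congr (_ * _)%:E.
by apply: eq_bigr => i _; rewrite mxE liftK.
Qed.

Lemma measurable_dot d (xi : 'rV[R]_d) : measurable_fun setT (fun x => dot x xi).
Proof.
apply: measurable_sum => i; apply: measurable_funM => //.
exact: measurable_rV_coord.
Qed.

Lemma measurable_tensor d (g : 'I_d -> R -> R) : (forall i, measurable_fun setT (g i)) ->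
    measurable_fun setT (fun x : 'rV[R]_d => \prod_(i < d) g i (x 0 i)).
Proof.
by move=> mg; apply: measurable_prod => i _; apply: measurableT_comp => //;
  exact: measurable_rV_coord.
Qed.

Lemma integrable_tensor_expN_abs d (e : R) : 0 < e ->
  (leb d).-integrable setT (fun x => (\prod_(i < d) expR (- e * `|x 0 i|))%:E).
Proof.
move=> e0.
have m1 : measurable_fun setT (fun t : R => expR (- e * `|t|)).
  apply: continuous_measurable_fun; exact: continuous_expN_abs.
apply/integrableP; split.
  by apply/measurable_EFinP; exact: (measurable_tensor (fun=> m1)).
under eq_integral do rewrite gee0_abs ?lee_fin ?prodr_ge0 //.
rewrite (@ge0_integral_tensor _ (fun _ t => expR (- e * `|t|))) //.
by under eq_bigr do rewrite integral_expN_abs //; rewrite prodEFin ltry.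
Qed.

Lemma dot_cons d (y : 'rV[R]_d) t xi : dot (cons_rV (y, t)) xi =
  t * xi 0 ord0 + dot y (\row_i xi 0 (lift ord0 i)).
Proof.
rewrite /dot big_ord_recl mxE unlift_none; congr (_ + _).
by apply: eq_bigr => i _; rewrite !mxE liftK.
Qed.

(** The arbitrary phase makes the induction work: while one coordinate is integrated out, the rest
    of the dot product is part of the phase. *)
Lemma integral_cos_tensor_expN_abs d (e th : R) xi : 0 < e ->
  (\int[leb d]_x (cos (dot x xi + th) * \prod_(i < d) expR (- e * `|x 0 i|))%:E =
   (cos th * \prod_(i < d) (2 * poisson e (xi 0 i)))%:E)%E.
Proof.
move=> e0; elim: d xi th => [|d IH] xi th.
  under eq_integral do rewrite big_ord0 mulr1 /dot big_ord0 add0r.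
  by rewrite integral_cst //= diracE mem_set // mule1 big_ord0 mulr1.
have mE := @measurable_tensor d.+1 (fun _ t => expR (- e * `|t|)).
have ci : (leb d.+1).-integrable setT (fun x =>
    (cos (dot x xi + th) * \prod_(i < d.+1) expR (- e * `|x 0 i|))%:E).
  apply: (le_integrable measurableT _ _ (integrable_tensor_expN_abs d.+1 e0)).
    apply/measurable_EFinP; apply: measurable_funM.
      apply: measurableT_comp; first exact: continuous_measurable_fun (@continuous_cos R).
      by apply: measurable_funD => //; exact: measurable_dot.
    by apply: mE => _; apply: continuous_measurable_fun; exact: continuous_expN_abs.
  move=> x _ /=; rewrite lee_fin normrM ler_piMl // cos_max //.
rewrite integral_rVS //.
transitivity (\int[leb d]_y ((2 * poisson e (xi 0 ord0))%:E *
  (cos (dot y (\row_i xi 0 (lift ord0 i)) + th) * \prod_(i < d) expR (- e * `|y 0 i|))%:E))%E.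
  apply: eq_integral => y _.
  rewrite -EFinM mulrCA mulrA -mulrA.
  pose E := \prod_(i < d) expR (- e * `|y 0 i|).
  transitivity (\int[mu]_t (E%:E * (cos (t * xi 0 ord0 +
      (dot y (\row_i xi 0 (lift ord0 i)) + th)) * expR (- e * `|t|))%:E))%E.
    apply: eq_integral => t _; rewrite -EFinM dot_cons big_ord_recl mxE unlift_none.
    rewrite (_ : \prod_(i < d) _ = E) /=; last by apply: eq_bigr => i _; rewrite mxE liftK.
    by rewrite addrA mulrC -mulrA [in RHS]mulrC mulrA; congr EFin; ring.
  rewrite integralZl //.
    by rewrite integral_cos_expN_abs // -EFinM; congr EFin; rewrite /E; ring.
  apply: (le_integrable measurableT _ _ (integrable_expN_abs e0)).
    apply/measurable_EFinP; apply: measurable_funM.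
      by apply: continuous_measurable_fun; exact: continuous_cos_affine.
    by apply: continuous_measurable_fun; exact: continuous_expN_abs.
  by move=> t _ /=; rewrite lee_fin normrM ler_piMl // cos_max.
rewrite integralZl // ?IH.
  rewrite -EFinM big_ord_recl mulrCA; congr (_ * (_ * _))%:E.
  by apply: eq_bigr => i _; rewrite mxE.
apply: (le_integrable measurableT _ _ (integrable_tensor_expN_abs d e0)).
  apply/measurable_EFinP; apply: measurable_funM.
    apply: measurableT_comp; first exact: continuous_measurable_fun (@continuous_cos R).
    by apply: measurable_funD => //; exact: measurable_dot.
  apply: (@measurable_tensor d (fun _ t => expR (- e * `|t|))) => _.
  by apply: continuous_measurable_fun; exact: continuous_expN_abs.
by move=> x _ /=; rewrite lee_fin normrM ler_piMl // cos_max.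
Qed.

End rV_integral.

(** * Symbols off an axis *)

Section symbol_class.
Context (R : realType) (d : nat).
Local Notation X := ('rV[R]_d * R)%type.
Implicit Types (p : X) (m : int) (y : 'rV[R]_d) (t : R).

Definition rad p : R := Num.sqrt (p.2 ^+ 2 + dot p.1 p.1).

(** For [y != 0] the radius stays positive on the whole line of points [(y, t)], so it is smooth in
    [t] even through [t = 0]. *)
Definition offaxis : set X := [set p | p.1 != 0].

Definition dt (f : X -> R) p : R := derive1 (fun t => f (p.1, t)) p.2.

Lemma dot_ge0 n (y : 'rV[R]_n) : 0 <= dot y y.
Proof. by apply: sumr_ge0 => i _; rewrite -expr2 sqr_ge0. Qed.

Lemma dot_gt0 n (y : 'rV[R]_n) : y != 0 -> 0 < dot y y.
Proof.
move=> y0; rewrite lt0r dot_ge0 andbT; apply: contra y0 => /eqP yy.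
apply/eqP/rowP => i; rewrite mxE; apply/eqP.
have /psumr_eq0P yi : \sum_(i < n) y 0 i * y 0 i = 0 := yy.
by rewrite -sqrf_eq0 expr2 yi // => j _; rewrite -expr2 sqr_ge0.
Qed.

Lemma rad_gt0 p : offaxis p -> 0 < rad p.
Proof.
by move=> p0; rewrite sqrtr_gt0 ltr_wpDl ?sqr_ge0 ?dot_gt0.
Qed.

Lemma normr_snd_le_rad p : `|p.2| <= rad p.
Proof.
by rewrite -sqrtr_sqr ler_wsqrtr // lerDl dot_ge0.
Qed.

Lemma normr_coord_le_rad p i : `|p.1 0 i| <= rad p.
Proof.
rewrite -sqrtr_sqr ler_wsqrtr // (le_trans _ (_ : dot p.1 p.1 <= _)) ?lerDr ?sqr_ge0 //.
rewrite /dot (bigD1 i) //= -expr2 lerDl.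
by apply: sumr_ge0 => j _; rewrite -expr2 sqr_ge0.
Qed.

Lemma measurable_offaxis : measurable offaxis.
Proof.
have m0 : measurable [set 0 : 'rV[R]_d].
  rewrite [X in measurable X](_ : _ =
      [set x : 'rV[R]_d | forall i, (fun=> [set (0 : R)]) i (x 0 i)]).
    by apply: (@measurable_rV_box _ _ (fun=> [set 0])).
  apply/seteqP; split => x /= x0; first by move=> i; rewrite x0 mxE.
  by apply/rowP => i; rewrite mxE; exact: x0.
rewrite [X in measurable X](_ : _ = (~` [set 0]) `*` setT).
  by apply: measurableX => //; exact: measurableC.
by apply/seteqP; split => p /= => [/eqP ?|[/eqP]].
Qed.

Lemma measurable_rad : measurable_fun setT rad.
Proof.
apply: measurableT_comp; first by apply: continuous_measurable_fun; exact: sqrt_continuous.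
apply: measurable_funD; first by apply: measurable_funX; exact: measurable_snd.
have mc i : measurable_fun setT (fun p : X => p.1 0 i).
  apply: (@measurableT_comp _ _ _ _ _ _ (@rV_coord R d i)); last exact: measurable_fst.
  exact: measurable_rV_coord.
by rewrite /dot; apply: measurable_sum => i; exact: measurable_funM.
Qed.

Lemma is_derive_rad p : offaxis p ->
  is_derive p.2 (1 : R) (fun t => rad (p.1, t)) (p.2 * (rad p)^-1).
Proof.
move=> p0; have r0 := rad_gt0 p0.
have s0 : 0 < p.2 ^+ 2 + dot p.1 p.1 by rewrite ltr_wpDl ?sqr_ge0 ?dot_gt0.
have ds := is_derive1_sqrt s0.
have dq : is_derive p.2 (1 : R) (fun t : R => t ^+ 2 + dot p.1 p.1) (2 * p.2).
  by apply: is_derive_eq; rewrite /GRing.scale /=; ring.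
have := @is_derive1_comp _ _ (fun t : R => t ^+ 2 + dot p.1 p.1) _ _ _ ds dq.
by move/is_derive_eq; apply; rewrite -/(rad p) /GRing.scale /=; field; rewrite gt_eqF.
Qed.

Section family.
Context (I : Type).
Implicit Types (f g : I -> X -> R) (n k : nat).

(* Uniformly in the index and off the axis, the j-th derivative in t is
   O(rad ^ (m - j)) for all j <= n. *)
Fixpoint symbol n m f : Prop :=
  [/\ forall i, measurable_fun offaxis (f i),
      exists C, forall i p, offaxis p -> `|f i p| <= C * rad p ^ m &
      if n is k.+1 then
        (forall i p, offaxis p -> derivable (fun t => f i (p.1, t)) p.2 1) /\
        symbol k (m - 1) (fun i => dt (f i))
      else True].

Lemma symbol_bound n m f : symbol n m f ->
  exists C, forall i p, offaxis p -> `|f i p| <= C * rad p ^ m.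
Proof. by case: n => [|n] []. Qed.

Lemma symbol_measurable n m f : symbol n m f -> forall i, measurable_fun offaxis (f i).
Proof. by case: n => [|n] []. Qed.

(** The set [offaxis] is a union of full lines in the [t] direction, so agreement there passes to
    [t]-derivatives. *)
Lemma eq_dt (f g : X -> R) : {in offaxis, f =1 g} -> {in offaxis, dt f =1 dt g}.
Proof.
move=> fg p /set_mem p0; rewrite /dt; congr (derive1 _ _).
by apply/funext => t; apply: fg; rewrite inE.
Qed.

Lemma eq_symbol n m f g : (forall i, {in offaxis, f i =1 g i}) -> symbol n m f -> symbol n m g.
Proof.
elim: n m f g => [|n IH] m f g fg [mf [C fC] Hf]; split.
- by move=> i; apply: eq_measurable_fun (mf i).
- by exists C => i p p0; rewrite -fg ?inE //; exact: fC.
- by [].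
- by move=> i; apply: eq_measurable_fun (mf i).
- by exists C => i p p0; rewrite -fg ?inE //; exact: fC.
case: Hf => df sf; split; last by apply: (IH _ _ _ _ sf) => i; exact: eq_dt.
move=> i p p0; rewrite -(_ : (fun t => f i (p.1, t)) = (fun t => g i (p.1, t)));
  first exact: df.
by apply/funext => t; apply: fg; rewrite inE.
Qed.

(** The form used in practice: any closed formula [g] for the derivative off the axis may stand in
    for [dt]. *)
Lemma symbolS n m f g :
  (forall i, measurable_fun offaxis (f i)) ->
  (exists C, forall i p, offaxis p -> `|f i p| <= C * rad p ^ m) ->
  (forall i p, offaxis p -> is_derive p.2 (1 : R) (fun t => f i (p.1, t)) (g i p)) ->
  symbol n (m - 1) g -> symbol n.+1 m f.
Proof.
move=> mf fC df sg; split => //; split; first by move=> i p p0; have [] := df i p p0.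
apply: eq_symbol sg => i p /set_mem p0; rewrite /dt derive1E.
by have [_ ->] := df i p p0.
Qed.

Lemma symbolW n m f : symbol n.+1 m f -> symbol n m f.
Proof.
elim: n m f => [|n IH] m f [mf bf [df sf]]; split => //.
by split => //; exact: IH.
Qed.

Lemma symbol_is_derive n m f i p : symbol n.+1 m f -> offaxis p ->
  is_derive p.2 (1 : R) (fun t => f i (p.1, t)) (dt (f i) p).
Proof.
by move=> [_ _ [df _]] p0; split; [exact: df|rewrite /dt derive1E].
Qed.

Lemma symbol_dt n m f : symbol n.+1 m f -> symbol n (m - 1) (fun i => dt (f i)).
Proof. by move=> [_ _ []]. Qed.

Lemma symbolD n m f g : symbol n m f -> symbol n m g ->
  symbol n m (fun i p => f i p + g i p).
Proof.
elim: n m f g => [|n IH] m f g sf sg.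
  have [mf [C fC] _] := sf; have [mg [D gD] _] := sg; split => //.
    by move=> i; exact: measurable_funD.
  exists (C + D) => i p p0; rewrite mulrDl (le_trans (ler_normD _ _)) // lerD //.
    exact: fC.
  exact: gD.
have [mf [C fC] _] := sf; have [mg [D gD] _] := sg.
apply: (@symbolS _ _ _ (fun i p => dt (f i) p + dt (g i) p)).
- by move=> i; exact: measurable_funD.
- exists (C + D) => i p p0; rewrite mulrDl (le_trans (ler_normD _ _)) // lerD //.
    exact: fC.
  exact: gD.
- move=> i p p0.
  exact: (is_deriveD (symbol_is_derive i sf p0) (symbol_is_derive i sg p0)).
- by apply: IH; exact: symbol_dt.
Qed.

Lemma symbolM n m l f g : symbol n m f -> symbol n l g ->
  symbol n (m + l) (fun i p => f i p * g i p).
Proof.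
have bM m1 (l1 : int) C D (u v : I -> X -> R) :
    (forall i p, offaxis p -> `|u i p| <= C * rad p ^ m1) ->
    (forall i p, offaxis p -> `|v i p| <= D * rad p ^ l1) ->
    forall i p, offaxis p -> `|u i p * v i p| <= C * D * rad p ^ (m1 + l1).
  move=> uC vD i p p0; have r0 : rad p != 0 by rewrite gt_eqF // rad_gt0.
  by rewrite normrM expfzDr // mulrACA ler_pM ?normr_ge0 ?uC ?vD.
elim: n m l f g => [|n IH] m l f g sf sg.
  have [mf [C fC] _] := sf; have [mg [D gD] _] := sg; split => //.
    by move=> i; exact: measurable_funM.
  by exists (C * D); exact: bM.
have [mf [C fC] _] := sf; have [mg [D gD] _] := sg.
apply: (@symbolS _ _ _ (fun i p => f i p * dt (g i) p + g i p * dt (f i) p)).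
- by move=> i; exact: measurable_funM.
- by exists (C * D); exact: bM.
- move=> i p p0.
  have := is_deriveM (symbol_is_derive i sf p0) (symbol_is_derive i sg p0).
  by rewrite /GRing.scale /= -!surjective_pairing.
- apply: symbolD.
    by rewrite -addrA; apply: IH; [exact: symbolW sf|exact: symbol_dt sg].
  by rewrite addrAC addrC; apply: IH; [exact: symbolW sg|exact: symbol_dt sf].
Qed.

Lemma symbolN n m f : symbol n m f -> symbol n m (fun i p => - f i p).
Proof.
elim: n m f => [|n IH] m f sf; have [mf [C fC] _] := sf.
  split => //; first by move=> i; exact: measurable_funN.
  by exists C => i p p0; rewrite normrN; exact: fC.
apply: (@symbolS _ _ _ (fun i p => - dt (f i) p)).
- by move=> i; exact: measurable_funN.
- by exists C => i p p0; rewrite normrN; exact: fC.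
- by move=> i p p0; exact: (is_deriveN (symbol_is_derive i sf p0)).
- by apply: IH; exact: symbol_dt sf.
Qed.

Lemma symbol0 n m : symbol n m (fun _ _ => 0).
Proof.
elim: n m => [|n IH] m.
  by split => //; exists 0 => i p p0; rewrite normr0 mul0r.
apply: (@symbolS _ _ _ (fun _ _ => 0)) => //.
  by exists 0 => i p p0; rewrite normr0 mul0r.
by move=> i p p0; exact: is_derive_cst.
Qed.

Lemma symbol_cst n (c : I -> R) (C : R) : (forall i,
  `|c i| <= C) -> symbol n 0 (fun i _ => c i).
Proof.
move=> cC; have bc : exists C, forall i p, offaxis p -> `|c i| <= C * rad p ^ 0.
  by exists C => i p p0; rewrite expr0z mulr1.
case: n => [|n]; first by split.
apply: (@symbolS _ _ _ (fun _ _ => 0)) => //; last exact: symbol0.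
by move=> i p p0; exact: is_derive_cst.
Qed.

Lemma symbol_snd n : symbol n 1 (fun _ p => p.2).
Proof.
have b1 : exists C, forall (i : I) p, offaxis p -> `|p.2| <= C * rad p ^ 1.
  by exists 1 => i p p0; rewrite mul1r expr1z normr_snd_le_rad.
have m1 : I -> measurable_fun offaxis (fun p : X => p.2).
  by move=> i; apply: measurable_funTS; exact: measurable_snd.
case: n => [|n]; first by split.
apply: (@symbolS _ _ _ (fun _ _ => 1)) => //.
by rewrite subrr; apply: (@symbol_cst _ _ 1) => ?; rewrite normr1.
Qed.

Lemma symbol_coord n j : symbol n 1 (fun _ p => p.1 0 j).
Proof.
have b1 : exists C, forall (i : I) p, offaxis p -> `|p.1 0 j| <= C * rad p ^ 1.
  by exists 1 => i p p0; rewrite mul1r expr1z normr_coord_le_rad.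
have m1 : I -> measurable_fun offaxis (fun p : X => p.1 0 j).
  move=> i; apply: measurable_funTS.
  apply: (@measurableT_comp _ _ _ _ _ _ (@rV_coord R d j)); last exact: measurable_fst.
  exact: measurable_rV_coord.
case: n => [|n]; first by split.
apply: (@symbolS _ _ _ (fun _ _ => 0)) => //; last exact: symbol0.
by move=> i p p0; exact: is_derive_cst.
Qed.

Lemma symbol_rad_pair n :
  symbol n 1 (fun _ => rad) /\ symbol n (- 1) (fun _ p => (rad p)^-1).
Proof.
have m1 : I -> measurable_fun offaxis rad.
  by move=> _; apply: measurable_funTS; exact: measurable_rad.
have mV : I -> measurable_fun offaxis (fun p => (rad p)^-1).
  move=> i; apply: measurable_funTS.
  rewrite (_ : (fun p => _) = (fun p => rad p `^ (- 1))); last first.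
    by apply/funext => p; rewrite powR_inv1 ?sqrtr_ge0.
  apply: (@measurableT_comp _ _ _ _ _ _ (fun r : R => r `^ (- 1))).
    exact: measurable_powR.
  exact: measurable_rad.
have b1 : exists C, forall (i : I) p, offaxis p -> `|rad p| <= C * rad p ^ 1.
  by exists 1 => i p p0; rewrite mul1r expr1z ger0_norm ?sqrtr_ge0.
have bV : exists C, forall (i : I) p, offaxis p -> `|(rad p)^-1| <= C * rad p ^ (- 1).
  by exists 1 => i p p0; rewrite mul1r exprN1 ger0_norm ?invr_ge0 ?sqrtr_ge0.
elim: n => [|n [IH IHV]]; first by split; split.
split.
  apply: (@symbolS _ _ _ (fun _ p => p.2 * (rad p)^-1)) => //.
    by move=> i p p0; exact: is_derive_rad.
  by apply: symbolM => //; exact: symbol_snd.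
apply: (@symbolS _ _ _ (fun _ p => - (p.2 * ((rad p)^-1 * ((rad p)^-1 * (rad p)^-1))))) => //.
  move=> i p p0; have r0 : rad (p.1, p.2) != 0 by rewrite gt_eqF // rad_gt0.
  have := @is_deriveV _ (fun t => rad (p.1, t)) p.2 _ 1 r0 (is_derive_rad p0).
  move/is_derive_eq; apply; rewrite /GRing.scale /= -surjective_pairing in r0 *.
  by field.
apply: symbolN; rewrite (_ : - 1 - 1 = 1 + (- 1 + (- 1 + -1))) //.
by apply: symbolM; [exact: symbol_snd|apply: symbolM => //; exact: symbolM].
Qed.

Lemma symbol_rad n : symbol n 1 (fun _ => rad).
Proof. by have [] := symbol_rad_pair n. Qed.

Lemma symbol_radV n : symbol n (- 1) (fun _ p => (rad p)^-1).
Proof. by have [] := symbol_rad_pair n. Qed.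

(** By the chain rule each [t]-derivative trades [h] for its derivative, one order lower, times
    [p.2 * (rad p)^-1], which is of order 0. *)
Lemma symbol_radial n m (h : I -> R -> R) :
  (forall k i, measurable_fun setT (derive1n k (h i))) ->
  (forall k i r, 0 < r -> derivable (derive1n k (h i)) r 1) ->
  (forall k, exists C, forall i r, 0 < r -> `|derive1n k (h i) r| <= C * r ^ (m - k%:Z)) ->
  symbol n m (fun i p => h i (rad p)).
Proof.
elim: n m h => [|n IH] m h mh dh bh.
  split => //.
    move=> i; apply: measurable_funTS; apply: measurableT_comp; last exact: measurable_rad.
    exact: (mh 0%N).
  have [C hC] := bh 0%N; exists C => i p p0.
  by have := hC i (rad p) (rad_gt0 p0); rewrite subr0.
apply: (@symbolS _ _ _ (fun i p => derive1 (h i) (rad p) * (p.2 * (rad p)^-1))).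
- move=> i; apply: measurable_funTS; apply: measurableT_comp; last exact: measurable_rad.
  exact: (mh 0%N).
- have [C hC] := bh 0%N; exists C => i p p0.
  by have := hC i (rad p) (rad_gt0 p0); rewrite subr0.
- move=> i p p0.
  have dhr : is_derive (rad (p.1, p.2)) (1 : R) (h i) (derive1 (h i) (rad p)).
    rewrite -surjective_pairing; split; first exact: (dh 0%N i _ (rad_gt0 p0)).
    by rewrite derive1E.
  exact: (@is_derive1_comp _ _ (fun t => rad (p.1, t)) _ _ _ dhr (is_derive_rad p0)).
rewrite -[X in symbol _ X _]addr0; apply: symbolM.
  apply: (IH _ (fun i => derive1 (h i))) => [k i|k i r r0|k].
  - by rewrite -derive1Sn; exact: mh.
  - by rewrite -derive1Sn; exact: dh.
  have [C hC] := bh k.+1; exists C => i r r0.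
  by rewrite -derive1Sn (le_trans (hC i r r0)) // -addrA -opprD -intS.
rewrite (_ : 0 = 1 + -1) //; apply: symbolM; [exact: symbol_snd|exact: symbol_radV].
Qed.

End family.
End symbol_class.

(** * Symbol estimates for the cut-off and the exponential factor *)

Section cutoff_symbol.
Context (R : realType) (d : nat) (chi h : R -> R) (a b : R).
Hypotheses (a_gt0 : 0 < a) (b_gt0 : 0 < b).
Hypothesis h_smooth : forall n r, derivable (derive1n n h) r 1.
Hypothesis chi_h : forall r, 0 <= r -> chi r = h r.
Hypothesis chi01 : forall r, 0 <= r -> 0 <= chi r <= 1.
Hypothesis chi_eq1 : forall r, 0 <= r <= 1 -> chi r = 1.
Hypothesis chi_eq0 : forall r, 2 <= r -> chi r = 0.
Local Notation X := ('rV[R]_d * R)%type.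
Implicit Types (p : X) (m : int) (r : R) (n k : nat).

Let continuous_derive1n_h k : continuous (derive1n k h).
Proof. by move=> r; apply: differentiable_continuous; apply/derivable1_diffP. Qed.

Let derive1_locally_cst (g : R -> R) (u v c : R) : (forall r, u < r < v -> g r = c) ->
  forall r, u < r < v -> derive1 g r = 0.
Proof.
move=> gc r ruv; rewrite derive1E (@near_eq_derive _ _ _ _ (cst c)) ?derive_cst ?oner_neq0 //.
have : nbhs r `]u, v[%classic.
  by apply: open_nbhs_nbhs; split; [exact: interval_open|rewrite /= in_itv].
by apply: filterS => s; rewrite /= in_itv /= => /gc.
Qed.

Let derive1n_locally_cst k (u v c : R) : (forall r, u < r < v -> h r = c) ->
  forall r, u < r < v -> derive1n k.+1 h r = 0.
Proof.
move=> hc; elim: k => [|k IH]; first by move=> r ruv; rewrite derive1n1;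
  exact: (derive1_locally_cst hc ruv).
by move=> r ruv; rewrite derive1nS; exact: (derive1_locally_cst IH ruv).
Qed.

(** The values of [h] are known only on the half-line, where it agrees with [chi]; the open
    intervals (0, 1) and (2, r + 1) stay inside it. *)
Let derive1n_h_eq0 k r : 0 < r -> r < 1 \/ 2 < r -> derive1n k.+1 h r = 0.
Proof.
move=> r0 [r1|r2].
  apply: (@derive1n_locally_cst k 0 1 1); last by rewrite r0.
  by move=> s /andP[s0 s1]; rewrite -chi_h ?chi_eq1 ?ltW.
apply: (@derive1n_locally_cst k 2 (r + 1) 0); last by rewrite r2 ltrDl ltr01.
by move=> s /andP[s2 _]; rewrite -chi_h ?chi_eq0 ?ltW // (lt_trans _ s2).
Qed.

Let exprz_12_ge m r : 1 <= r <= 2 -> 1 <= 2 ^+ absz m * r ^ m.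
Proof.
move=> /andP[r1 r2]; have r0 : 0 < r by rewrite (lt_le_trans ltr01).
case: m => n /=; first by rewrite mulr_ege1 // exprn_ege1 // ler1n.
by rewrite NegzE -exprnN ler_pdivlMr ?exprn_gt0 // mul1r lerXn2r ?nnegrE // ltW.
Qed.

(* The derivatives of chi live in 1 <= r <= 2, where all powers of r are comparable. *)
Let derive1n_h_flat k m : exists C, forall r, 0 < r -> `|derive1n k.+1 h r| <= C * r ^ m.
Proof.
have le12 : (1 : R) <= 2 by rewrite ler1n.
have [c _ hc] := @EVT_max R (fun r => `|derive1n k.+1 h r|) 1 2 le12
  (continuous_subspaceT (fun r => continuous_comp (@continuous_derive1n_h _ r)
    (@norm_continuous _ _ _))).
exists (`|derive1n k.+1 h c| * 2 ^+ absz m) => r r0.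
have [r1|r1] := ltP r 1; first by rewrite derive1n_h_eq0 ?normr0 ?mulr_ge0 ?exprz_ge0 ?(ltW
  r0) //; left.
have [r2|r2] := ltP 2 r; first by rewrite derive1n_h_eq0 ?normr0 ?mulr_ge0 ?exprz_ge0 ?(ltW
  r0) //; right.
rewrite -mulrA; apply: (le_trans (hc r _)); first by rewrite in_itv /= r1.
by rewrite ler_peMr // exprz_12_ge // r1.
Qed.

Let chi_decay m : m <= 0 -> exists C, forall r, 0 < r -> `|h r| <= C * r ^ m.
Proof.
case: m => [[|//]|n] _.
  exists 1 => r r0; rewrite expr0z mulr1 -(chi_h (ltW r0)) ger0_norm.
    by have /andP[] := chi01 (ltW r0).
  by have /andP[] := chi01 (ltW r0).
exists (2 ^+ n.+1) => r r0.
have [/ltW r2|r2] := ltP 2 r.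
  by rewrite -(chi_h (ltW r0)) chi_eq0 // normr0 mulr_ge0 ?exprz_ge0 ?ltW.
rewrite -(chi_h (ltW r0)) ger0_norm; last by have /andP[] := chi01 (ltW r0).
have /andP[_ /le_trans] := chi01 (ltW r0); apply.
by rewrite NegzE -exprnN ler_pdivlMr ?exprn_gt0 // mul1r lerXn2r ?nnegrE // ltW.
Qed.

Let derive1n_scale e k : derive1n k (fun r => h (e * r)) = (fun r => e ^+ k * derive1n k h (e
  * r)).
Proof.
elim: k => [|k IH]; first by apply/funext => r; rewrite mul1r.
apply/funext => r; rewrite derive1nS IH derive1E.
have dh : is_derive (e * r) (1 : R) (derive1n k h) (derive1n k.+1 h (e * r)).
  by split => //; rewrite derive1nS derive1E.
have de : is_derive r (1 : R) (fun r : R => e * r) e.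
  by apply: is_derive_eq; rewrite /GRing.scale /= mulr1.
have := @is_derive1_comp _ _ (fun r : R => e * r) _ _ _ dh de.
move=> /(is_deriveZ (e ^+ k))[_ dE].
by rewrite (_ : (fun r => _) = e ^+ k \*: (derive1n k h \o (fun r => e * r))) // dE
  /GRing.scale /= exprSr; ring.
Qed.

Section index.
Context (I : Type).

(** Positive orders are excluded since [chi] is 1 near the origin; every order up to 0 is allowed
    since it vanishes from 2 on. *)
Lemma symbol_chi n m : m <= 0 -> symbol n m (fun (_ : I) p => chi (rad p)).
Proof.
move=> m0; apply: (@eq_symbol _ _ _ _ _ (fun _ p => h (rad p))).
  by move=> i p p0; rewrite chi_h // sqrtr_ge0.
apply: (@symbol_radial _ _ _ _ _ (fun=> h)) => [k i|k i r r0|[|k]] //.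
- exact: continuous_measurable_fun.
- by rewrite subr0; have [C hC] := chi_decay m0; exists C => i; exact: hC.
- by have [C hC] := derive1n_h_flat k (m - k.+1%:Z); exists C => i; exact: hC.
Qed.

Let dchi p : R := derive1 h (rad p) * (p.2 * (rad p)^-1).

Let symbol_dchi n m : symbol n m (fun _ : I => dchi).
Proof.
rewrite -[m]addr0; apply: symbolM; last first.
  by rewrite -(subrr 1); apply: symbolM; [exact: symbol_snd|exact: symbol_radV].
apply: (@symbol_radial _ _ _ _ _ (fun=> derive1 h)) => [k i|k i r r0|k] //.
- by rewrite -derive1Sn; exact: continuous_measurable_fun.
- by rewrite -derive1Sn.
- by rewrite -derive1Sn; have [C hC] := derive1n_h_flat k (m - k%:Z); exists C => i; exact: hC.
Qed.

Let is_derive_chi p : offaxis p -> is_derive p.2 (1 : R) (fun t => chi (rad (p.1, t))) (dchi p).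
Proof.
move=> p0.
have dh : is_derive (rad (p.1, p.2)) (1 : R) h (derive1 h (rad p)).
  rewrite -surjective_pairing; split; first by have := @h_smooth 0%N (rad p); rewrite derive1n0.
  by rewrite derive1E.
rewrite (_ : (fun t => _) = h \o (fun t => rad (p.1, t))).
  exact: (@is_derive1_comp _ h (fun t => rad (p.1, t)) _ _ _ dh (is_derive_rad p0)).
by apply/funext => t /=; rewrite chi_h // sqrtr_ge0.
Qed.

Definition exponent r : R := - b * r + a * chi r * r.

Let symbol_exponent n : symbol n 1 (fun (_ : I) p => exponent (rad p)).
Proof.
apply: symbolD.
  rewrite -[1]add0r; apply: symbolM; last exact: symbol_rad.
  by apply: (@symbol_cst _ _ _ _ (fun=> - b) `|b|) => i; rewrite normrN.
rewrite -[1]add0r; apply: symbolM; last exact: symbol_rad.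
rewrite -[0]add0r; apply: symbolM; last exact: symbol_chi.
exact: (@symbol_cst _ _ _ _ (fun=> a) `|a|).
Qed.

Let exponent_le r : 0 <= r -> exponent r <= - b * r + a * 2.
Proof.
move=> r0; rewrite /exponent lerD2l -mulrA ler_wpM2l ?(ltW a_gt0) //.
have [r2|r2] := leP 2 r; first by rewrite chi_eq0 // mul0r.
have /andP[c0 c1] := chi01 r0.
by rewrite -[2]mul1r ler_pM // ltW.
Qed.

Let expR_exponent_decay m : m <= 0 -> exists C, forall r, 0 < r ->
  `|expR (exponent r)| <= C * r ^ m.
Proof.
move=> m0; have [n ->] : exists n, m = - n%:Z.
  by case: m m0 => [[|//]|n] _; [exists 0%N|exists n.+1; rewrite NegzE].
(* The first factor comes from chi(r) r <= 2, the second from the term (b r)^n / n! of the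
   exponential series. *)
exists (expR (a * 2) * (n`!%:R / b ^+ n)) => r r0.
rewrite ger0_norm ?expR_ge0 // (le_trans (_ : _ <= expR (- b * r + a * 2))) //.
  by rewrite ler_expR exponent_le ?ltW.
rewrite addrC expRD -mulrA ler_wpM2l ?expR_ge0 // mulNr expRN -[X in X <= _]div1r.
rewrite ler_pdivrMr ?expR_gt0 //.
have br0 : 0 <= b * r by rewrite mulr_ge0 ?ltW.
have : (b * r) ^+ n / n`!%:R <= expR (b * r).
  case: n => [|n]; first by rewrite expr0 divr1 -[1]addr0 (le_trans _ (expR_ge1Dx _)) ?lerD2l.
  by apply: le_trans (expR_ge1Dxn n br0); rewrite lerDr.
rewrite ler_pdivrMr ?ltr0n ?fact_gt0 // exprMn => brn.
have b_n : 0 < b ^+ n by rewrite exprn_gt0.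
have r_n : 0 < r ^+ n by rewrite exprn_gt0.
rewrite -exprnN (_ : _ * _ = expR (b * r) * n`!%:R / (b ^+ n * r ^+ n)).
  by rewrite ler_pdivlMr ?mulr_gt0 // mul1r.
by field; rewrite !gt_eqF.
Qed.

Let is_derive_expR_exponent (i : I) p : offaxis p ->
  is_derive p.2 (1 : R) (fun t => expR (exponent (rad (p.1, t))))
    (expR (exponent (rad p)) * dt (fun p => exponent (rad p)) p).
Proof.
move=> p0; have dE := symbol_is_derive i (symbol_exponent 1) p0.
have := @is_derive1_comp _ expR (fun t => exponent (rad (p.1, t))) _ _ _
  (is_derive_expR _) dE.
by rewrite -surjective_pairing.
Qed.

(** The exponent has order 1, so its derivative has order 0 and brings no decay. The lost order is
    recovered from the exponential, which has every order up to 0 and is used at [m - 1] in the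
    induction. *)
Lemma symbol_expR_exponent n m : m <= 0 ->
  symbol n m (fun (_ : I) p => expR (exponent (rad p))).
Proof.
have mE : I -> measurable_fun (@offaxis R d) (fun p => expR (exponent (rad p))).
  move=> i; apply: measurableT_comp; first exact: measurable_expR.
  exact: (symbol_measurable (symbol_exponent 0) i).
elim: n m => [|n IH] m m0; have [C hC] := expR_exponent_decay m0.
  by split => //; exists C => i p p0; apply: hC; exact: rad_gt0.
apply: (@symbolS _ _ _ _ _ _
  (fun i p => expR (exponent (rad p)) * dt (fun p => exponent (rad p)) p)) => //.
- by exists C => i p p0; apply: hC; exact: rad_gt0.
- rewrite -[m - 1]addr0; apply: symbolM.
    by apply: IH; rewrite (le_trans _ m0) // gerBl.
  by have := symbol_dt (symbol_exponent n.+1); rewrite subrr.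
Qed.

Lemma symbol_dt_chi n m : symbol n m (fun _ : I => dt (fun p => chi (rad p))).
Proof.
apply: (@eq_symbol _ _ _ _ _ (fun _ => dchi)) (symbol_dchi n m) => i p /set_mem p0.
by have [_ <-] := is_derive_chi p0; rewrite /dt derive1E.
Qed.

(** The cancellation behind the splitting: near the origin [chi] is 1 and the exponent is (a - b) r,
    so the difference is O(r); from radius 1 on, boundedness is enough. Only the function itself
    needs this, because its derivative has to be merely of order 0 = 1 - 1. *)
Lemma symbol_expR_exponent_sub n : symbol n 1
  (fun (_ : I) p => expR (exponent (rad p)) - chi (rad p)).
Proof.
have m0 := symbolD (symbol_expR_exponent 0 (lexx 0)) (symbolN (symbol_chi 0 (lexx 0))).
have bnd : exists C, forall (i : I) p, offaxis p ->
    `|expR (exponent (rad p)) - chi (rad p)| <= C * rad p ^ 1.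
  have [C hC] := symbol_bound m0; have C0 : 0 <= `|C| := normr_ge0 C.
  pose c := `|- b + a|; exists (`|C| + c * expR c) => i p p0; have r0 := rad_gt0 p0.
  rewrite expr1z; have [r1|r1] := leP 1 (rad p).
    have := hC i p p0; rewrite expr0z mulr1 => /le_trans; apply.
    rewrite (le_trans (ler_norm C)) // (le_trans (_ : _ <= `|C| + c * expR c)) //.
      by rewrite lerDl mulr_ge0 ?expR_ge0 /c.
    by rewrite ler_peMr // addr_ge0 ?mulr_ge0 ?expR_ge0 /c.
  have -> : chi (rad p) = 1 by rewrite chi_eq1 // !ltW.
  have -> : exponent (rad p) = (- b + a) * rad p.
    by rewrite /exponent chi_eq1 ?mulr1 ?mulrDl // !ltW.
  set y := (- b + a) * rad p.
  have yc : `|y| <= c by rewrite normrM (gtr0_norm r0) ler_piMr ?normr_ge0 ?ltW.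
  (* Both signs of [y] follow from 1 + y <= e^y and 1 - y <= e^(-y). *)
  have yE : `|expR y - 1| <= `|y| * expR `|y|.
    have e1 := expR_ge1Dx y; have := expR_ge1Dx (- y).
    have p1 := expR_gt0 y; rewrite expRN -div1r ler_pdivlMr // mulrBl mul1r => e2.
    have [y0|y0] := leP 0 y.
      rewrite (ger0_norm y0) ger0_norm; first by lra.
      by rewrite subr_ge0 (le_trans _ e1) // lerDl.
    have em : 1 <= expR (- y) by rewrite -expR0 ler_expR oppr_ge0 ltW.
    rewrite (ltr0_norm y0) ler0_norm; last by rewrite subr_le0 -expR0 ler_expR ltW.
    rewrite opprB (le_trans (_ : _ <= - y)) //; first by lra.
    by rewrite ler_peMr // oppr_ge0 ltW.
  rewrite (le_trans yE) // mulrDl (le_trans (_ : _ <= c * expR c * rad p)) //; last first.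
    by rewrite lerDr mulr_ge0 // ltW.
  rewrite mulrAC ler_pM ?expR_ge0 ?normr_ge0 ?ler_expR //.
  by rewrite normrM (gtr0_norm r0).
case: n => [|n].
  by split => // i; exact: symbol_measurable m0 i.
apply: (@symbolS _ _ _ _ _ _ (fun i p =>
    dt (fun p => expR (exponent (rad p))) p - dchi p)) => //.
- by move=> i; exact: symbol_measurable m0 i.
- move=> i p p0.
  exact: (is_deriveB (symbol_is_derive i (symbol_expR_exponent 1 (lexx 0)) p0) (is_derive_chi
    p0)).
rewrite subrr; apply: symbolD; last by apply: symbolN; exact: symbol_dchi.
apply: (@eq_symbol _ _ _ _ _ (fun i p =>
    expR (exponent (rad p)) * dt (fun p => exponent (rad p)) p)); last first.
  rewrite -[0]addr0; apply: symbolM; first exact: symbol_expR_exponent.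
  by have := symbol_dt (symbol_exponent n.+1); rewrite subrr.
move=> i p /set_mem p0.
have [_ <-] := is_derive_expR_exponent i p0.
by rewrite /dt derive1E.
Qed.

(* d_t^2 (x chi) involves only derivatives of chi, so it is flat even where x chi is not. *)
Lemma symbol_dt_mul_chi n (u : X -> R) : symbol n.+1 1 (fun _ : I => u) ->
  forall m, symbol n m (fun (_ : I) p => dt (fun p => u p * chi (rad p)) p - dt u p * chi
    (rad p)).
Proof.
move=> su m; apply: (@eq_symbol _ _ _ _ _ (fun _ p => u p * dchi p)); last first.
  by rewrite -[m](subrK 1) addrC; apply: symbolM; [exact: symbolW|exact: symbol_dchi].
move=> i p /set_mem p0.
have := is_deriveM (symbol_is_derive i su p0) (is_derive_chi p0).
rewrite /GRing.scale /= -!surjective_pairing => -[_ dE].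
rewrite [X in _ = X - _]/dt derive1E.
rewrite (_ : (fun t => _) = (fun t => u (p.1, t)) * (fun t => chi (rad (p.1, t)))) // dE.
by ring.
Qed.

End index.
(** Scale invariance: the k-th derivative of chi(e r) is e^k times a quantity of size (e r)^(-k),
    and the powers of [e] cancel. Symbols are indexed families so that this uniformity in [e] can be
    expressed. *)
Lemma symbol_chi_scale n :
  symbol n 0 (fun (e : {posnum R}) p => chi (e%:num * rad p)).
Proof.
apply: (@eq_symbol _ _ _ _ _ (fun (e : {posnum R}) p => h (e%:num * rad p))).
  by move=> e p p0; rewrite chi_h // mulr_ge0 ?sqrtr_ge0.
apply: (@symbol_radial _ _ _ _ _ (fun (e : {posnum R}) r => h (e%:num * r))) => [k e|k e r
  r0|k].
- apply: continuous_measurable_fun; rewrite derive1n_scale => r.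
  apply: cvgM; first exact: cvg_cst.
  apply: (@cvg_comp _ _ _ (fun r => e%:num * r) (derive1n k h));
    last exact: continuous_derive1n_h.
  by apply: cvgM; [exact: cvg_cst|exact: cvg_id].
- rewrite derive1n_scale; apply: derivableM; first exact: derivable_cst.
  have de : derivable (fun r : R => e%:num * r) r 1 by apply: derivableM;
    [exact: derivable_cst|exact: derivable_id].
  by apply/derivable1_diffP; apply: differentiable_comp; apply/derivable1_diffP.
have [C hC] : exists C, forall r, 0 < r -> `|derive1n k h r| <= C * r ^ (- k%:Z).
  case: k => [|k]; first exact: chi_decay.
  exact: derive1n_h_flat.
exists C => e r r0; rewrite derive1n_scale normrM ger0_norm ?exprn_ge0 //.
have er0 : 0 < e%:num * r by rewrite mulr_gt0.
rewrite (le_trans (ler_wpM2l _ (hC _ er0))) ?exprn_ge0 // sub0r -!exprnN exprMn.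
by rewrite le_eqVlt; apply/orP; left; apply/eqP; field; rewrite !gt_eqF ?exprn_gt0.
Qed.

End cutoff_symbol.

(** * Oscillatory integrals *)

Section oscillatory_integral.
Context (R : realType) (d : nat).
Local Notation X := ('rV[R]_d * R)%type.
Local Notation mu := (@lebesgue_measure R).
Local Notation P := (@leb_rV R d \x mu)%E.
Local Notation off := (@offaxis R d).
Implicit Types (p : X) (f g : X -> R) (e k th : R) (eta : 'rV[R]_d).

(** An integrable majorant at scale [e], whose integral does not depend on [e]. Functions bounded on
    radius at most 2e, or of size rad^(-2(d+1)) beyond radius e, are compared with it. *)
Definition weight e p : R := \prod_(i < d.+1) poisson e (cons_rV p 0 i).

Lemma weight_ge0 e p : 0 < e -> 0 <= weight e p.
Proof. by move=> e0; apply: prodr_ge0 => i _; exact: poisson_ge0. Qed.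

Let measurable_poisson e : 0 < e -> measurable_fun setT (poisson e).
Proof.
move=> e0; apply: continuous_measurable_fun.
by have := continuous_poisson (t := 0) e0; under eq_fun do rewrite subr0.
Qed.

Let integral_tensor_poisson e : 0 < e ->
  (\int[lebesgue_rV R d.+1]_x (\prod_(i < d.+1) poisson e (x 0 i))%:E =
   ((pi : R) ^+ d.+1)%:E)%E.
Proof.
move=> e0; rewrite (@ge0_integral_tensor _ _ (fun=> poisson e)); last 2 first.
- by move=> _; exact: measurable_poisson.
- by move=> _ t; exact: poisson_ge0.
under eq_bigr do under eq_integral do rewrite -[X in poisson e X]subr0.
under eq_bigr do rewrite integral_poisson //.
by rewrite prodEFin prodr_const card_ord.
Qed.

Let measurable_tensor_poisson e : 0 < e ->
  measurable_fun setT (fun x : 'rV[R]_d.+1 => \prod_(i < d.+1) poisson e (x 0 i)).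
Proof.
by move=> e0; apply: (@measurable_tensor _ _ (fun=> poisson e)) => _; exact: measurable_poisson.
Qed.

Lemma measurable_weight e : 0 < e -> measurable_fun setT (weight e).
Proof.
move=> e0; apply: (@measurableT_comp _ _ _ _ _ _
  (fun x : 'rV[R]_d.+1 => \prod_(i < d.+1) poisson e (x 0 i))).
  exact: measurable_tensor_poisson.
exact: measurable_cons_rV.
Qed.

Lemma integral_weight e : 0 < e -> (\int[P]_p (weight e p)%:E = ((pi : R) ^+ d.+1)%:E)%E.
Proof.
move=> e0; rewrite -(integral_tensor_poisson e0); apply/esym.
apply: (@ge0_integral_pushforward _ _ _ _ _ _ _ P setT) => //.
- exact: measurable_cons_rV.
- by apply/measurable_EFinP; exact: measurable_tensor_poisson.
- by move=> x _; rewrite lee_fin; apply: prodr_ge0 => i _; exact: poisson_ge0.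
Qed.

Lemma integrable_weight e : 0 < e -> P.-integrable setT (EFin \o weight e).
Proof.
move=> e0; apply/integrableP; split.
  by apply/measurable_EFinP; exact: measurable_weight.
under eq_integral do rewrite gee0_abs ?lee_fin ?weight_ge0 //.
by rewrite integral_weight // ltry.
Qed.

Lemma integrable_offaxis e C f : 0 < e -> measurable_fun off f ->
  (forall p, off p -> `|f p| <= C * weight e p) -> P.-integrable off (EFin \o f).
Proof.
move=> e0 mf fC; have moff := @measurable_offaxis R d.
apply: (@le_integrable _ _ _ P off moff _ (fun p => (`|C| * weight e p)%:E)).
- exact/measurable_EFinP.
- move=> p p0 /=; rewrite lee_fin (le_trans (fC p p0)) // ger0_norm ?mulr_ge0 ?weight_ge0 //.
  by rewrite ler_wpM2r ?weight_ge0 ?ler_norm.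
- apply: (integrableS measurableT) => //.
  by under eq_fun do rewrite EFinM; apply: integrableZl => //; exact: integrable_weight.
Qed.

Lemma le_Rintegral_weight e C f : 0 < e -> 0 <= C -> measurable_fun off f ->
  (forall p, off p -> `|f p| <= C * weight e p) ->
  \int[P]_(p in off) `|f p| <= C * (pi : R) ^+ d.+1.
Proof.
move=> e0 C0 mf fC; have moff := @measurable_offaxis R d.
rewrite -lee_fin /Rintegral fineK; last first.
  have /integrable_abse := integrable_offaxis e0 mf fC.
  rewrite (_ : (\int[_]_(x in _) _)%E = (\int[P]_(x in off) (abse \o (EFin \o f)) x)%E) //
    => fi.
  by apply: integrable_fin_num.
apply: (@le_trans _ _ (\int[P]_(p in off) (C * weight e p)%:E)%E).
  apply: ge0_le_integral => //.
  - by apply/measurable_EFinP; exact: measurableT_comp.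
  - apply/measurable_EFinP; apply: measurable_funTS.
    by apply: measurable_funM => //; exact: measurable_weight.
apply: (@le_trans _ _ (\int[P]_p (C * weight e p)%:E)%E).
  apply: ge0_subset_integral => //.
    apply/measurable_EFinP.
    by apply: measurable_funM => //; exact: measurable_weight.
  by move=> p p0; rewrite lee_fin mulr_ge0 ?weight_ge0.
under eq_integral do rewrite EFinM.
rewrite integralZl //; first by rewrite integral_weight // -EFinM.
exact: integrable_weight.
Qed.

(* For e <= rad p every factor of the weight is at least e / (2 rad^2). *)
Lemma rad_le_weight e p : 0 < e -> e <= rad p ->
  rad p ^ (- (2 * d.+1)%:Z) <= (2 / e) ^+ d.+1 * weight e p.
Proof.
move=> e0 er; have r0 : 0 < rad p := lt_le_trans e0 er.
have fac i : (2 / e)^-1 * (rad p ^+ 2)^-1 <= poisson e (cons_rV p 0 i).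
  have xr : (cons_rV p 0 i) ^+ 2 <= rad p ^+ 2.
    rewrite -[X in X <= _]real_normK ?num_real //.
    rewrite lerXn2r ?nnegrE ?normr_ge0 ?sqrtr_ge0 // mxE.
    by case: unliftP => [j _|_]; [exact: normr_coord_le_rad|exact: normr_snd_le_rad].
  have er2 : e ^+ 2 <= rad p ^+ 2 by rewrite lerXn2r // nnegrE ltW.
  rewrite /poisson invf_div -mulrA -invfM.
  rewrite ler_wpM2l ?(ltW e0) // lef_pV2 ?posrE ?poisson_denom_gt0 ?mulr_gt0 ?exprn_gt0 //.
  by rewrite mulr_natl mulr2n lerD.
have e2 : 2 / e != 0 by rewrite gt_eqF ?divr_gt0.
have -> : rad p ^ (- (2 * d.+1)%:Z) =
    (2 / e) ^+ d.+1 * \prod_(i < d.+1) ((2 / e)^-1 * (rad p ^+ 2)^-1).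
  by rewrite prodr_const card_ord -exprMn mulVKf // exprVn -exprM exprnN.
rewrite ler_pM2l ?exprn_gt0 ?divr_gt0 //; apply: ler_prod => i _; rewrite fac andbT.
by rewrite mulr_ge0 ?invr_ge0 ?divr_ge0 ?exprn_ge0 ?(ltW e0) ?(ltW r0).
Qed.

(** Each coordinate is at most 2e in absolute value, so each denominator e^2 + x_i^2 is at most 5
    e^2 and each factor at least 1 / (5e). *)
Lemma one_le_weight e p : 0 < e -> rad p <= 2 * e -> 1 <= (5 * e) ^+ d.+1 * weight e p.
Proof.
move=> e0 re; rewrite -ler_pdivrMl ?exprn_gt0 ?mulr_gt0 // mulr1 -exprVn.
rewrite (_ : _ ^+ _ = \prod_(i < d.+1) (5 * e)^-1); last by rewrite prodr_const card_ord.
apply: ler_prod => i _; rewrite invr_ge0 mulr_ge0 ?(ltW e0) //= /poisson.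
have xr : (cons_rV p 0 i) ^+ 2 <= (2 * e) ^+ 2.
  rewrite -[X in X <= _]real_normK ?num_real //
    lerXn2r ?nnegrE ?normr_ge0 ?mulr_ge0 ?(ltW e0) //.
  rewrite (le_trans _ re) // mxE.
  by case: unliftP => [j _|_]; [exact: normr_coord_le_rad|exact: normr_snd_le_rad].
rewrite ler_pdivlMr ?poisson_denom_gt0 // ler_pdivrMl ?mulr_gt0 //.
by move: xr; rewrite !expr2 => xr; lra.
Qed.

Definition phase k eta th p : R := cos (p.2 * k + dot p.1 eta + th).

Lemma measurable_phase k eta th : measurable_fun setT (phase k eta th).
Proof.
apply: (@measurableT_comp _ _ _ _ _ _ (@cos R)).
  by apply: continuous_measurable_fun; exact: continuous_cos.
apply: measurable_funD => //; apply: measurable_funD.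
  by apply: measurable_funM => //; exact: measurable_snd.
apply: (@measurableT_comp _ _ _ _ _ _ (fun y => dot y eta)); last exact: measurable_fst.
exact: measurable_dot.
Qed.

Definition osc k eta th f : R := \int[P]_(p in off) (f p * phase k eta th p).

Lemma measurable_mul_phase k eta th f : measurable_fun off f ->
  measurable_fun off (fun p => f p * phase k eta th p).
Proof.
by move=> mf; apply: measurable_funM => //; apply: measurable_funTS; exact: measurable_phase.
Qed.

Lemma normr_mul_phase k eta th f p : `|f p * phase k eta th p| <= `|f p|.
Proof. by rewrite normrM ler_piMr ?normr_ge0 // cos_max. Qed.

Lemma normr_osc_le k eta th e C f : 0 < e -> measurable_fun off f ->
  (forall p, off p -> `|f p| <= C * weight e p) ->
  `|osc k eta th f| <= \int[P]_(p in off) `|f p|.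
Proof.
move=> e0 mf fC; have moff := @measurable_offaxis R d.
have fi := integrable_offaxis e0 mf fC.
have fpi : P.-integrable off (EFin \o (fun p => f p * phase k eta th p)).
  apply: integrable_offaxis (measurable_mul_phase _ _ _ mf) _; first exact: e0.
  by move=> p p0; apply: le_trans (normr_mul_phase _ _ _ _ _) (fC p p0).
rewrite (le_trans (le_normr_Rintegral _ fpi)) //.
apply: le_Rintegral => //.
- exact: (integrable_abse fpi).
- exact: (integrable_abse fi).
- by move=> p _; exact: normr_mul_phase.
Qed.

(** At scale 1 all Poisson factors are at most 1; keeping only the one in [t] leaves the bound 1 /
    (1 + t^2). *)
Lemma weight_cvg0 y (F : R -> R) C : (forall t, `|F t| <= C * weight 1 (y, t)) ->
  F t @[t --> +oo] --> 0 /\ F t @[t --> -oo] --> 0.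
Proof.
move=> FC.
have FC' t : `|F t| <= `|C| * (t ^+ 2 + 1)^-1.
  rewrite (le_trans (FC t)) // (le_trans (ler_wpM2r _ (ler_norm C))) ?weight_ge0 //.
  rewrite ler_wpM2l // /weight big_ord_recl mxE unlift_none /= /poisson mul1r expr1n addrC.
  rewrite ler_piMr ?invr_ge0 ?addr_ge0 ?sqr_ge0 //; apply: prodr_ile1 => i _.
  rewrite divr_ge0 ?addr_ge0 ?sqr_ge0 //= ler_pdivrMr ?ltr_wpDr ?sqr_ge0 //.
  by rewrite mul1r lerDl sqr_ge0.
have dec : `|C| * (t ^+ 2 + 1)^-1 @[t --> +oo] --> 0.
  rewrite -[X in _ --> X](mulr0 `|C|); apply: cvgM; first exact: cvg_cst.
  apply/gtr0_cvgV0; first by apply: nearW => t; rewrite ltr_wpDl ?sqr_ge0.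
  apply/cvgryPge => A; near=> t.
  rewrite (le_trans (_ : _ <= t)) //.
  have t1 : 1 <= t by [].
  by rewrite (le_trans (_ : _ <= t ^+ 2)) ?lerDl // expr2 ler_peMl // (le_trans _ t1).
split; first exact: cvg0_le dec.
apply/cvgNy_compNP; apply: cvg0_le dec => t /=.
by have := FC' (- t); rewrite sqrrN.
Unshelve. all: by end_near. Qed.

(** Integration by parts in [t]. The total derivative [H] of [f] times the phase integrates to 0 on
    every line with [y != 0], since the weight forces limits 0 at both ends; Fubini then gives the
    claim. Differentiating the cosine advances its phase by pi / 2. *)
Lemma osc_dt k eta th f C C' :
  measurable_fun off f -> measurable_fun off (dt f) ->
  (forall p, off p -> `|f p| <= C * weight 1 p) ->
  (forall p, off p -> `|dt f p| <= C' * weight 1 p) ->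
  (forall p, off p -> derivable (fun t => f (p.1, t)) p.2 1) ->
  (forall p, off p -> derivable (fun t => dt f (p.1, t)) p.2 1) ->
  osc k eta th (dt f) = - k * osc k eta (th + pi / 2) f.
Proof.
move=> mf mf' fC fC' df df'; have moff := @measurable_offaxis R d.
pose H p := dt f p * phase k eta th p + k * (f p * phase k eta (th + pi / 2) p).
have i1 : P.-integrable off (EFin \o (fun p => dt f p * phase k eta th p)).
  apply: integrable_offaxis (measurable_mul_phase _ _ _ mf') _; first exact: ltr01.
  by move=> p p0; apply: le_trans (normr_mul_phase _ _ _ _ _) (fC' p p0).
have i2 : P.-integrable off (EFin \o (fun p => f p * phase k eta (th + pi / 2) p)).
  apply: integrable_offaxis (measurable_mul_phase _ _ _ mf) _; first exact: ltr01.
  by move=> p p0; apply: le_trans (normr_mul_phase _ _ _ _ _) (fC p p0).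
have i3 : P.-integrable off (EFin \o (fun p => k * (f p * phase k eta (th + pi / 2) p))).
  rewrite (_ : _ \o _ = fun p => k%:E * (f p * phase k eta (th + pi / 2) p)%:E)%E.
    exact: integrableZl.
  by apply/funext => p /=; rewrite EFinM.
have HE : \int[P]_(p in off) H p = osc k eta th (dt f) + k * osc k eta (th + pi / 2) f.
  by rewrite RintegralD // RintegralZl.
suff H0 : \int[P]_(p in off) H p = 0 by move: HE; rewrite H0 => /esym/eqP;
  rewrite addr_eq0 mulNr => /eqP.
have iH0 : P.-integrable off (EFin \o H).
  apply: eq_integrable (integrableD _ i1 i3) => // p _ /=.
have iH : P.-integrable setT ((EFin \o H) \_ off).
  by move/integrable_mkcond : iH0; apply.
rewrite /Rintegral integral_mkcond -(integral12_prod_meas1 iH) (_ : fubini_F _ _ = cst 0%E).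
  by rewrite integral0.
apply/funext => y; rewrite /fubini_F /=.
have [y0|y0] := eqVneq y 0.
  by apply: integral0_eq => t _; rewrite patchE memNset // /offaxis /= y0 eqxx.
transitivity (\int[mu]_t (H (y, t))%:E)%E.
  by apply: eq_integral => t _; rewrite patchE mem_set.
pose G t := f (y, t) * phase k eta th (y, t).
have yoff t : off (y, t) by [].
have dG t : is_derive t (1 : R) G (H (y, t)).
  have d1 : is_derive t (1 : R) (fun t => f (y, t)) (dt f (y, t)).
    by split; [exact: (df (y, t))|rewrite /dt derive1E].
  have d2 : is_derive t (1 : R) (fun t => phase k eta th (y, t))
      (k * phase k eta (th + pi / 2) (y, t)).
    rewrite /phase /=; apply: is_derive_eq.
    by rewrite addrA cosDpihalf /GRing.scale /=; ring.
  have := is_deriveM d1 d2; rewrite /GRing.scale /= => /is_derive_eq; apply.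
  by rewrite /H; ring.
have cH : continuous (fun t => H (y, t)).
  move=> t; apply: differentiable_continuous; apply/derivable1_diffP.
  apply: derivableD; apply: derivableM; [exact: (df' (y, t))| |exact: derivable_cst|].
    by rewrite /phase /=; apply: ex_derive.
  apply: derivableM; first exact: (df (y, t)).
  by rewrite /phase /=; apply: ex_derive.
have [Gy GNy] : G t @[t --> +oo] --> 0 /\ G t @[t --> -oo] --> 0.
  apply: (@weight_cvg0 y G C) => t.
  exact: le_trans (normr_mul_phase _ _ _ _ _) (fC _ (yoff t)).
have HC t : `|H (y, t)| <= (C' + `|k| * C) * weight 1 (y, t).
  rewrite mulrDl (le_trans (ler_normD _ _)) // lerD //.
    exact: le_trans (normr_mul_phase _ _ _ _ _) (fC' _ (yoff t)).
  rewrite normrM -mulrA ler_wpM2l //.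
  exact: le_trans (normr_mul_phase _ _ _ _ _) (fC _ (yoff t)).
have iHy : mu.-integrable setT (EFin \o (fun t => H (y, t))).
  pose D := `|C' + `|k| * C|.
  apply: (@le_integrable _ _ _ mu setT measurableT _ (fun t => (D * poisson 1 (t - 0))%:E)).
  - by apply/measurable_EFinP; exact: continuous_measurable_fun.
  - move=> t _ /=; rewrite lee_fin (le_trans (HC t)) // [leRHS]ger0_norm; last first.
      exact: mulr_ge0 (normr_ge0 _) (poisson_ge0 _ ltr01).
    rewrite (le_trans (ler_wpM2r _ (ler_norm _))) ?weight_ge0 // ler_wpM2l // subr0.
    rewrite /weight big_ord_recl mxE unlift_none /= ler_piMr ?poisson_ge0 //.
    apply: prodr_ile1 => i _; rewrite poisson_ge0 //= /poisson expr1n.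
    by rewrite ler_pdivrMr ?ltr_wpDr ?sqr_ge0 // mul1r lerDl sqr_ge0.
  - under eq_fun do rewrite EFinM; apply: integrableZl => //.
    apply/integrableP; split.
      by apply/measurable_EFinP; apply: continuous_measurable_fun; exact: continuous_poisson.
    under eq_integral do rewrite gee0_abs ?lee_fin ?poisson_ge0 //.
    by rewrite integral_poisson // ltry.
rewrite (@integral_FTC2_line R _ G G 0 0) //.
- by congr EFin; ring.
- by move=> t _; have [] := dG t.
- by move=> t _; have [] := dG t.
Qed.

(** What [n] integrations by parts consume: the derivatives of order 0 to [n] are dominated by the
    weight and can be differentiated once more. *)
Fixpoint osc_chain n f : Prop :=
  [/\ measurable_fun off f, exists C, forall p, off p -> `|f p| <= C * weight 1 p,
      forall p, off p -> derivable (fun t => f (p.1, t)) p.2 1 &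
      if n is n'.+1 then osc_chain n' (dt f) else True].

Lemma normr_osc_iter_dt k eta th n f : osc_chain n f ->
  `|k| ^+ n * `|osc k eta th f| <= \int[P]_(p in off) `|iter n (@dt R d) f p|.
Proof.
elim: n f th => [|n IH] f th.
  by move=> [mf [C fC] _ _]; rewrite mul1r; exact: (normr_osc_le _ _ _ ltr01 mf fC).
move=> [mf [C fC] df cf].
have [mf' [C' fC'] df'] : [/\ measurable_fun off (dt f),
    exists C, forall p, off p -> `|dt f p| <= C * weight 1 p &
    forall p, off p -> derivable (fun t => dt f (p.1, t)) p.2 1].
  by case: (n) cf => [|?] [].
(* Starting pi / 2 behind compensates for the phase shift in [osc_dt]. *)
have := IH _ (th - pi / 2) cf; rewrite (osc_dt _ _ _ mf mf' fC fC' df df').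
by rewrite subrK normrM normrN mulrA -exprSr -iterSr.
Qed.

Lemma osc_iter_dt_bound n f : osc_chain n f -> exists C, forall k eta th,
  `|k| ^+ n * `|osc k eta th f| <= C.
Proof.
by move=> cf; exists (\int[P]_(p in off) `|iter n (@dt R d) f p|) => k eta th;
  exact: normr_osc_iter_dt.
Qed.

Lemma dt_vanish e f : (forall p, off p -> rad p < e -> f p = 0) ->
  forall p, off p -> rad p < e -> dt f p = 0.
Proof.
move=> f0 p p0 pe; rewrite /dt derive1E.
rewrite (@near_eq_derive _ _ _ _ (cst 0)) ?derive_cst ?oner_neq0 //.
have cr : {for p.2, continuous (fun t => rad (p.1, t))}.
  apply: differentiable_continuous; apply/derivable1_diffP.
  by have [] := is_derive_rad p0.
have : \forall t \near p.2, rad (p.1, t) < e.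
  have /cvgr_lt := cr; apply.
  by rewrite -surjective_pairing.
by apply: filterS => t te; rewrite f0.
Qed.

Lemma weight_bound e f m C : 0 < e -> 0 <= C ->
  (forall p, off p -> rad p < e -> f p = 0) -> m = - (2 * d.+1)%:Z ->
  (forall p, off p -> `|f p| <= C * rad p ^ m) ->
  forall p, off p -> `|f p| <= C * (2 / e) ^+ d.+1 * weight e p.
Proof.
move=> e0 C0 f0 -> fC p p0; have [ep|pe] := leP e (rad p).
  by rewrite (le_trans (fC p p0)) // -mulrA ler_wpM2l // rad_le_weight.
by rewrite f0 // normr0 !mulr_ge0 ?exprn_ge0 ?divr_ge0 ?weight_ge0 ?(ltW e0).
Qed.

(** The order 0 bound serves inside the unit ball, through [one_le_weight], and the bound of order
    -2(d+1) outside, through [rad_le_weight]; this is where the 5 and the 2 come from. *)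
Lemma weight_bound1 f C C' :
  (forall p, off p -> `|f p| <= C * rad p ^ 0) ->
  (forall p, off p -> `|f p| <= C' * rad p ^ (- (2 * d.+1)%:Z)) ->
  exists D, forall p, off p -> `|f p| <= D * weight 1 p.
Proof.
move=> f1 f2; exists (`|C| * 5 ^+ d.+1 + `|C'| * 2 ^+ d.+1) => p p0; rewrite mulrDl.
have w0 : 0 <= weight 1 p by rewrite weight_ge0.
have [r1|r1] := leP 1 (rad p).
  apply: (@le_trans _ _ (`|C'| * 2 ^+ d.+1 * weight 1 p)); last first.
    by rewrite lerDr !mulr_ge0 ?exprn_ge0.
  rewrite (le_trans (f2 p p0)) // (le_trans (ler_wpM2r _ (ler_norm C'))) ?exprz_ge0
    ?sqrtr_ge0 //.
  by rewrite -mulrA ler_wpM2l //; have := rad_le_weight ltr01 r1; rewrite divr1.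
apply: (@le_trans _ _ (`|C| * 5 ^+ d.+1 * weight 1 p)); last first.
  by rewrite lerDl !mulr_ge0 ?exprn_ge0.
rewrite (le_trans (f1 p p0)) // expr0z mulr1 (le_trans (ler_norm C)) //.
rewrite -mulrA ler_peMr //; have := @one_le_weight 1 p ltr01; rewrite !mulr1; apply.
by rewrite (le_trans (ltW r1)) // ler1n.
Qed.

Lemma weight_bound_vanish e f C : 0 < e -> (forall p, off p -> rad p < e -> f p = 0) ->
  (forall p, off p -> `|f p| <= C * rad p ^ (- (2 * d.+1)%:Z)) ->
  exists D, forall p, off p -> `|f p| <= D * weight 1 p.
Proof.
move=> e0 f0 hC.
have hC' p : off p -> `|f p| <= `|C| * rad p ^ (- (2 * d.+1)%:Z).
  move=> p0; rewrite (le_trans (hC p p0)) // ler_wpM2r ?ler_norm //.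
  by rewrite exprz_ge0 ?sqrtr_ge0.
apply: (@weight_bound1 _ (`|C| * (e ^- (2 * d.+1)%N)) `|C|) => // p p0.
rewrite expr0z mulr1; have [ep|pe] := leP e (rad p); last first.
  by rewrite f0 // normr0 mulr_ge0 ?invr_ge0 ?exprn_ge0 ?(ltW e0).
have r0 := lt_le_trans e0 ep; rewrite (le_trans (hC' p p0)) // ler_wpM2l // -exprnN.
by rewrite lef_pV2 ?posrE ?exprn_gt0 // lerXn2r ?nnegrE ?(ltW e0) // ltW.
Qed.

(** From order n - 2(d+1) on top, [n] derivatives lead to order -2(d+1), the decay of the weight.
    All smaller orders are assumed too, so that the earlier derivatives decay as fast; near the
    origin everything vanishes. *)
Lemma osc_chain_vanish n e f : 0 < e -> (forall p, off p -> rad p < e -> f p = 0) ->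
  (forall m, m <= n%:Z - (2 * d.+1)%:Z -> symbol n.+1 m (fun _ : unit => f)) ->
  osc_chain n f.
Proof.
move=> e0; elim: n f => [|n IH] f f0 sf.
all: have [] // : [/\ measurable_fun off f,
    exists C, forall p, off p -> `|f p| <= C * weight 1 p &
    forall p, off p -> derivable (fun t => f (p.1, t)) p.2 1].
- have s0 := sf (- (2 * d.+1)%:Z) ltac:(lia); split; first exact: symbol_measurable s0 tt.
    by have [C hC] := symbol_bound s0; exact: (weight_bound_vanish e0 f0 (hC tt)).
  by move=> p p0; have [] := symbol_is_derive tt s0 p0.
- have s0 := sf (- (2 * d.+1)%:Z) ltac:(lia); split; first exact: symbol_measurable s0 tt.
    by have [C hC] := symbol_bound s0; exact: (weight_bound_vanish e0 f0 (hC tt)).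
  by move=> p p0; have [] := symbol_is_derive tt s0 p0.
move=> ? ? ?; split => //; apply: IH; first exact: dt_vanish.
move=> m mn; have mn' : m + 1 <= n.+1%:Z - (2 * d.+1)%:Z by lia.
by have := symbol_dt (sf _ mn'); rewrite addrK.
Qed.

Lemma osc_chain_flat n f : (forall m, symbol n.+1 m (fun _ : unit => f)) -> osc_chain n f.
Proof.
elim: n f => [|n IH] f sf.
all: have [] // : [/\ measurable_fun off f,
    exists C, forall p, off p -> `|f p| <= C * weight 1 p &
    forall p, off p -> derivable (fun t => f (p.1, t)) p.2 1].
1,2: split; [exact: symbol_measurable (sf 0) tt| |
    by move=> p p0; have [] := symbol_is_derive tt (sf 0) p0].
1,2: have [C hC] := symbol_bound (sf 0); have [C' hC'] := symbol_bound (sf (- (2 * d.+1)%:Z)).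
1,2: exact: weight_bound1 (hC tt) (hC' tt).
move=> ? ? ?; split => //; apply: IH => m.
by have := symbol_dt (sf (m + 1)); rewrite addrK.
Qed.

Lemma oscD k eta th f g C D : measurable_fun off f -> measurable_fun off g ->
  (forall p, off p -> `|f p| <= C * weight 1 p) ->
  (forall p, off p -> `|g p| <= D * weight 1 p) ->
  osc k eta th (fun p => f p + g p) = osc k eta th f + osc k eta th g.
Proof.
move=> mf mg fC gD; have moff := @measurable_offaxis R d.
rewrite /osc -RintegralD //.
- by apply: eq_Rintegral => p _; rewrite mulrDl.
- apply: (integrable_offaxis ltr01 (measurable_mul_phase _ _ _ mf) (C := C)) => p p0.
  exact: le_trans (normr_mul_phase _ _ _ _ _) (fC p p0).
- apply: (integrable_offaxis ltr01 (measurable_mul_phase _ _ _ mg) (C := D)) => p p0.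
  exact: le_trans (normr_mul_phase _ _ _ _ _) (gD p p0).
Qed.

End oscillatory_integral.

Lemma symbol_iter_dt (R : realType) d (I : Type) j n m (f : I -> 'rV[R]_d * R -> R) :
  symbol (j + n)%N m f -> symbol n (m - j%:Z) (fun i => iter j (@dt R d) (f i)).
Proof.
elim: j n m f => [|j IH] n m f sf; first by rewrite subr0.
have := IH n (m - 1) (fun i => dt (f i)) (symbol_dt sf).
rewrite (_ : m - 1 - j%:Z = m - j.+1%:Z); last by lia.
by apply: eq_symbol => i p _; rewrite -iterSr.
Qed.

Lemma symbol_at (R : realType) d (I J : Type) n m (f : I -> 'rV[R]_d * R -> R) i :
  symbol n m f -> symbol n m (fun _ : J => f i).
Proof.
elim: n m f => [|n IH] m f [mf [C fC] sf]; split => //.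
- by exists C => _; exact: fC.
- by exists C => _; exact: fC.
case: sf => df sf; split; first by move=> _; exact: df.
exact: (IH _ (fun i => dt (f i))).
Qed.

(** * Decay of order five for a linear factor times the exponential *)

Section radial_decay.
Context (R : realType) (chi h : R -> R) (a b : R).
Hypotheses (a_gt0 : 0 < a) (b_gt0 : 0 < b).
Hypothesis h_smooth : forall n r, derivable (derive1n n h) r 1.
Hypothesis chi_h : forall r, 0 <= r -> chi r = h r.
Hypothesis chi01 : forall r, 0 <= r -> 0 <= chi r <= 1.
Hypothesis chi_eq1 : forall r, 0 <= r <= 1 -> chi r = 1.
Hypothesis chi_eq0 : forall r, 2 <= r -> chi r = 0.
Local Notation X := ('rV[R]_2 * R)%type.
Local Notation off := (@offaxis R 2).
Local Notation P := (@leb_rV R 2 \x @lebesgue_measure R)%E.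
Implicit Types (p : X) (m : int) (k th : R) (eta : 'rV[R]_2).

(** The factor x_1 as seen after a permutation of the coordinates: either [t] itself, with [c = 1],
    or a coordinate of [y], with [c = 0]. *)
Variables (u : X -> R) (c : R).
Hypothesis symbol_u : forall (I : Type) n, symbol n 1 (fun _ : I => u).
Hypothesis dt_u : forall p, off p -> dt u p = c.

Let chir p := chi (rad p).
Let E p := expR (exponent chi a b (rad p)).
Let w p := u p * (E p - chir p).
Let near_ (e : {posnum R}) p := w p * chi (e%:num * rad p).
Let far (e : {posnum R}) p := w p * (1 - chi (e%:num * rad p)).

Let symbol_chir I n m : m <= 0 -> symbol n m (fun _ : I => chir).
Proof. exact: (symbol_chi _ h_smooth chi_h chi01 chi_eq1 chi_eq0). Qed.

Let symbol_w I n m : m <= 2 -> symbol n m (fun _ : I => w).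
Proof.
move=> m2; rewrite (_ : m = 1 + (m - 1)); last by rewrite addrC subrK.
apply: symbolM; first exact: symbol_u.
have : m - 1 <= 1 by lia.
(* Only the top order 2 needs the cancellation in [E - chir]; below it both terms qualify
   separately. *)
rewrite le_eqVlt => /orP[/eqP ->|m1].
  exact: (symbol_expR_exponent_sub _ a_gt0 b_gt0 h_smooth chi_h chi01 chi_eq1 chi_eq0).
have m0 : m - 1 <= 0 by lia.
apply: symbolD; last by apply: symbolN; exact: symbol_chir.
exact: (symbol_expR_exponent _ a_gt0 b_gt0 h_smooth chi_h chi01 chi_eq1 chi_eq0).
Qed.

Let symbol_far n m : m <= 2 -> symbol n m far.
Proof.
move=> m2; rewrite -[m]addr0; apply: symbolM; first exact: symbol_w.
apply: symbolD; first by apply: (@symbol_cst _ _ _ _ (fun=> 1) 1) => _; rewrite normr1.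
by apply: symbolN; exact: (symbol_chi_scale _ h_smooth chi_h chi01 chi_eq1 chi_eq0).
Qed.

Let far_vanish e p : off p -> rad p < e%:num^-1 -> far e p = 0.
Proof.
move=> p0 pe; rewrite /far chi_eq1 ?subrr ?mulr0 //.
have r0 := rad_gt0 p0; rewrite mulr_ge0 ?(ltW r0) //=.
by rewrite mulrC -ler_pdivlMr // div1r ltW.
Qed.

(** Eight fits because [far e] has all orders up to 2 and 8 - 2 * 3 = 2. *)
Let chain_far e : osc_chain 8 (far e).
Proof.
apply: (@osc_chain_vanish _ _ _ e%:num^-1); [by []|exact: far_vanish|move=> m m2].
apply: (@symbol_at _ _ _ _ _ _ far e); exact: symbol_far.
Qed.

(** The eighth derivative has order -6 uniformly in [e] and vanishes within radius 1 / e, so the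
    weight at scale 1 / e dominates it with the constant (2e)^3 up to a fixed factor. With [e] equal
    to |k| this is k^3 against k^8. *)
Let far_decay : exists C, 0 <= C /\ forall e k eta th, `|k| = e%:num ->
  `|k| ^+ 8 * `|osc k eta th (far e)| <= C * e%:num ^+ 3.
Proof.
have s := @symbol_iter_dt _ _ _ 8 0 2 far (symbol_far 8 (lexx 2)).
have [C hC] := symbol_bound s.
exists (`|C| * 2 ^+ 3 * pi ^+ 3); split; first by rewrite !mulr_ge0 ?exprn_ge0 ?pi_ge0.
move=> e k eta th ke; rewrite (le_trans (normr_osc_iter_dt _ _ _ (chain_far e))) //.
have e0 : 0 < e%:num^-1 by [].
have c0 : 0 <= `|C| * (2 / e%:num^-1) ^+ 3 by rewrite mulr_ge0 ?exprn_ge0.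
have van : forall j p, off p -> rad p < e%:num^-1 -> iter j (@dt R 2) (far e) p = 0.
  by elim=> [|j IH]; [exact: far_vanish|exact: dt_vanish].
have bnd : forall p, off p -> `|iter 8 (@dt R 2) (far e) p| <=
    `|C| * (2 / e%:num^-1) ^+ 3 * weight e%:num^-1 p.
  apply: (@weight_bound _ _ _ _ (2 - 8%:Z) _ e0) => //; first exact: van.
  move=> p p0; rewrite (le_trans (hC e p p0)) // ler_wpM2r ?ler_norm //.
  by rewrite exprz_ge0 ?sqrtr_ge0.
apply: le_trans (le_Rintegral_weight e0 c0 (symbol_measurable s e) bnd) _.
by rewrite invrK exprMn le_eqVlt; apply/orP; left; apply/eqP; ring.
Qed.

Let w_weight : exists C, forall p, off p -> `|w p| <= C * weight 1 p.
Proof.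
have [C hC] := symbol_bound (@symbol_w unit 0 0 isT).
have [D hD] := symbol_bound (@symbol_w unit 0 (- 6) isT).
exact: weight_bound1 (hC tt) (hD tt).
Qed.

Let measurable_near e : measurable_fun off (near_ e).
Proof.
apply: measurable_funM; first exact: symbol_measurable (@symbol_w unit 0 0 isT) tt.
exact: symbol_measurable (symbol_chi_scale _ h_smooth chi_h chi01 chi_eq1 chi_eq0 0) e.
Qed.

Let chi_scale01 (e : {posnum R}) p : 0 <= chi (e%:num * rad p) <= 1.
Proof. by apply: chi01; rewrite mulr_ge0 ?sqrtr_ge0. Qed.

(** No oscillation is used: on radius at most 2 / e the function is O(e^-2), and the weight at scale
    1 / e turns this into an integral at the cost of (5 / e)^3. *)
Let near_decay : exists C, 0 <= C /\ forall e k eta th,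
  `|osc k eta th (near_ e)| <= C * e%:num ^- 5.
Proof.
have [C hC] := symbol_bound (@symbol_w unit 0 2 isT).
exists (`|C| * 2 ^+ 2 * 5 ^+ 3 * pi ^+ 3); split; first by rewrite !mulr_ge0 ?exprn_ge0 ?pi_ge0.
move=> e k eta th; have e0 : 0 < e%:num^-1 by [].
have bnd p : off p -> `|near_ e p| <=
    `|C| * (2 / e%:num) ^+ 2 * (5 / e%:num) ^+ 3 * weight e%:num^-1 p.
  move=> p0; rewrite /near_ normrM; have r0 := rad_gt0 p0.
  have rhs0 : 0 <= `|C| * (2 / e%:num) ^+ 2 by rewrite mulr_ge0 ?exprn_ge0.
  have [r2|r2] := leP 2 (e%:num * rad p).
    by rewrite chi_eq0 // normr0 mulr0 !mulr_ge0 ?exprn_ge0 ?weight_ge0.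
  have re : rad p <= 2 / e%:num by rewrite ler_pdivlMr // mulrC ltW.
  have := one_le_weight e0 re => w1.
  rewrite (le_trans (_ : _ <= `|w p|)) //.
    by have /andP[c0 c1] := chi_scale01 e p; rewrite ler_piMr // ger0_norm.
  rewrite (le_trans (_ : _ <= `|C| * (2 / e%:num) ^+ 2)) //.
    rewrite (le_trans (hC tt p p0)) //
      (le_trans (ler_wpM2r _ (ler_norm C))) ?exprz_ge0 ?(ltW r0) //.
    by rewrite ler_wpM2l // lerXn2r ?nnegrE ?(ltW r0).
  by rewrite -mulrA ler_peMr.
rewrite (le_trans (normr_osc_le _ _ _ e0 (measurable_near e) bnd)) //.
have c0 : 0 <= `|C| * (2 / e%:num) ^+ 2 * (5 / e%:num) ^+ 3 by rewrite !mulr_ge0 ?exprn_ge0.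
apply: le_trans (le_Rintegral_weight e0 c0 (measurable_near e) bnd) _.
by rewrite le_eqVlt; apply/orP; left; apply/eqP; field.
Qed.

(** Near the origin the product is just [u], which is not flat, so the first two links of the chain
    are checked by hand with the orders at hand. As [dt u] is the constant [c], the second
    derivative contains only derivatives of [chir], and the six remaining links are flat. *)
Let chain_chi : osc_chain 8 (fun p => u p * chir p).
Proof.
have flat n m : symbol n m (fun (_ : unit) p => dt (fun p => u p * chir p) p - dt u p * chir p).
  exact: (symbol_dt_mul_chi h_smooth chi_h chi_eq1 chi_eq0 (symbol_u _ _)).
have dchi n m : symbol n m (fun _ : unit => dt chir).
  exact: (symbol_dt_chi _ h_smooth chi_h chi_eq1 chi_eq0).
have sf n m : m <= 1 -> symbol n m (fun _ : unit => fun p => u p * chir p).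
  move=> m1; rewrite (_ : m = 1 + (m - 1)); last by rewrite addrC subrK.
  by apply: symbolM; [exact: symbol_u|apply: symbol_chir; lia].
have weight_of f : (forall m, m <= 0 -> symbol 0 m (fun _ : unit => f)) ->
    exists C, forall p, off p -> `|f p| <= C * weight 1 p.
  move=> s; have [C hC] := symbol_bound (s 0 (lexx 0)).
  have [D hD] := symbol_bound (s (- 6) isT).
  exact: weight_bound1 (hC tt) (hD tt).
have sdf n m : m <= 0 -> symbol n m (fun _ : unit => dt (fun p => u p * chir p)).
  move=> m0; have m1 : m + 1 <= 1 by lia.
  by have := symbol_dt (sf n.+1 _ m1); rewrite addrK.
split; [exact: symbol_measurable (sf 0 0 isT) tt| | |].
- by apply: weight_of => m m0; apply: sf; lia.
- by move=> p p0; have [] := symbol_is_derive tt (sf 1%N 0 isT) p0.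
split; [exact: symbol_measurable (sdf 0 0 isT) tt| | |].
- by apply: weight_of => m m0; exact: sdf.
- by move=> p p0; have [] := symbol_is_derive tt (sdf 1%N 0 isT) p0.
apply: osc_chain_flat => m.
pose g p := dt (fun p => u p * chir p) p - dt u p * chir p.
have sg : symbol 7 m (fun _ : unit => dt g).
  by have := symbol_dt (flat 8 (m + 1)); rewrite addrK.
apply: (@eq_symbol _ _ _ _ _ (fun _ p => dt g p + c * dt chir p)); last first.
  apply: symbolD; first exact: sg.
  rewrite -[m]add0r; apply: symbolM; last exact: dchi.
  exact: (@symbol_cst _ _ _ _ (fun=> c) `|c|).
move=> i p /set_mem p0.
have dg := symbol_is_derive tt (flat 1%N 0) p0.
have dc := symbol_is_derive tt (@symbol_chir unit 1 0 isT) p0.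
have [_ <-] := is_deriveD dg (is_deriveZ c dc).
rewrite -derive1E (@eq_dt _ _ _ (fun p => g p + c * chir p)) ?inE // => q /set_mem q0.
by rewrite /g dt_u // subrK.
Qed.

Lemma radial_decay : exists C, forall k eta th, 1 <= `|k| ->
  `|osc k eta th (fun p => u p * E p)| <= C * `|k| ^- 5.
Proof.
have [C1 hC1] := osc_iter_dt_bound chain_chi.
have [C2 [C20 hC2]] := near_decay; have [C3 [C30 hC3]] := far_decay.
exists (`|C1| + C2 + C3) => k eta th k1.
have k0 : 0 < `|k| by rewrite (lt_le_trans ltr01).
(* The scale of the splitting is the frequency itself, which balances the near and the far part at
   k^-5. *)
pose e := PosNum k0.
have [A hA] : exists C, forall p, off p -> `|u p * chir p| <= C * weight 1 p by case: chain_chi.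
have [B hB] := w_weight.
have [D hD] : exists C, forall p, off p -> `|far e p| <= C * weight 1 p by case: (chain_far e).
have mA : measurable_fun off (fun p => u p * chir p) by case: chain_chi.
have mD : measurable_fun off (far e) by case: (chain_far e).
have hN p : off p -> `|near_ e p| <= B * weight 1 p.
  move=> p0; apply: le_trans (hB p p0); rewrite /near_ normrM ler_piMr //.
  by have /andP[c0 c1] := chi_scale01 e p; rewrite ger0_norm.
have -> : (fun p => u p * E p) = (fun p => u p * chir p + (near_ e p + far e p)).
  by apply/funext => p; rewrite /near_ /far /w; ring.
have hND p : off p -> `|near_ e p + far e p| <= (B + D) * weight 1 p.
  move=> p0; rewrite mulrDl (le_trans (ler_normD _ _)) // lerD //; [exact: hN|exact: hD].
rewrite (oscD _ _ _ mA (measurable_funD (measurable_near e) mD) hA hND).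
rewrite (oscD _ _ _ (measurable_near e) mD hN hD).
rewrite (le_trans (ler_normD _ _)) // -addrA mulrDl lerD //.
  have k8 : 0 < `|k| ^+ 8 by rewrite exprn_gt0.
  have := hC1 k eta th; rewrite mulrC -ler_pdivlMr // => /le_trans; apply.
  rewrite (le_trans (ler_wpM2r _ (ler_norm C1))) ?invr_ge0 ?exprn_ge0 //.
  by rewrite ler_wpM2l // lef_pV2 ?posrE ?exprn_gt0 // ler_weXn2l.
have n1 : `|osc k eta th (near_ e)| <= C2 * `|k| ^- 5 by have := hC2 e k eta th.
have n2 : `|osc k eta th (far e)| <= C3 * `|k| ^- 5.
  have := hC3 e k eta th erefl; rewrite mulrC -ler_pdivlMr ?exprn_gt0 // => /le_trans; apply.
  by rewrite le_eqVlt; apply/orP; left; apply/eqP => /=; field; rewrite gt_eqF.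
by apply: le_trans (ler_normD _ _) _; rewrite mulrDl; exact: lerD n1 n2.
Qed.

End radial_decay.

(** * Cosine transforms *)

Section offaxis_integral.
Context (R : realType) (d : nat).
Local Notation X := ('rV[R]_d.+1 * R)%type.
Local Notation P := (@leb_rV R d.+1 \x @lebesgue_measure R)%E.
Local Notation off := (@offaxis R d.+1).

(** The axis is a single point of ['rV[R]_d.+1] times the line; in positive dimension the point is a
    null box. *)
Lemma offaxis_null : P (~` off) = 0%E.
Proof.
have m0 : measurable [set 0 : 'rV[R]_d.+1].
  rewrite (_ : [set 0] = closed_box (fun=> 0) (fun=> 0)); first exact: measurable_closed_box.
  apply/seteqP; split => x /= x0; first by move=> i; rewrite x0 mxE lexx.
  by apply/rowP => i; rewrite mxE; apply/eqP; rewrite eq_le andbC x0.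
rewrite (_ : ~` off = [set 0] `*` setT).
  rewrite product_measure1E // (_ : [set 0] = closed_box (fun=> 0) (fun=> 0)).
    by rewrite /leb_rV lebesgue_rV_closed_box // big_ord_recl subrr mul0r mul0e.
  apply/seteqP; split => x /= x0; first by move=> i; rewrite x0 mxE lexx.
  by apply/rowP => i; rewrite mxE; apply/eqP; rewrite eq_le andbC x0.
apply/seteqP; split => p /=; rewrite /offaxis /=; first by move/negP; rewrite negbK => /eqP.
by move=> [-> _]; rewrite eqxx.
Qed.

Let mcons (f : 'rV[R]_d.+2 -> R) : measurable_fun setT f ->
  measurable_fun setT (f \o @cons_rV R d.+1).
Proof. by move=> mf; apply: measurableT_comp => //; exact: measurable_cons_rV. Qed.

Lemma ge0_integral_offaxis (f : 'rV[R]_d.+2 -> R) : measurable_fun setT f -> (forall x,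
  0 <= f x) ->
  (\int[lebesgue_rV R d.+2]_x (f x)%:E = \int[P]_(p in off) (f (cons_rV p))%:E)%E.
Proof.
move=> mf f0; have moff := @measurable_offaxis R d.+1.
transitivity (\int[P]_p (f (cons_rV p))%:E)%E.
  apply: (@ge0_integral_pushforward _ _ _ _ _ _ _ P setT (fun x => (f x)%:E)) => //.
  - exact: measurable_cons_rV.
  - exact/measurable_EFinP.
  - by move=> x _; rewrite lee_fin.
rewrite (@ge0_negligible_integral _ _ _ P setT (~` off)) ?setTD ?setCK //.
- exact: measurableC.
- by apply/measurable_EFinP; exact: mcons.
- by move=> p _; rewrite lee_fin.
- exact: offaxis_null.
Qed.

Lemma integrable_of_offaxis (f : 'rV[R]_d.+2 -> R) : measurable_fun setT f ->
  P.-integrable off (fun p => (f (cons_rV p))%:E) ->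
  (lebesgue_rV R d.+2).-integrable setT (EFin \o f).
Proof.
move=> mf /integrableP[_ foo]; apply/integrableP; split; first exact/measurable_EFinP.
rewrite (@ge0_integral_offaxis (fun x => `|f x|)) //.
exact: measurableT_comp.
Qed.

Lemma Rintegral_offaxis (f : 'rV[R]_d.+2 -> R) : (lebesgue_rV R d.+2).-integrable setT (EFin
  \o f) ->
  \int[lebesgue_rV R d.+2]_x f x = \int[P]_(p in off) f (cons_rV p).
Proof.
move=> fi; have moff := @measurable_offaxis R d.+1.
have mf : measurable_fun setT f by apply/measurable_EFinP; exact: measurable_int fi.
rewrite /Rintegral; congr fine.
transitivity (\int[P]_p (f (cons_rV p))%:E)%E.
  apply: (@integral_pushforward _ _ _ _ _ _ _ P setT (EFin \o f)) => //.
  - exact: measurable_cons_rV.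
  - exact/measurable_EFinP.
  - exact: integrable_rVS.
rewrite (@negligible_integral _ _ _ P setT (~` off)) ?setTD ?setCK //.
- exact: measurableC.
- exact: integrable_rVS.
- exact: offaxis_null.
Qed.

End offaxis_integral.

Section euclidean.
Context (R : realType) (d : nat).
Implicit Types (x xi : 'rV[R]_d).

Lemma enorm_ge0 x : 0 <= enorm x. Proof. exact: sqrtr_ge0. Qed.

Lemma sqr_enorm x : enorm x ^+ 2 = dot x x.
Proof. by rewrite sqr_sqrtr // dot_ge0. Qed.

Lemma normr_coord_le_enorm x i : `|x 0 i| <= enorm x.
Proof.
rewrite -sqrtr_sqr ler_wsqrtr // /dot (bigD1 i) //= -expr2 lerDl.
by apply: sumr_ge0 => j _; rewrite -expr2 sqr_ge0.
Qed.

Lemma sqr_japanese xi : japanese xi ^+ 2 = 1 + \sum_(i < d) xi 0 i ^+ 2.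
Proof. by rewrite sqr_sqrtr ?addr_ge0 ?sqr_ge0 // sqr_enorm; congr (1 + _). Qed.

Lemma japanese_ge1 xi : 1 <= japanese xi.
Proof. by rewrite -[X in X <= _](@sqrtr1 R) ler_wsqrtr // lerDl sqr_ge0. Qed.

Lemma japanese_gt0 xi : 0 < japanese xi.
Proof. exact: lt_le_trans (japanese_ge1 xi). Qed.

Lemma normr_coord_le_japanese xi i : `|xi 0 i| <= japanese xi.
Proof.
rewrite (le_trans (normr_coord_le_enorm xi i)) // -[enorm xi]ger0_norm ?enorm_ge0 //.
by rewrite -sqrtr_sqr ler_wsqrtr // lerDr.
Qed.

Lemma continuous_enorm : continuous (@enorm R d).
Proof.
move=> x; apply: (@cvg_comp _ _ _ (fun x => dot x x) (@Num.sqrt R));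
  last exact: sqrt_continuous.
rewrite /dot; apply: (@cvg_big _ _ _ _ _ _ _ (nbhs x)); first exact: add_continuous.
by move=> i _; apply: cvgM; exact: coord_continuous.
Qed.

Lemma dot_col_perm (s : 'S_d) x xi : dot (col_perm s x) xi = dot x (col_perm (s^-1)%g xi).
Proof.
rewrite /dot (reindex_inj (@perm_inj _ (s^-1)%g)) /=.
by apply: eq_bigr => i _; rewrite !mxE permKV.
Qed.

Lemma enorm_col_perm (s : 'S_d) x : enorm (col_perm s x) = enorm x.
Proof.
rewrite /enorm dot_col_perm; congr (Num.sqrt (dot _ _)).
by apply/rowP => i; rewrite !mxE permKV.
Qed.

End euclidean.

Lemma enorm_cons_rV (R : realType) d (p : 'rV[R]_d * R) : enorm (cons_rV p) = rad p.
Proof.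
case: p => y t; rewrite /enorm dot_cons /rad mxE unlift_none /=; congr (Num.sqrt (_ + _)).
by congr (dot _ _); apply/rowP => i; rewrite !mxE liftK.
Qed.

Section cosine_transform.
Context (R : realType) (d : nat).
Local Notation rV := 'rV[R]_d.
Local Notation leb := (lebesgue_rV R d).
Implicit Types (f p : rV -> R) (x xi : rV) (th : R).

(** One real integral for both parts of the Fourier transform: for real [f], [th = 0] gives the real
    part and [th = pi / 2] the imaginary part, as cos(v + pi / 2) = - sin v. *)
Definition cosine_transform f xi th : R :=
  \int[leb]_x (f x * cos (dot x xi + th)).

Lemma measurable_cos_dot xi th : measurable_fun setT (fun x => cos (dot x xi + th)).
Proof.
apply: (@measurableT_comp _ _ _ _ _ _ (@cos R)).
  by apply: continuous_measurable_fun; exact: continuous_cos.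
by apply: measurable_funD => //; exact: measurable_dot.
Qed.

Lemma integrable_mul_cos f xi th : leb.-integrable setT (EFin \o f) ->
  leb.-integrable setT (fun x => (f x * cos (dot x xi + th))%:E).
Proof.
move=> fi; have mf : measurable_fun setT f by apply/measurable_EFinP; exact: measurable_int fi.
apply: (le_integrable measurableT _ _ fi).
  by apply/measurable_EFinP; apply: measurable_funM => //; exact: measurable_cos_dot.
by move=> x _ /=; rewrite lee_fin normrM ler_piMr // cos_max.
Qed.

Lemma dotC x xi : dot x xi = dot xi x.
Proof. by apply: eq_bigr => i _; rewrite mulrC. Qed.

Lemma normr_cosine_transform_le f xi th : leb.-integrable setT (EFin \o f) ->
  `|cosine_transform f xi th| <= \int[leb]_x `|f x|.
Proof.
move=> fi; have ci := integrable_mul_cos xi th fi.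
rewrite (le_trans (le_normr_Rintegral _ ci)) // le_Rintegral //.
- exact: (integrable_abse ci).
- exact: (integrable_abse fi).
- by move=> x _; rewrite normrM ler_piMr // cos_max.
Qed.

Let measurable_kernel f th : measurable_fun setT f ->
  measurable_fun setT (fun z : rV * rV => f z.2 * cos (dot z.2 z.1 + th)).
Proof.
move=> mf; apply: measurable_funM; first exact: measurableT_comp.
apply: (@measurableT_comp _ _ _ _ _ _ (@cos R)).
  by apply: continuous_measurable_fun; exact: continuous_cos.
apply: measurable_funD => //; apply: measurable_sum => i; apply: measurable_funM.
- by apply: (@measurableT_comp _ _ _ _ _ _ (@rV_coord R d i)) => //; exact: measurable_rV_coord.
- by apply: (@measurableT_comp _ _ _ _ _ _ (@rV_coord R d i)) => //; exact: measurable_rV_coord.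
Qed.

(** Tonelli is applied to the positive and the negative part of the kernel, so measurability of [f]
    suffices. *)
Lemma measurable_cosine_transform f th : measurable_fun setT f ->
  measurable_fun setT (fun xi => cosine_transform f xi th).
Proof.
move=> mf; rewrite /cosine_transform /Rintegral.
have mk : measurable_fun setT (EFin \o (fun z : rV * rV => f z.2 * cos (dot z.2 z.1 + th))).
  by apply/measurable_EFinP; exact: measurable_kernel.
apply: (@measurableT_comp _ _ _ _ _ _ (@fine R)) => //.
under eq_fun do rewrite integralE.
apply: emeasurable_funB.
- have H := @measurable_fun_fubini_tonelli_F _ _ _ _ _ (@leb_rV R d) _
    (measurable_funepos mk) (fun z => funepos_ge0 _ z).
  apply: eq_measurable_fun H => xi _; rewrite /fubini_F; apply: eq_integral => x _.
  by rewrite !(funeposE, funenegE).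
- have H := @measurable_fun_fubini_tonelli_F _ _ _ _ _ (@leb_rV R d) _
    (measurable_funeneg mk) (fun z => funeneg_ge0 _ z).
  apply: eq_measurable_fun H => xi _; rewrite /fubini_F; apply: eq_integral => x _.
  by rewrite !(funeposE, funenegE).
Qed.

Lemma EFin_mul_cosine_transform f xi th (c : R) : leb.-integrable setT (EFin \o f) ->
  (c * cosine_transform f xi th)%:E = (\int[leb]_x (c * (f x * cos (dot x xi + th)))%:E)%E.
Proof.
move=> fi; have ci := integrable_mul_cos xi th fi.
rewrite /cosine_transform /Rintegral EFinM fineK; last exact: integrable_fin_num.
by rewrite -(integralZl measurableT ci).
Qed.

Lemma integrable_mul_cosine_transform f p th : leb.-integrable setT (EFin \o f) ->
  leb.-integrable setT (EFin \o p) ->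
  leb.-integrable setT (fun x => (f x * cosine_transform p x th)%:E).
Proof.
move=> fi pi; pose K := \int[leb]_x `|p x|.
have mf : measurable_fun setT f by apply/measurable_EFinP; exact: measurable_int fi.
have mp : measurable_fun setT p by apply/measurable_EFinP; exact: measurable_int pi.
apply: (le_integrable measurableT _ _ (integrableZl measurableT K fi)).
  by apply/measurable_EFinP; apply: measurable_funM => //; exact: measurable_cosine_transform.
move=> x _ /=; rewrite lee_fin !normrM mulrC ler_wpM2r //.
by rewrite (le_trans (normr_cosine_transform_le _ _ pi)) // ler_norm.
Qed.

(** The multiplication formula: the kernel cos(x.y + th) is symmetric and bounded by 1, so Fubini
    applies. It serves both for the transform of a distribution and for Fourier inversion. *)
Lemma Rintegral_mul_cosine_transform f p th : leb.-integrable setT (EFin \o f) ->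
  leb.-integrable setT (EFin \o p) ->
  \int[leb]_x (f x * cosine_transform p x th) = \int[leb]_y (p y * cosine_transform f y th).
Proof.
move=> fi pi.
have mf : measurable_fun setT f by apply/measurable_EFinP; exact: measurable_int fi.
have mp : measurable_fun setT p by apply/measurable_EFinP; exact: measurable_int pi.
pose F (z : rV * rV) := (f z.1 * (p z.2 * cos (dot z.2 z.1 + th)))%:E.
have mF : measurable_fun setT F.
  apply/measurable_EFinP; apply: measurable_funM; first exact: measurableT_comp.
  exact: measurable_kernel.
have Fi : (@leb_rV R d \x @leb_rV R d)%E.-integrable setT F.
  apply/integrable12ltyP => //.
  apply: (@le_lt_trans _ _ (\int[leb]_x (`|f x|%:E * \int[leb]_y `|p y|%:E))%E).
    apply: ge0_le_integral => //.
    - by move=> x _; exact: integral_ge0.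
    - apply: (@measurable_fun_fubini_tonelli_F _ _ _ _ _ (@leb_rV R d) (fun z => `|F z|)%E)
      => //.
      exact: measurableT_comp.
    - by apply: emeasurable_funM => //; apply/measurable_EFinP; exact: measurableT_comp.
    move=> x _; rewrite -ge0_integralZl //; last first.
      by apply/measurable_EFinP; exact: measurableT_comp.
    apply: ge0_le_integral => //.
    - apply: (@measurableT_comp _ _ _ _ _ _ (@abse R)) => //; apply/measurable_EFinP => /=.
      by apply: measurable_funM => //; apply: measurable_funM => //; exact: measurable_cos_dot.
    - by apply: emeasurable_funM => //; apply/measurable_EFinP; exact: measurableT_comp.
    - by move=> y _; rewrite /F /= lee_fin !normrM ler_wpM2l // ler_piMr // cos_max.
  rewrite ge0_integralZr //; last 2 first.
    by apply/measurable_EFinP; exact: measurableT_comp.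
    exact: integral_ge0.
  have /integrableP[_ foo] := fi; have /integrableP[_ poo] := pi.
  by rewrite lte_mul_pinfty // ?integral_ge0 // ge0_fin_numE // integral_ge0.
have := Fubini Fi; rewrite /= /Rintegral => FE.
have EF x : (f x * cosine_transform p x th)%:E = (\int[leb]_y F (x, y))%E.
  exact: EFin_mul_cosine_transform.
have EG y : (p y * cosine_transform f y th)%:E = (\int[leb]_x F (x, y))%E.
  rewrite EFin_mul_cosine_transform //.
  by apply: eq_integral => x _; rewrite /F /= (dotC x) mulrCA.
under eq_integral do rewrite EF.
under [in RHS]eq_integral do rewrite EG.
by rewrite FE.
Qed.

End cosine_transform.

(** * Decay of the transform of [phi2] *)

Section phi2_decay.
Context (R : realType) (chi h : R -> R) (a b : R).
Hypotheses (a_gt0 : 0 < a) (b_gt0 : 0 < b).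
Hypothesis h_smooth : forall n r, derivable (derive1n n h) r 1.
Hypothesis chi_h : forall r, 0 <= r -> chi r = h r.
Hypothesis chi01 : forall r, 0 <= r -> 0 <= chi r <= 1.
Hypothesis chi_eq1 : forall r, 0 <= r <= 1 -> chi r = 1.
Hypothesis chi_eq0 : forall r, 2 <= r -> chi r = 0.
Local Notation leb := (lebesgue_rV R 3).
Local Notation P := (@leb_rV R 2 \x @lebesgue_measure R)%E.
Local Notation off := (@offaxis R 2).
Local Notation phi := (phi2 a b chi).
Implicit Types (x xi : 'rV[R]_3) (th : R).

Lemma phi2E x : phi x = x 0 0 * expR (exponent chi a b (enorm x)).
Proof. by []. Qed.

(** Every coordinate is needed, since a permutation turns the factor x_1 of [phi2] into x_i. *)
Lemma continuous_coord_mul_expR i :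
  continuous (fun x : 'rV[R]_3 => x 0 i * expR (exponent chi a b (enorm x))).
Proof.
(* [chi] is arbitrary on the negative reals and may be discontinuous at 0 there; [h] is smooth on
   the whole line. *)
have -> : (fun x : 'rV[R]_3 => x 0 i * expR (exponent chi a b (enorm x))) =
    (fun x => x 0 i * expR (- b * enorm x + a * h (enorm x) * enorm x)).
  by apply/funext => x; rewrite /exponent chi_h ?enorm_ge0.
have ch : continuous h.
  by move=> r; apply: differentiable_continuous; apply/derivable1_diffP; exact: (@h_smooth 0%N).
have cc : continuous (fun x : 'rV[R]_3 => x 0 i) by exact: coord_continuous.
have ce : continuous (@enorm R 3) by exact: continuous_enorm.
have cl c : {for c, continuous (fun r => expR (- b * r + a * h r * r))}.
  apply: (@continuous_comp _ _ _ (fun r => - b * r + a * h r * r) expR);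
    last exact: continuous_expR.
  apply: cvgD; apply: cvgM; [exact: cvg_cst|exact: cvg_id| |exact: cvg_id].
  by apply: cvgM; [exact: cvg_cst|exact: ch].
move=> x; apply: (@cvgM _ _ (nbhs x)); first exact: cc.
exact: (continuous_comp (ce x) (cl _)).
Qed.

Lemma continuous_phi2 : continuous phi.
Proof. exact: continuous_coord_mul_expR. Qed.

Lemma measurable_phi2 : measurable_fun setT phi.
Proof. exact: continuous_measurable_rV continuous_phi2. Qed.

Lemma exponent_le_affine r : 0 <= r -> exponent chi a b r <= - b * r + a * 2.
Proof.
move=> r0; rewrite /exponent lerD2l -mulrA ler_wpM2l ?(ltW a_gt0) //.
have [r2|r2] := leP 2 r; first by rewrite chi_eq0 // mul0r.
have /andP[c0 c1] := chi01 r0.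
by rewrite -[2]mul1r ler_pM // ltW.
Qed.

Lemma phi2_bounded : exists M, forall x, `|phi x| <= M.
Proof.
(* From b r <= e^(b r) and chi(r) r <= 2. *)
exists (b^-1 * expR (a * 2)) => x; rewrite phi2E normrM (ger0_norm (expR_ge0 _)).
have r0 := enorm_ge0 x; set r := enorm x in r0 *.
apply: (@le_trans _ _ (r * expR (- b * r + a * 2))).
  by rewrite ler_pM ?expR_ge0 ?normr_coord_le_enorm ?ler_expR ?exponent_le_affine.
rewrite expRD mulrA ler_wpM2r ?expR_ge0 // mulNr expRN ler_pdivrMr ?expR_gt0 //.
rewrite mulrC ler_pdivlMr // mulrC.
by apply: le_trans (expR_ge1Dx _); rewrite lerDr.
Qed.

Let swap (i : 'I_3) : 'S_3 := tperm ord0 i.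

Let u (i : 'I_3) (p : 'rV[R]_2 * R) : R := cons_rV p 0 i.

Let decay_u i : exists C, forall k eta th, 1 <= `|k| ->
  `|osc k eta th (fun p => u i p * expR (exponent chi a b (rad p)))| <= C * `|k| ^- 5.
Proof.
have [->|[j ->]] : i = ord0 \/ exists j, i = lift ord0 j.
    by case: (unliftP ord0 i) => [j ->|->]; [right; exists j|left].
  have -> : u ord0 = fun p => p.2 by apply/funext => p; rewrite /u mxE unlift_none.
  apply: (radial_decay a_gt0 b_gt0 h_smooth chi_h chi01 chi_eq1 chi_eq0 (c := 1)).
    by move=> I n; exact: symbol_snd.
  by move=> p p0; rewrite /dt derive1_id.
have -> : u (lift ord0 j) = fun p => p.1 0 j by apply/funext => p; rewrite /u mxE liftK.
apply: (radial_decay a_gt0 b_gt0 h_smooth chi_h chi01 chi_eq1 chi_eq0 (c := 0)).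
  by move=> I n; exact: symbol_coord.
by move=> p p0; rewrite /dt derive1_cst.
Qed.

Let integrable_u i : P.-integrable off (fun p => (u i p * expR (exponent chi a b (rad p)))%:E).
Proof.
have su n : symbol n 1 (fun _ : unit => u i).
  case: (unliftP ord0 i) => [j ->|->].
    by rewrite (_ : u _ = fun p => p.1 0 j); [exact: symbol_coord|
      apply/funext => p; rewrite /u mxE liftK].
  by rewrite (_ : u _ = fun p => p.2); [exact: symbol_snd|
      apply/funext => p; rewrite /u mxE unlift_none].
have sE n m : m <= 0 -> symbol n m (fun (_ : unit) (p : 'rV[R]_2 * R) => expR (exponent chi a
  b (rad p))).
  exact: (symbol_expR_exponent _ a_gt0 b_gt0 h_smooth chi_h chi01 chi_eq1 chi_eq0).
(* With the linear factor of order 1, the orders -1 and -7 become 0 and -6, the two bounds asked for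
   by [weight_bound1] in dimension 3. *)
have s0 := symbolM (su 0%N) (sE 0%N (- 1) isT); have s6 := symbolM (su 0%N) (sE 0%N (- 7) isT).
have [C hC] := symbol_bound s0; have [D hD] := symbol_bound s6.
have [K hK] := weight_bound1 (hC tt) (hD tt).
exact: (integrable_offaxis ltr01 (symbol_measurable s0 tt) hK).
Qed.

Lemma integrable_phi2 : leb.-integrable setT (EFin \o phi).
Proof.
apply: integrable_of_offaxis; first exact: measurable_phi2.
rewrite (_ : (fun p => _) = (fun p => (u 0 p * expR (exponent chi a b (rad p)))%:E)).
  exact: integrable_u.
by apply/funext => p; rewrite phi2E enorm_cons_rV.
Qed.

(** Swapping coordinates 0 and [i] turns xi_i into the frequency [k] of [osc] and the factor x_1
    into x_i, while the radial factor is unchanged. *)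
Lemma cosine_transform_phi2_decay : exists C, forall xi th (i : 'I_3), 1 <= `|xi 0 i| ->
  `|cosine_transform phi xi th| <= C * `|xi 0 i| ^- 5.
Proof.
have /choice[C hC] := decay_u.
exists (\sum_i `|C i|) => xi th i xi1.
have -> : cosine_transform phi xi th = osc (xi 0 i)
    (\row_j col_perm (swap i) xi 0 (lift ord0 j)) th
    (fun p => u i p * expR (exponent chi a b (rad p))).
  rewrite /cosine_transform -(Rintegral_rV_col_perm (swap i)); last first.
    by apply: measurable_funM; [exact: measurable_phi2|exact: measurable_cos_dot].
  have E x : phi (col_perm (swap i) x) * cos (dot (col_perm (swap i) x) xi + th) =
      x 0 i * expR (exponent chi a b (enorm x)) * cos (dot x (col_perm (swap i) xi) + th).
    by rewrite phi2E enorm_col_perm mxE tpermL dot_col_perm tpermV.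
  under eq_Rintegral do rewrite E.
  rewrite Rintegral_offaxis.
    apply: eq_Rintegral => -[y t] _.
    by rewrite enorm_cons_rV /phase dot_cons [col_perm _ _ 0 ord0]mxE /swap tpermL.
  apply: integrable_mul_cos; apply: integrable_of_offaxis.
    apply: continuous_measurable_rV; exact: continuous_coord_mul_expR.
  by under eq_fun do rewrite enorm_cons_rV; exact: integrable_u.
rewrite (le_trans (hC i _ _ th xi1)) // ler_wpM2r ?invr_ge0 ?exprn_ge0 //.
by rewrite (le_trans (ler_norm _)) // (bigD1 i) //= lerDl sumr_ge0.
Qed.

(** For the largest coordinate xi_i and m = max(1, |xi_i|), <xi>^2 <= 1 + 3 m^2 <= (2m)^2, so m^-5
    costs a factor 2^5. If |xi_i| < 1, the bound by the L^1 norm [K] replaces the decay. *)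
Lemma cosine_transform_phi2_le : exists C, forall xi th,
  `|cosine_transform phi xi th| <= C * japanese xi ^- 5.
Proof.
have [C hC] := cosine_transform_phi2_decay.
pose K := \int[leb]_x `|phi x|.
have hK xi th : `|cosine_transform phi xi th| <= K.
  exact: normr_cosine_transform_le integrable_phi2.
exists ((`|K| + `|C|) * 2 ^+ 5) => xi th.
have jE := sqr_japanese xi; have j0 := japanese_gt0 xi.
have CK c (m : R) : 0 <= c -> c <= `|K| + `|C| -> 1 <= m -> japanese xi <= 2 * m ->
    c * m ^- 5 <= (`|K| + `|C|) * 2 ^+ 5 * japanese xi ^- 5.
  move=> c0 cKC m1 jm; have m0 : 0 < m by exact: lt_le_trans m1.
  rewrite -mulrA ler_pM ?invr_ge0 ?exprn_ge0 ?(ltW m0) //.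
  rewrite ler_pdivlMr ?exprn_gt0 // mulrC ler_pdivrMr ?exprn_gt0 // -exprMn.
  by rewrite lerXn2r // nnegrE ?mulr_ge0 ?(ltW j0) ?(ltW m0).
pose i := [arg max_(i > (ord0 : 'I_3)) `|xi 0 i|]%O.
have imax j : xi 0 j ^+ 2 <= xi 0 i ^+ 2.
  rewrite -(real_normK (num_real (xi 0 j))) -(real_normK (num_real (xi 0 i))).
  rewrite lerXn2r ?nnegrE // /i.
  by case: arg_maxP => // k _ /(_ j); apply.
have j4 m : 1 <= m -> `|xi 0 i| <= m -> japanese xi <= 2 * m.
  move=> m1 im; have m0 : 0 < m by exact: lt_le_trans m1.
  rewrite -(@ler_pXn2r _ 2) ?nnegrE ?mulr_ge0 ?(ltW j0) ?(ltW m0) //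
    jE !big_ord_recr big_ord0 /=.
  have im2 : xi 0 i ^+ 2 <= m ^+ 2.
    by rewrite -(real_normK (num_real (xi 0 i))) lerXn2r ?nnegrE // ltW.
  have m12 : 1 <= m ^+ 2 by rewrite -(expr1n _ 2) lerXn2r ?nnegrE // ltW.
  have := imax (widen_ord (leqnSn 2) (widen_ord (leqnSn 1) ord_max)).
  have := imax (widen_ord (leqnSn 2) ord_max).
  have := imax ord_max.
  by rewrite exprMn; lra.
have [x1|x1] := leP 1 `|xi 0 i|.
  apply: le_trans (hC xi th i x1) _.
  apply: le_trans (CK `|C| `|xi 0 i| _ _ x1 (j4 _ x1 (lexx _))) => //; last by rewrite lerDr.
  by rewrite ler_wpM2r ?ler_norm // invr_ge0 exprn_ge0.
apply: le_trans (hK xi th) _.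
apply: le_trans (CK `|K| 1 _ _ (lexx _) (j4 _ (lexx _) (ltW x1))) => //; last by rewrite lerDl.
by rewrite expr1n invr1 mulr1 ler_norm.
Qed.

End phi2_decay.

(** * Integrability of powers of <xi> and membership for s < 2 *)

Section japanese_decay.
Context (R : realType).
Local Notation mu := (@lebesgue_measure R).
Implicit Types (q s t : R).

Let is_derive_expR_ln q t : 0 <= t ->
  is_derive t 1 (fun r => expR (q * ln (1 + r))) (q * (1 + t)^-1 * expR (q * ln (1 + t))).
Proof.
move=> t0; have t1 : 0 < 1 + t by rewrite ltr_pwDl.
have d1 : is_derive t (1 : R) (fun r : R => 1 + r) 1.
  by rewrite -[X in is_derive _ _ _ X]add0r; exact: is_deriveD.
have dl : is_derive t (1 : R) (fun r : R => ln (1 + r)) (1 + t)^-1.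
  apply: is_derive_eq.
    exact: (@is_derive1_comp _ (@ln R) (fun r : R => 1 + r) _ _ _ (is_derive1_ln t1) d1).
  by rewrite mulr1.
have dq : is_derive t (1 : R) (fun r : R => q * ln (1 + r)) (q * (1 + t)^-1).
  by apply: is_derive_eq; rewrite /GRing.scale /=; ring.
by apply: is_derive_eq; rewrite mulrC.
Qed.

Lemma continuous_expR_ln_abs q : continuous (fun t => expR (- q * ln (1 + `|t|))).
Proof.
have cl (c : R) : 0 <= c -> {for c, continuous (fun r : R => expR (- q * ln (1 + r)))}.
  move=> c0; apply: differentiable_continuous; apply/derivable1_diffP.
  by have [] := is_derive_expR_ln (- q) c0.
move=> t; apply: (@continuous_comp _ _ _ _ (fun r : R => expR (- q * ln (1 + r)))).
  exact: norm_continuous.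
exact: cl.
Qed.

Lemma integral_expR_ln_abs q : 1 < q ->
  (\int[mu]_t (expR (- q * ln (1 + `|t|)))%:E = (2 / (q - 1))%:E)%E.
Proof.
move=> q1; have q_neq0 : q - 1 != 0 by rewrite subr_eq0 gt_eqF.
pose H (r : R) := expR ((1 - q) * ln (1 + r)) / (q - 1).
have dH t : 0 <= t -> is_derive t 1 H (- expR (- q * ln (1 + t))).
  move=> t0; have t1 : 0 < 1 + t by rewrite ltr_pwDl.
  have dE := is_derive_expR_ln (1 - q) t0.
  apply: is_derive_eq.
  have -> : (1 - q) * ln (1 + t) = - q * ln (1 + t) + ln (1 + t) by ring.
  rewrite expRD lnK ?posrE // /GRing.scale /=; field.
  by rewrite q_neq0 gt_eqF.
have H0 : H 0 = (q - 1)^-1 by rewrite /H addr0 ln1 mulr0 expR0 mul1r.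
have ly : (fun t : R => ln (1 + t)) @ +oo --> +oo.
  apply/cvgryPge => A; near=> t.
  have t1 : expR A <= 1 + t.
    by apply: (@le_trans _ _ t); [near: t; apply: nbhs_pinfty_ge;
      exact: num_real|rewrite lerDr].
  by rewrite -(expRK A) ler_ln ?posrE ?expR_gt0 // (lt_le_trans _ t1) ?expR_gt0.
have Hy : H t @[t --> +oo] --> (0 : R).
  rewrite -(mul0r (q - 1)^-1); apply: cvgM; last exact: cvg_cst.
  under eq_fun do rewrite -(opprB q) mulNr.
  have := @cvgr_expR R; apply: (@cvg_comp _ _ _ (fun t => (q - 1) * ln (1 + t)) (fun x =>
    expR (- x))).
  by apply: gt0_cvgMry => //; rewrite subr_gt0.
apply: etrans; first apply: (@ge0_integral_FTC2_line R _ (fun t => - H t) (fun t => H (- t))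
  0 0).
- exact: continuous_expR_ln_abs.
- by move=> x; exact: expR_ge0.
- move=> x x0; have dHx := dH x x0; rewrite ger0_norm //.
  suff [] : is_derive x (1 : R) (fun t => - H t) (expR (- q * ln (1 + x))) by [].
  by apply: is_derive_eq; rewrite opprK.
- move=> x x0; have := dH (- x); rewrite oppr_ge0 => /(_ x0) dHx; rewrite ler0_norm //.
  suff [] : is_derive x (1 : R) (fun t => H (- t)) (expR (- q * ln (1 - x))) by [].
  have dN : is_derive x (1 : R) (fun t : R => - t) (- 1) by apply: is_derive_eq.
  by apply: is_derive_eq; rewrite mulrNN mulr1.
- by rewrite -oppr0; exact: cvgN.
- by apply/cvgNy_compNP; rewrite (_ : _ \o _ = H) //; apply/funext => x /=; rewrite opprK.
congr (_%:E); rewrite oppr0 H0; field.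
by [].
Unshelve. all: by end_near. Qed.

Lemma measurable_expR_japanese d q :
  measurable_fun setT (fun xi : 'rV[R]_d => expR (q * ln (japanese xi))).
Proof.
apply: (@measurableT_comp _ _ _ _ _ _ (@expR R)) => //.
apply: measurable_funM => //; apply: (@measurableT_comp _ _ _ _ _ _ (@ln R)).
  exact: measurable_ln.
apply: continuous_measurable_rV => x; rewrite /japanese.
apply: (@continuous_comp _ _ _ (@enorm R d) (fun r => Num.sqrt (1 + r ^+ 2))).
  exact: continuous_enorm.
apply: (@cvg_comp _ _ _ (fun r : R => 1 + r ^+ 2) (@Num.sqrt R)); last exact: sqrt_continuous.
by apply: cvgD; [exact: cvg_cst|exact: exprn_continuous].
Qed.

(** As 1 + |xi_i| <= 2 <xi>, a third of the exponent can be spent on each coordinate; the resulting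
    product of one-dimensional powers is integrable since q / 3 > 1. Powers are written as
    [expR (q * ln _)]. *)
Lemma integral_japanese_expR q : 3 < q ->
  (\int[lebesgue_rV R 3]_xi (expR (- q * ln (japanese xi)))%:E < +oo)%E.
Proof.
move=> q3; pose p := q / 3.
have p1 : 1 < p by rewrite /p ltr_pdivlMr // mul1r.
have mp : measurable_fun setT (fun t => expR (- p * ln (1 + `|t|))).
  by apply: continuous_measurable_fun; exact: continuous_expR_ln_abs.
pose w t := expR (p * ln 2) * expR (- p * ln (1 + `|t|)).
have mw : measurable_fun setT w by exact: measurable_funM.
have w0 t : 0 <= w t by rewrite mulr_ge0 ?expR_ge0.
have mJ : measurable_fun setT (fun xi : 'rV[R]_3 => expR (- q * ln (japanese xi))).
  exact: measurable_expR_japanese.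
apply: (@le_lt_trans _ _ (\int[lebesgue_rV R 3]_xi (\prod_(i < 3) w (xi 0 i))%:E)%E);
  last first.
  rewrite (ge0_integral_tensor (f := fun=> w)) //.
  have wE : (\int[mu]_t (w t)%:E = (expR (p * ln 2) * (2 / (p - 1)))%:E)%E.
    rewrite (EFinM _ (2 / _)) -integral_expR_ln_abs // -ge0_integralZl //.
    by apply/measurable_EFinP.
  by under eq_bigr do rewrite wE; rewrite prodEFin ltry.
apply: ge0_le_integral => //.
- exact/measurable_EFinP.
- by apply/measurable_EFinP; exact: (measurable_tensor (fun=> mw)).
move=> x _; rewrite lee_fin.
have -> : expR (- q * ln (japanese x)) = \prod_(i < 3) expR (- p * ln (japanese x)).
  rewrite prodr_const card_ord -expRM_natl; congr expR; rewrite /p; field.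
  by [].
apply: ler_prod => i _; rewrite expR_ge0 /= /w -expRD ler_expR.
have lnJ : ln (1 + `|x 0 i|) <= ln 2 + ln (japanese x).
  rewrite -lnM ?posrE ?japanese_gt0 // ler_ln ?posrE ?mulr_gt0 ?japanese_gt0 ?ltr_pwDl //.
  by rewrite [2 * _]mulrDl mul1r lerD ?japanese_ge1 ?normr_coord_le_japanese.
rewrite -subr_ge0 (_ : _ - _ = p * (ln 2 + ln (japanese x) - ln (1 + `|x 0 i|))); last by ring.
by rewrite mulr_ge0 ?subr_ge0 // (le_trans ler01) // ltW.
Qed.

End japanese_decay.

Section regular_real.
Context (R : realType) (d : nat) (f : 'rV[R]_d -> R).
Local Notation rV := 'rV[R]_d.
Local Notation leb := (lebesgue_rV R d).
Local Notation Re := (@complex.Re R).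
Local Notation Im := (@complex.Im R).
Local Notation T := (regular_distribution (fun x => (f x)%:C)).
Implicit Types (p : rV -> R) (phi psi : rV -> R[i]) (x xi : rV).
Hypothesis fi : leb.-integrable setT (EFin \o f).

Let mf : measurable_fun setT f.
Proof. by apply/measurable_EFinP; exact: measurable_int fi. Qed.

Lemma regular_distributionE phi :
  T phi = (\int[leb]_x (f x * Re (phi x))) +i* (\int[leb]_x (f x * Im (phi x))).
Proof.
rewrite /regular_distribution /cintegral; congr (_ +i* _); apply: eq_Rintegral => x _.
  by case: (phi x) => a b /=; rewrite mul0r subr0.
by case: (phi x) => a b /=; rewrite mul0r addr0.
Qed.

Lemma integrable_mul_bounded p (M : R) : measurable_fun setT p -> (forall x, `|p x| <= M) ->
  leb.-integrable setT (fun x => (f x * p x)%:E).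
Proof.
move=> mp pM; apply: (le_integrable measurableT _ _ (integrableZl measurableT M fi)).
  by apply/measurable_EFinP; exact: measurable_funM.
move=> x _ /=; rewrite lee_fin !normrM mulrC ler_wpM2r //.
by rewrite (le_trans (pM x)) // ler_norm.
Qed.

Lemma normr_Rintegral_mul_bounded p (M : R) : measurable_fun setT p -> (forall x,
  `|p x| <= M) ->
  `|\int[leb]_x (f x * p x)| <= \int[leb]_x `|f x| * M.
Proof.
move=> mp pM; have fpi := integrable_mul_bounded mp pM.
rewrite (le_trans (le_normr_Rintegral _ fpi)) // mulrC -RintegralZl //;
  last exact: (integrable_abse fi).
apply: le_Rintegral => //.
- exact: (integrable_abse fpi).
- exact: (integrableZl measurableT M (integrable_abse fi)).
- by move=> x _; rewrite normrM mulrC ler_wpM2r.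
Qed.

Lemma normr_Re_le_normc (z : R[i]) : `|Re z| <= normc z.
Proof. by case: z => a b /=; rewrite -sqrtr_sqr ler_wsqrtr // lerDl sqr_ge0. Qed.

Lemma normr_Im_le_normc (z : R[i]) : `|Im z| <= normc z.
Proof. by case: z => a b /=; rewrite -sqrtr_sqr ler_wsqrtr // lerDr sqr_ge0. Qed.

Lemma normc_le_ReIm (z : R[i]) : normc z <= `|Re z| + `|Im z|.
Proof.
case: z => a b /=; rewrite -(@ler_pXn2r _ 2) ?nnegrE ?sqrtr_ge0 ?addr_ge0 //
  sqr_sqrtr ?addr_ge0 ?sqr_ge0 //.
by rewrite sqrrD !real_normK ?num_real // addrAC lerDl mulrn_wge0 // mulr_ge0.
Qed.

Lemma smooth_continuous p : smooth p -> continuous p.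
Proof. by move=> sp x; apply: differentiable_continuous; exact: (sp [::]). Qed.

Lemma smooth_measurable p : smooth p -> measurable_fun setT p.
Proof.
by move=> sp; apply: continuous_measurable_rV; exact: smooth_continuous.
Qed.

Lemma cpartial_nil phi x : cpartial [::] phi x = phi x.
Proof. by rewrite /cpartial /=; case: (phi x). Qed.

Let schwartz_bounded phi : schwartz phi -> exists M : R, forall x, normc (phi x) <= M.
Proof.
move=> [_ /(_ 0%N [::])[M hM]]; exists M => x.
by have := hM x; rewrite expr0 mul1r cpartial_nil.
Qed.

Lemma tempered_regular_real : tempered_distribution T.
Proof.
split => [a phi psi sphi spsi|].
  have [M hM] := schwartz_bounded sphi; have [N hN] := schwartz_bounded spsi.
  have [[/smooth_measurable m1 /smooth_measurable m2] _] := sphi.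
  have [[/smooth_measurable m3 /smooth_measurable m4] _] := spsi.
  have i1 := integrable_mul_bounded m1 (fun x => le_trans (normr_Re_le_normc _) (hM x)).
  have i2 := integrable_mul_bounded m2 (fun x => le_trans (normr_Im_le_normc _) (hM x)).
  have i3 := integrable_mul_bounded m3 (fun x => le_trans (normr_Re_le_normc _) (hN x)).
  have i4 := integrable_mul_bounded m4 (fun x => le_trans (normr_Im_le_normc _) (hN x)).
  rewrite !regular_distributionE; case: a => a b.
  have lin (c1 c2 : R) (p1 p2 p3 : rV -> R) :
      leb.-integrable setT (fun x => (f x * p1 x)%:E) ->
      leb.-integrable setT (fun x => (f x * p2 x)%:E) ->
      leb.-integrable setT (fun x => (f x * p3 x)%:E) ->
      \int[leb]_x (f x * (c1 * p1 x + c2 * p2 x + p3 x)) =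
      c1 * \int[leb]_x (f x * p1 x) + c2 * \int[leb]_x (f x * p2 x) + \int[leb]_x (f x * p3 x).
    move=> h1 h2 h3; have h1' := integrableZl measurableT c1 h1;
      have h2' := integrableZl measurableT c2 h2.
    rewrite -!RintegralZl // -RintegralD // -RintegralD //; last exact: integrableD h1' h2'.
    by apply: eq_Rintegral => x _; ring.
  have mulE (u v u' v' : R) : (a +i* b) * (u +i* v) + (u' +i* v') =
      (a * u + - b * v + u') +i* (a * v + b * u + v') by rewrite mulNr.
  rewrite mulE -(lin a (- b) _ _ _ i1 i2 i3) -(lin a b _ _ _ i2 i1 i4).
  by congr (_ +i* _); apply: eq_Rintegral => x _; congr (_ * _) => /=;
    case: (phi x) => u v; case: (psi x) => u' v'; rewrite mulE.
(* As [f] is integrable, the supremum of the Schwartz function is enough: no weights and no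
   derivatives. The 2 accounts for real and imaginary parts. *)
exists 0%N, (2 * \int[leb]_x `|f x|) => phi M [[s1 s2] _] hM.
have pM x : normc (phi x) <= M.
  by have := hM 0%N [::] x (leqnn _) (leqnn _); rewrite expr0 mul1r cpartial_nil.
rewrite regular_distributionE (le_trans (normc_le_ReIm _)) //= -mulrA mulr_natl mulr2n.
rewrite lerD // normr_Rintegral_mul_bounded //; try exact: smooth_measurable.
- by move=> x; exact: le_trans (normr_Re_le_normc _) (pM x).
- by move=> x; exact: le_trans (normr_Im_le_normc _) (pM x).
Qed.

Lemma compact_fun_bounded p (K : set rV) : compact K -> continuous p ->
  exists M : R, forall x, K x -> `|p x| <= M.
Proof.
move=> cK cp; have /compact_bounded[M [_ hM]] : compact (p @` K).
  by apply: continuous_compact => //; exact: continuous_subspaceT.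
by exists (M + 1) => x Kx; apply: (hM (M + 1)); [rewrite ltrDl|exists x].
Qed.

Lemma integrable_compact_support p (K : set rV) : continuous p -> compact K ->
  (forall x, ~ K x -> p x = 0) -> leb.-integrable setT (EFin \o p).
Proof.
move=> cp cK p0; have mK := compact_measurable_rV cK.
have pK : p = p \_ K.
  by apply/funext => x; rewrite patchE; case: ifPn => // /negP; rewrite inE => /p0.
have Koo : (leb K < +oo)%E.
  have [M hM] := compact_fun_bounded cK (@continuous_enorm R d).
  apply: (@le_lt_trans _ _ (leb (closed_box (fun=> - M) (fun=> M)))); last first.
    exact: lebesgue_rV_closed_box_lty.
  apply: le_measure; rewrite ?inE //; first exact: measurable_closed_box.
  move=> x Kx i; rewrite -ler_norml (le_trans (normr_coord_le_enorm x i)) //.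
  by rewrite (le_trans (ler_norm _)) // hM.
have mp := continuous_measurable_rV cp.
rewrite pK (_ : _ \o _ = (EFin \o p) \_ K); last first.
  by apply/funext => x /=; rewrite !patchE; case: ifP.
apply/(integrable_mkcond _ mK); apply: measurable_bounded_integrable => //.
  exact: measurable_funS mp.
have [M hM] := compact_fun_bounded cK cp.
exists M; split; first exact: num_real.
by move=> N /ltW MN x Kx; rewrite /= (le_trans (hM x Kx)).
Qed.

Let integrable_test phi : test_function phi ->
  leb.-integrable setT (EFin \o (Re \o phi)) /\ leb.-integrable setT (EFin \o (Im \o phi)).
Proof.
move=> [[s1 s2] [K [cK phi0]]].
by split; apply: (@integrable_compact_support _ K) => //;
  [exact: smooth_continuous|move=> x /phi0 /= ->|exact: smooth_continuous|move=> x /phi0 /= ->].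
Qed.

Lemma fourier_ReIm phi xi : test_function phi -> fourier phi xi =
  (cosine_transform (Re \o phi) xi 0 - cosine_transform (Im \o phi) xi (pi / 2)) +i*
  (cosine_transform (Im \o phi) xi 0 + cosine_transform (Re \o phi) xi (pi / 2)).
Proof.
move=> /integrable_test[i1 i2]; rewrite /fourier /cintegral /cosine_transform.
rewrite -RintegralB ?integrable_mul_cos // -RintegralD ?integrable_mul_cos //.
congr (_ +i* _); apply: eq_Rintegral => x _ /=; case: (phi x) => u v;
  by rewrite /= cosN sinN addr0 cosDpihalf; ring.
Qed.

(** The multiplication formula, applied to the real and imaginary parts of the test function at both
    phases. *)
Lemma represents_regular_real :
  represents (fun xi => cosine_transform f xi 0 +i* cosine_transform f xi (pi / 2))
    (fourier_distribution T).
Proof.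
move=> phi tphi; have [i1 i2] := integrable_test tphi.
rewrite /fourier_distribution regular_distributionE /regular_distribution /cintegral.
have h p th (ip : leb.-integrable setT (EFin \o p)) := integrable_mul_cosine_transform th fi ip.
have h' p th (ip : leb.-integrable setT (EFin \o p)) :=
  integrable_mul_cosine_transform th ip fi.
congr (_ +i* _).
  transitivity (\int[leb]_x (f x * cosine_transform (Re \o phi) x 0) -
      \int[leb]_x (f x * cosine_transform (Im \o phi) x (pi / 2))).
    rewrite -RintegralB ?h //; apply: eq_Rintegral => x _.
    by rewrite fourier_ReIm // mulrBr.
  have e p th (ip : leb.-integrable setT (EFin \o p)) :=
    Rintegral_mul_cosine_transform th fi ip.
  rewrite (e _ _ i1) (e _ _ i2) -(RintegralB measurableT (h' _ _ i1) (h' _ _ i2)).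
  by apply: eq_Rintegral => x _ /=; case: (phi x) => u v /=; ring.
transitivity (\int[leb]_x (f x * cosine_transform (Im \o phi) x 0) +
    \int[leb]_x (f x * cosine_transform (Re \o phi) x (pi / 2))).
  rewrite -RintegralD ?h //; apply: eq_Rintegral => x _.
  by rewrite fourier_ReIm // mulrDr.
have e p th (ip : leb.-integrable setT (EFin \o p)) := Rintegral_mul_cosine_transform th fi ip.
rewrite (e _ _ i1) (e _ _ i2) -(RintegralD measurableT (h' _ _ i2) (h' _ _ i1)).
by apply: eq_Rintegral => x _ /=; case: (phi x) => u v /=; ring.
Qed.

End regular_real.

Lemma measurable_normc d (T : measurableType d) (R : realType) (g : T -> R[i]) :
  measurable_fun setT (fun x => complex.Re (g x)) -> measurable_fun setT (fun x => complex.Im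
    (g x)) ->
  measurable_fun setT (fun x => normc (g x)).
Proof.
move=> mRe mIm; rewrite (_ : (fun x => _) = fun x => Num.sqrt (complex.Re (g x) ^+ 2 +
  complex.Im (g x) ^+ 2)).
  apply: (@measurableT_comp _ _ _ _ _ _ (@Num.sqrt R)) => //.
    by apply: continuous_measurable_fun; exact: sqrt_continuous.
  by apply: measurable_funD; apply: measurable_funX.
by apply/funext => x; case: (g x).
Qed.

Lemma integrable_cosine_transform (R : realType) (f : 'rV[R]_3 -> R) (th C : R) :
  measurable_fun setT f ->
  (forall xi th, `|cosine_transform f xi th| <= C * japanese xi ^- 5) ->
  (lebesgue_rV R 3).-integrable setT (fun xi => (cosine_transform f xi th)%:E).
Proof.
move=> mf fC.
have iJ : (lebesgue_rV R 3).-integrable setT (fun xi => (expR (- 5 * ln (japanese xi)))%:E).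
  apply/integrableP; split; first by apply/measurable_EFinP; exact: measurable_expR_japanese.
  under eq_integral do rewrite gee0_abs ?lee_fin ?expR_ge0 //.
  by apply: integral_japanese_expR; rewrite ltr_nat.
apply: (le_integrable measurableT _ _ (integrableZl measurableT C iJ)).
  by apply/measurable_EFinP; exact: measurable_cosine_transform.
move=> xi _ /=; rewrite lee_fin (le_trans (fC xi th)) // (le_trans _ (ler_norm _)) //.
by rewrite mulNr expRN expRM_natl lnK ?posrE ?japanese_gt0.
Qed.

Lemma spectral_barron_of_decay (R : realType) (f : 'rV[R]_3 -> R) (s C : R) :
  (lebesgue_rV R 3).-integrable setT (EFin \o f) ->
  (forall xi th, `|cosine_transform f xi th| <= C * japanese xi ^- 5) ->
  0 <= s < 2 -> spectral_barron s (regular_distribution (fun x => (f x)%:C)).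
Proof.
move=> fi fC /andP[s0 s2]; split; first exact: tempered_regular_real.
have mf : measurable_fun setT f by apply/measurable_EFinP; exact: measurable_int fi.
pose g xi := cosine_transform f xi 0 +i* cosine_transform f xi (pi / 2).
have C0 : 0 <= C.
  by have := le_trans (normr_ge0 _) (fC 0 0);
    rewrite pmulr_lge0 // invr_gt0 exprn_gt0 // japanese_gt0.
have mA th := measurable_cosine_transform th mf.
have mg : measurable_fun setT (fun xi => normc (g xi)) by apply: measurable_normc; exact: mA.
(* A general exponent, because [r = 0] also yields local integrability. The threshold comes from 5 -
   r > 3, and [2 * C] bounds the two components of [g]. *)
have bound (r : R) : 0 <= r < 2 ->
    (\int[lebesgue_rV R 3]_xi (japanese xi `^ r * normc (g xi))%:E < +oo)%E.
  move=> /andP[r0 r2].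
  have mJ (q : R) : measurable_fun setT (fun xi : 'rV[R]_3 => expR (q * ln (japanese xi))).
    exact: measurable_expR_japanese.
  have powE (xi : 'rV[R]_3) (q : R) : japanese xi `^ q = expR (q * ln (japanese xi)).
    by rewrite /powR gt_eqF // japanese_gt0.
  apply: (@le_lt_trans _ _ (\int[lebesgue_rV R 3]_xi ((2 * C)%:E * (expR (- (5 - r) * ln
    (japanese xi)))%:E))%E).
    apply: ge0_le_integral => //.
    - by move=> xi _; rewrite lee_fin mulr_ge0 ?powR_ge0 // sqrtr_ge0.
    - apply/measurable_EFinP; apply: measurable_funM => //.
      by apply: eq_measurable_fun (mJ r) => xi _; rewrite powE.
    - by apply/measurable_EFinP; apply: measurable_funM.
    move=> xi _; rewrite lee_fin powE.
    have -> : - (5 - r) * ln (japanese xi) = r * ln (japanese xi) - 5%:R * ln (japanese xi)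
      by ring.
    rewrite expRD mulrCA ler_wpM2l ?expR_ge0 // (le_trans (normc_le_ReIm _)) //=.
    rewrite expRN expRM_natl lnK ?posrE ?japanese_gt0 //.
    by rewrite -mulrA mulr_natl mulr2n lerD.
  rewrite ge0_integralZl //.
  - rewrite lte_mul_pinfty ?integral_japanese_expR //; first by rewrite lee_fin mulr_ge0.
    by rewrite ltrBrDr -ltrBrDl (lt_le_trans r2) //; lra.
  - exact/measurable_EFinP.
  - by rewrite lee_fin mulr_ge0.
exists g; split; [|exact: represents_regular_real|by apply: bound; rewrite s0].
split; [exact: mA|exact: mA|move=> K cK].
have r02 : (0 : R) <= 0 < (2 : R) by rewrite lexx /=.
apply: le_lt_trans (bound 0 r02).
under [leRHS]eq_integral do rewrite powRr0 mul1r.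
apply: ge0_subset_integral => //; first exact: compact_measurable_rV.
- exact/measurable_EFinP.
- by move=> xi _; rewrite lee_fin sqrtr_ge0.
Qed.

(** * Fourier inversion and second differences *)

Section cvg_Rintegral.
Context d (T : measurableType d) (R : realType) (mu : {measure set T -> \bar R}).

Lemma cvg_Rintegral (f_ : nat -> T -> R) (f g : T -> R) :
  (forall n, measurable_fun setT (f_ n)) -> measurable_fun setT f ->
  (forall x, f_ n x @[n --> \oo] --> f x) -> mu.-integrable setT (EFin \o g) ->
  (forall n x, `|f_ n x| <= g x) ->
  \int[mu]_x f_ n x @[n --> \oo] --> \int[mu]_x f x.
Proof.
move=> mf_ mf cf gi fg.
have [|||||fi _ cv] := @dominated_convergence _ _ _ mu setT measurableT
  (fun n => EFin \o f_ n) (EFin \o f) (EFin \o g) => //.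
- by move=> n; exact/measurable_EFinP.
- exact/measurable_EFinP.
- by apply: aeW => x _; apply: cvg_EFin; [exact: nearW|exact: cf].
- by apply: aeW => x n _ /=; rewrite lee_fin.
by apply: fine_cvg; rewrite fineK ?integrable_fin_num.
Qed.

End cvg_Rintegral.

(** * Smooth test functions and their pairing with sines *)

Section smooth_real_functions.
Context (R : realType).
Implicit Types f g u : R -> R.

(** Derivatives are peeled off from the innermost, unlike in [derive1nS], so that the product and
    chain rules go through by induction on the order. *)
Fixpoint derivable_upto n f : Prop :=
  if n is m.+1 then (forall t, derivable f t 1) /\ derivable_upto m (fun t => derive1 f t)
    else True.

Lemma derivable_upto_derive1n n f : derivable_upto n.+1 f -> forall t,
  derivable (derive1n n f) t 1.
Proof.
elim: n f => [|n IH] f; first by case.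
by move=> [_ /IH h] t; rewrite derive1Sn; exact: h.
Qed.

Lemma derive1n_derivable_upto f : (forall n t, derivable (derive1n n f) t 1) ->
  forall n, derivable_upto n f.
Proof.
move=> df n; elim: n f df => // n IH f df; split; first exact: (df 0%N).
by apply: IH => m t; rewrite -derive1Sn; exact: df.
Qed.

Lemma derivable_uptoW n f : derivable_upto n.+1 f -> derivable_upto n f.
Proof. by elim: n f => [//|n IH] f [df /IH]. Qed.

Lemma derivable_upto_cst n (c : R) : derivable_upto n (fun=> c).
Proof.
elim: n c => // n IH c; split; first by move=> t; exact: derivable_cst.
rewrite (_ : (fun t => derive1 _ t) = fun=> 0) //.
by apply/funext => t; exact: derive1_cst.
Qed.

Lemma derivable_upto_id n : derivable_upto n (fun t : R => t).
Proof.
case: n => // n; split; first by move=> t; exact: derivable_id.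
rewrite (_ : (fun t => derive1 _ t) = fun=> (1 : R)); first exact: derivable_upto_cst.
by apply/funext => t; exact: derive1_id.
Qed.

Lemma derivable_uptoD n f g : derivable_upto n f -> derivable_upto n g ->
  derivable_upto n (fun t => f t + g t).
Proof.
elim: n f g => // n IH f g [df sf] [dg sg]; split; first by move=> t; exact: derivableD.
rewrite (_ : (fun t => _) = fun t => derive1 f t + derive1 g t); first exact: IH.
by apply/funext => t; rewrite !derive1E deriveD.
Qed.

Lemma derivable_uptoM n f g : derivable_upto n f -> derivable_upto n g ->
  derivable_upto n (fun t => f t * g t).
Proof.
elim: n f g => // n IH f g sf sg; have [df sf'] := sf; have [dg sg'] := sg.
split; first by move=> t; exact: derivableM.
rewrite (_ : (fun t => _) = fun t => f t * derive1 g t + g t * derive1 f t).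
  by apply: derivable_uptoD; apply: IH => //; exact: derivable_uptoW.
by apply/funext => t; rewrite !derive1E deriveM.
Qed.

Lemma derivable_upto_comp n f g : derivable_upto n f -> derivable_upto n g ->
  derivable_upto n (fun t => f (g t)).
Proof.
elim: n f g => // n IH f g [df sf] sg; have [dg sg'] := sg.
split; first by move=> t; apply/derivable1_diffP; apply: differentiable_comp;
  exact/derivable1_diffP.
rewrite (_ : (fun t => _) = fun t => derive1 f (g t) * derive1 g t).
  by apply: derivable_uptoM => //; apply: (IH (fun t => derive1 f t)) => //;
    exact: derivable_uptoW.
by apply/funext => t; exact: (derive1_comp (dg t) (df _)).
Qed.

Lemma derivable_upto_sin n : derivable_upto n (@sin R) /\ derivable_upto n (@cos R).
Proof.
elim: n => // n [IHs IHc]; split; split.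
- by move=> t; exact: ex_derive.
- by rewrite (_ : (fun t => _) = @cos R) //; apply/funext => t; rewrite derive1E derive_val.
- by move=> t; exact: ex_derive.
rewrite (_ : (fun t => _) = fun t => -1 * sin t).
  by apply: derivable_uptoM => //; exact: derivable_upto_cst.
by apply/funext => t; rewrite derive1E derive_val mulN1r.
Qed.

End smooth_real_functions.

Section smooth_tensor.
Context (R : realType) (d : nat).
Implicit Types (u : 'I_d -> R -> R) (x : 'rV[R]_d) (s : seq 'I_d).

Lemma differentiable_tensor u x : (forall i t, derivable (u i) t 1) ->
  differentiable (fun x : 'rV[R]_d => \prod_(i < d) u i (x 0 i)) x.
Proof.
move=> du; elim: (index_enum _) => [|i r IH].
  under eq_fun do rewrite big_nil; exact: differentiable_cst.
under eq_fun do rewrite big_cons; apply: differentiableM => //.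
apply: (@differentiable_comp _ _ _ _ (fun x : 'rV[R]_d => x 0 i) (u i)).
  exact: differentiable_coord.
exact/derivable1_diffP.
Qed.

Lemma derive_tensor u i x : (forall i t, derivable (u i) t 1) ->
  'D_(delta_mx 0 i) (fun x : 'rV[R]_d => \prod_(j < d) u j (x 0 j)) x =
  \prod_(j < d) (if j == i then derive1 (u j) else u j) (x 0 j).
Proof.
move=> du; pose c := \prod_(j < d | j != i) u j (x 0 j).
rewrite [RHS](bigD1 i) //= eqxx [X in _ * X](eq_bigr (fun j => u j (x 0 j))) => [|j /negPf ->
  //].
rewrite -/c mulrC -derive1Ml // derive1E /derive.
(* Both sides are limits of the same difference quotient: moving along the i-th axis changes only
   the i-th factor. *)
apply: (f_equal (fun q : R -> R => lim (q @ 0^'))).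
apply/funext => r /=; rewrite scaler1.
have E t : \prod_(j < d) u j ((t *: delta_mx 0 i + x) 0 j) = c * u i (t + x 0 i).
  rewrite (bigD1 i) //= mulrC !mxE !eqxx mulr1; congr (_ * _).
  by apply: eq_bigr => j /negPf ji; rewrite !mxE ji andbF mulr0 add0r.
congr (_ *: (_ - _)); first exact: E.
by have := E 0; rewrite scale0r !add0r.
Qed.

Lemma partial_tensor u s : (forall i n t, derivable (derive1n n (u i)) t 1) ->
  partial s (fun x => \prod_(i < d) u i (x 0 i)) =
  fun x => \prod_(i < d) derive1n (count_mem i s) (u i) (x 0 i).
Proof.
move=> du; elim: s => [//|i s IH]; rewrite /= -/(partial s _) IH; apply/funext => x.
rewrite (derive_tensor (u := fun j => derive1n (count_mem j s) (u j))) //;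
  apply: eq_bigr => j _.
by rewrite [i == j]eq_sym; case: eqP => [->|_] //=; rewrite ?add1n ?derive1nS.
Qed.

End smooth_tensor.

Section smooth_tests.
Context (R : realType) (d : nat).

Lemma smooth_tensor (u : 'I_d -> R -> R) : (forall i n t, derivable (derive1n n (u i)) t 1) ->
  smooth (fun x : 'rV[R]_d => \prod_(i < d) u i (x 0 i)).
Proof.
by move=> du s x; rewrite partial_tensor //;
  exact: (differentiable_tensor (u := fun i => derive1n (count_mem i s) (u i))).
Qed.

Lemma smooth_cst0 : smooth ((fun=> 0) : 'rV[R]_d -> R).
Proof.
move=> s x; rewrite (_ : partial s _ = fun=> 0); first exact: differentiable_cst.
by elim: s => //= i s ->; apply/funext => y; exact: derive_cst.
Qed.

Lemma compact_closed_box (a b : 'I_d -> R) : compact (closed_box a b).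
Proof.
rewrite closed_boxE; apply: (@rV_compact _ _ (fun i => `[a i, b i]%classic)) => i.
exact: segment_compact.
Qed.

End smooth_tests.

Section sine_pairing.
Context (R : realType) (d : nat) (h : R -> R).
Hypothesis h_smooth : forall n r, derivable (derive1n n h) r 1.
Hypothesis h01 : forall r, 0 <= r -> 0 <= h r <= 1.
Hypothesis h_eq1 : forall r, 0 <= r <= 1 -> h r = 1.
Hypothesis h_eq0 : forall r, 2 <= r -> h r = 0.
Local Notation rV := 'rV[R]_d.+1.
Local Notation leb := (lebesgue_rV R d.+1).
Local Notation Re := (@complex.Re R).
Local Notation Im := (@complex.Im R).
Implicit Types (x xi : rV) (t s : R).

(** The square keeps the argument in the half-line where [h] is controlled, and keeps the bump
    smooth at [s = 0]. As [n] grows the bumps tend to 1. *)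
Let bump n s := h (n.+1%:R^-1 * (s * s)).

Let cut n t (i : 'I_d.+1) s := (if i == ord0 then sin (t * s) else 1) * bump n s.

Let sine_test n t xi := \prod_i cut n t i (xi 0 i).

Let sine_testE n t xi : sine_test n t xi = sin (t * xi 0 ord0) * \prod_i bump n (xi 0 i).
Proof. by rewrite /sine_test /cut big_split /= (bigD1 ord0) //= big1 ?mulr1 //
  => i /negPf ->. Qed.

Let bump01 n s : 0 <= bump n s <= 1.
Proof. by apply: h01; rewrite mulr_ge0 // -expr2 sqr_ge0. Qed.

Let normr_sine_test n t xi : `|sine_test n t xi| <= 1.
Proof.
rewrite sine_testE normrM mulr_ile1 // ?sin_max // normr_prod.
by apply: prodr_ile1 => i _; rewrite normr_ge0 /= ger0_norm; have /andP[] := bump01 n (xi 0 i).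
Qed.

Let smooth_sine_test n t : smooth (sine_test n t).
Proof.
apply: smooth_tensor => i k; apply: derivable_upto_derive1n; apply: derivable_uptoM.
  case: (i == ord0); last exact: derivable_upto_cst.
  apply: derivable_upto_comp; first by have [] := @derivable_upto_sin R k.+1.
  by apply: derivable_uptoM; [exact: derivable_upto_cst|exact: derivable_upto_id].
apply: derivable_upto_comp; first exact: derive1n_derivable_upto.
by apply: derivable_uptoM; [exact: derivable_upto_cst|apply: derivable_uptoM;
  exact: derivable_upto_id].
Qed.

Let test_function_sine n t : test_function (fun xi => (sine_test n t xi)%:C).
Proof.
split; first by split; [exact: smooth_sine_test|exact: smooth_cst0].
(* If |s| > 2(n + 1), then |s| >= 1 and s^2 >= |s| >= 2(n + 1), so the bump vanishes. *)
exists (closed_box (fun=> - (2 * n.+1%:R)) (fun=> 2 * n.+1%:R)); split.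
  exact: compact_closed_box.
move=> xi; rewrite /closed_box /= => /existsNP[i /negP xii].
rewrite /sine_test (bigD1 i) //= /cut /bump h_eq0 ?mulr0 ?mul0r //.
move: xii; rewrite -ler_norml -ltNge => xii.
have n1 : 1 <= n.+1%:R :> R by rewrite ler1n.
rewrite mulrC ler_pdivlMr // -expr2 -(real_normK (num_real _)).
rewrite (le_trans (ltW xii)) // expr2 ler_peMl // (le_trans _ (ltW xii)) //.
by rewrite -[X in X <= _]mul1r ler_pM // ler1n.
Qed.

Let cvg_sine_test t xi : sine_test n t xi @[n --> \oo] --> sin (t * xi 0 ord0).
Proof.
rewrite -[X in _ --> X]mulr1; under eq_fun do rewrite sine_testE.
apply: cvgM; first exact: cvg_cst.
apply: (@cvg_near_cst _ _ _ (fun n => \prod_i bump n (xi 0 i))).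
near=> n; rewrite big1 // => i _; rewrite /bump h_eq1 // -expr2 mulr_ge0 ?sqr_ge0 //=.
rewrite mulrC ler_pdivrMr // mul1r.
have dn : dot xi xi <= n%:R by near: n; exact: nbhs_infty_ger.
apply: (@le_trans _ _ (dot xi xi)); last by rewrite (le_trans dn) // ler_nat.
by rewrite /dot (bigD1 i) //= -expr2 lerDl; apply: sumr_ge0 => j _; rewrite -expr2 sqr_ge0.
Unshelve. all: by end_near. Qed.

(** [T] fixes only pairings with test functions, and a sine has no compact support. The cut-off
    sines are real, so their pairings determine the integrals of Im g, and dominated convergence
    removes the cut-off. *)
Lemma represents_sine (g1 g2 : rV -> R[i]) T t : represents g1 T -> represents g2 T ->
  leb.-integrable setT (EFin \o (Im \o g1)) -> leb.-integrable setT (EFin \o (Im \o g2)) ->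
  \int[leb]_xi (Im (g1 xi) * sin (t * xi 0 ord0)) = \int[leb]_xi (Im (g2 xi) * sin (t * xi 0
    ord0)).
Proof.
move=> r1 r2 i1 i2.
have cv g : leb.-integrable setT (EFin \o (Im \o g)) ->
    \int[leb]_xi (Im (g xi) * sine_test n t xi) @[n --> \oo] -->
    \int[leb]_xi (Im (g xi) * sin (t * xi 0 ord0)).
  move=> ig; have mg : measurable_fun setT (Im \o g) by apply/measurable_EFinP;
    exact: measurable_int ig.
  apply: (cvg_Rintegral (g := fun xi => `|Im (g xi)|)).
  - by move=> n; apply: measurable_funM => //; exact: smooth_measurable (smooth_sine_test n t).
  - apply: measurable_funM => //; apply: (@measurableT_comp _ _ _ _ _ _ (@sin R)).
      by apply: continuous_measurable_fun; exact: continuous_sin.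
    by apply: measurable_funM => //; exact: (measurable_rV_coord ord0).
  - by move=> xi; apply: cvgM; [exact: cvg_cst|exact: cvg_sine_test].
  - exact: (integrable_abse ig).
  - by move=> n xi; rewrite normrM ler_piMr // normr_sine_test.
have E n : \int[leb]_xi (Im (g1 xi) * sine_test n t xi) = \int[leb]_xi (Im (g2 xi) *
  sine_test n t xi).
  have e g : represents g T ->
      \int[leb]_xi (Im (g xi) * sine_test n t xi) = Im (T (fun xi => (sine_test n t xi)%:C)).
    move=> /(_ _ (test_function_sine n t)) ->; rewrite /regular_distribution /cintegral.
    apply: eq_Rintegral => xi _; case: (g xi) => a b /=.
    by rewrite mulr0 add0r.
  by rewrite !e.
have := cv _ i2; under eq_fun do rewrite -E.
by move=> c2; exact: (cvg_unique _ (cv _ i1) c2).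
Qed.

End sine_pairing.

(** * The Poisson kernel as an approximate identity, and inversion *)

Section poisson_identity.
Context (R : realType) (d : nat).
Local Notation mu := (@lebesgue_measure R).
Local Notation leb := (lebesgue_rV R d).
Implicit Types (x a : 'rV[R]_d) (e : R).

Definition poisson_rV e x : R := \prod_(i < d) poisson e (x 0 i).

Let measurable_poisson e t : 0 < e -> measurable_fun setT (fun s : R => poisson e (s - t)).
Proof. by move=> e0; apply: continuous_measurable_fun; exact: continuous_poisson. Qed.

Lemma poisson_rV_ge0 e x : 0 < e -> 0 <= poisson_rV e x.
Proof. by move=> e0; apply: prodr_ge0 => i _; exact: poisson_ge0. Qed.

Lemma measurable_poisson_rV e a : 0 < e -> measurable_fun setT (fun x => poisson_rV e (x - a)).
Proof.
move=> e0; rewrite /poisson_rV; under eq_fun do under eq_bigr do rewrite !mxE.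
by apply: (measurable_tensor (g := fun i s => poisson e (s - a 0 i))) => i;
  exact: measurable_poisson.
Qed.

Lemma integral_poisson_rV e a : 0 < e ->
  (\int[leb]_x (poisson_rV e (x - a))%:E = (pi ^+ d)%:E)%E.
Proof.
move=> e0; rewrite /poisson_rV; under eq_integral do under eq_bigr do rewrite !mxE.
rewrite (ge0_integral_tensor (f := fun i s => poisson e (s - a 0 i))).
- under eq_bigr do rewrite integral_poisson //.
  by rewrite prodEFin prodr_const card_ord.
- by move=> i; exact: measurable_poisson.
- by move=> i s; exact: poisson_ge0.
Qed.

Lemma integrable_poisson_rV e a : 0 < e ->
  leb.-integrable setT (fun x => (poisson_rV e (x - a))%:E).
Proof.
move=> e0; apply/integrableP; split; first by apply/measurable_EFinP;
  exact: measurable_poisson_rV.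
under eq_integral do rewrite gee0_abs ?lee_fin ?poisson_rV_ge0 //.
by rewrite integral_poisson_rV // ltry.
Qed.

Lemma integrable_mul_poisson_rV (f : 'rV[R]_d -> R) (M : R) e a : 0 < e ->
  measurable_fun setT f -> (forall x, `|f x| <= M) ->
  leb.-integrable setT (fun x => (f x * poisson_rV e (x - a))%:E).
Proof.
move=> e0 mf fM; under eq_fun do rewrite mulrC.
exact: (integrable_mul_bounded (integrable_poisson_rV a e0) mf fM).
Qed.

(** For |s| >= D, 1 + s^2 <= (1 + D^-2) s^2: away from its centre the kernel is [e] times a kernel
    of unit scale. *)
Let poisson_off e D s : 0 < e -> 0 < D -> D <= `|s| ->
  poisson e s <= e * (1 + D ^- 2) * poisson 1 s.
Proof.
move=> e0 D0 Ds.
have s2 : D ^+ 2 <= s ^+ 2 by rewrite -(real_normK (num_real s)) lerXn2r ?nnegrE // ltW.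
have s0 : 0 < s ^+ 2 by apply: lt_le_trans s2; rewrite exprn_gt0.
rewrite /poisson -mulrA ler_wpM2l ?(ltW e0) // expr1n mulrA mulr1.
rewrite ler_pdivlMr; last by rewrite addr_gt0.
rewrite mulrC ler_pdivrMr ?poisson_denom_gt0 //.
have h : 1 <= s ^+ 2 / D ^+ 2 by rewrite ler_pdivlMr ?exprn_gt0 // mul1r.
have : 0 <= (1 + D ^- 2) * e ^+ 2 by rewrite mulr_ge0 ?sqr_ge0 // addr_ge0 //
  invr_ge0 exprn_ge0 // ltW.
rewrite mulrDr mulrDl [X in _ -> _ <= _ + X]mulrDl mul1r mulrC (mulrC _ (s ^+ 2)); lra.
Qed.

(** The majorant when coordinate [j] is far from that of [a]: only this factor is traded for unit
    scale, so the integral remains pi^d while a factor [e] is gained. *)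
Let off_kernel e a j x : R := \prod_(i < d) (if i == j then poisson 1 else poisson e) (x 0 i
  - a 0 i).

Let integral_off_kernel e a j : 0 < e -> (\int[leb]_x (off_kernel e a j x)%:E = (pi ^+ d)%:E)%E.
Proof.
move=> e0; rewrite /off_kernel.
rewrite (ge0_integral_tensor (f :=
  fun i s => (if i == j then poisson 1 else poisson e) (s - a 0 i))).
- rewrite -[in RHS](card_ord d) -prodr_const -prodEFin; apply: eq_bigr => i _.
  by case: (i == j); rewrite integral_poisson.
- by move=> i; case: (i == j); exact: measurable_poisson.
- by move=> i s; case: (i == j); exact: poisson_ge0.
Qed.

Let off_kernel_ge0 e a j x : 0 < e -> 0 <= off_kernel e a j x.
Proof. by move=> e0; apply: prodr_ge0 => i _; case: (i == j); exact: poisson_ge0. Qed.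

Let measurable_off_kernel e a j : 0 < e -> measurable_fun setT (off_kernel e a j).
Proof.
move=> e0; apply: (measurable_tensor (g :=
  fun i s => (if i == j then poisson 1 else poisson e) (s - a 0 i))) => i.
by case: (i == j); exact: measurable_poisson.
Qed.

Let poisson_rV_off e D a x j : 0 < e -> 0 < D -> D <= `|x 0 j - a 0 j| ->
  poisson_rV e (x - a) <= e * (1 + D ^- 2) * off_kernel e a j x.
Proof.
move=> e0 D0 Dx; rewrite /poisson_rV /off_kernel (bigD1 j) //= [X in _ <= _ * X](bigD1 j) //=
  eqxx !mxE.
rewrite [X in _ <= _ * (_ * X)](eq_bigr (fun i => poisson e ((x - a) 0 i))); last first.
  by move=> i /negPf ->; rewrite !mxE.
rewrite mulrA ler_wpM2r ?poisson_off //.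
by apply: prodr_ge0 => i _; exact: poisson_ge0.
Qed.

Lemma poisson_rV_cvg (f : 'rV[R]_d -> R) (M : R) (e_ : nat -> R) a :
  continuous f -> (forall x, `|f x| <= M) -> (forall n, 0 < e_ n) -> e_ n @[n --> \oo] --> 0 ->
  \int[leb]_x (f x * poisson_rV (e_ n) (x - a)) @[n --> \oo] --> pi ^+ d * f a.
Proof.
move=> cf fM e0 ecv; have mf := continuous_measurable_rV cf.
have iM (g : 'rV[R]_d -> R) (K : R) n := @integrable_mul_poisson_rV g K (e_ n) a (e0 n).
have ip n := integrable_poisson_rV a (e0 n).
apply/cvgrPdist_le => eta eta0.
pose eta1 := eta / (2 * pi ^+ d).
have pid0 : 0 < pi ^+ d :> R by rewrite exprn_gt0 // pi_gt0.
have eta10 : 0 < eta1 by rewrite divr_gt0 // mulr_gt0.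
have M0 : 0 <= M by apply: le_trans (fM 0).
have [D D0 hD] : exists2 D : R, 0 < D & forall x, (forall i,
  `|x 0 i - a 0 i| < D) -> `|f x - f a| <= eta1.
  have /cvgrPdist_le/(_ _ eta10)/nbhs_ballP[D /= D0 hD] := cf a.
  exists D => // x xD; rewrite distrC; apply: hD; rewrite /ball /= /mx_ball; split=> // i j.
  by rewrite ord1 /ball /= distrC.
pose c n := 2 * M * (e_ n * (1 + D ^- 2)).
(* The constant [c n] joins |f x - f a| <= 2M to the gain in [poisson_rV_off]; it tends to 0 with
   [e_ n]. *)
have c0 n : 0 <= c n.
  by rewrite !mulr_ge0 ?(ltW (e0 n)) // addr_ge0 // invr_ge0 exprn_ge0 // ltW.
(* Either all coordinates are within [D] of [a] and continuity applies, or some coordinate [j] is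
   not and the j-th summand alone covers the left side. After integration the first term is eta /
   2. *)
have bound n x : `|f x - f a| * poisson_rV (e_ n) (x - a) <=
    eta1 * poisson_rV (e_ n) (x - a) + \sum_(j < d) c n * off_kernel (e_ n) a j x.
  have s0 : 0 <= \sum_(j < d) c n * off_kernel (e_ n) a j x.
    by apply: sumr_ge0 => j _; rewrite mulr_ge0 // off_kernel_ge0.
  have p0 := poisson_rV_ge0 (x - a) (e0 n).
  have [[j Dj]|/forallNP xD] := pselect (exists j, D <= `|x 0 j - a 0 j|); last first.
    rewrite -[leLHS]addr0 lerD // ler_wpM2r // hD // => i.
    by rewrite ltNge; apply/negP; exact: xD.
  rewrite -[leLHS]add0r lerD //; first by rewrite mulr_ge0 // ltW.
  rewrite (bigD1 j) //= -[leLHS]addr0 lerD //; last first.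
    by apply: sumr_ge0 => i _; rewrite mulr_ge0 // off_kernel_ge0.
  rewrite /c -[2 * M * _ * _]mulrA ler_pM // ?poisson_rV_off //.
  by rewrite mulr_natl mulr2n (le_trans (ler_normB _ _)) // lerD.
have mp n := measurable_poisson_rV a (e0 n).
have total n : (\int[leb]_x (`|f x - f a| * poisson_rV (e_ n) (x - a))%:E <=
   (eta1 * pi ^+ d + \sum_(j < d) c n * pi ^+ d)%:E)%E.
  apply: (@le_trans _ _ (\int[leb]_x ((eta1%:E * (poisson_rV (e_ n) (x - a))%:E) +
      \sum_(j < d) (c n)%:E * (off_kernel (e_ n) a j x)%:E))%E).
    apply: ge0_le_integral => //.
    - by move=> x _; rewrite lee_fin mulr_ge0 // poisson_rV_ge0.
    - apply/measurable_EFinP; apply: measurable_funM => //.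
      by apply: measurableT_comp => //; exact: measurable_funB.
    - apply: emeasurable_funD; first by apply: emeasurable_funM => //; apply/measurable_EFinP.
      apply: emeasurable_sum => j; apply: emeasurable_funM => //.
      by apply/measurable_EFinP; exact: measurable_off_kernel.
    move=> x _; under eq_bigr do rewrite -EFinM.
    by rewrite sumEFin -EFinM -EFinD lee_fin.
  rewrite ge0_integralD //; last 4 first.
  - by move=> x _; rewrite mule_ge0 ?lee_fin ?poisson_rV_ge0 // ltW.
  - by apply: emeasurable_funM => //; apply/measurable_EFinP.
  - by move=> x _; apply: sume_ge0 => j _; rewrite mule_ge0 ?lee_fin ?off_kernel_ge0.
  - apply: emeasurable_sum => j; apply: emeasurable_funM => //.
    by apply/measurable_EFinP; exact: measurable_off_kernel.
  rewrite ge0_integralZl //; last 3 first.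
  - by apply/measurable_EFinP.
  - by move=> x _; rewrite lee_fin poisson_rV_ge0.
  - by rewrite lee_fin ltW.
  rewrite integral_poisson_rV // ge0_integral_sum //; last 2 first.
  - by move=> j; apply: emeasurable_funM => //; apply/measurable_EFinP;
    exact: measurable_off_kernel.
  - by move=> j x _; rewrite mule_ge0 ?lee_fin ?off_kernel_ge0.
  rewrite EFinD EFinM -sumEFin leeD2l //; apply: lee_sum => j _.
  rewrite ge0_integralZl //; last 3 first.
  - by apply/measurable_EFinP; exact: measurable_off_kernel.
  - by move=> x _; rewrite lee_fin off_kernel_ge0.
  - by rewrite lee_fin.
  by rewrite integral_off_kernel.
have diff n : `|pi ^+ d * f a - \int[leb]_x (f x * poisson_rV (e_ n) (x - a))| <=
   eta1 * pi ^+ d + \sum_(j < d) c n * pi ^+ d.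
  have fp := iM _ _ n mf fM; have ap := iM (fun=> f a) M n (measurable_cst _) (fun=> fM a).
  have -> : pi ^+ d * f a = \int[leb]_x (f a * poisson_rV (e_ n) (x - a)).
    rewrite RintegralZl; [|exact: measurableT|exact: ip]; rewrite mulrC; congr (_ * _).
    by rewrite /Rintegral integral_poisson_rV.
  rewrite -RintegralB // (le_trans (le_normr_Rintegral _ _)) //;
    first exact: (integrableB measurableT ap fp).
  rewrite -lee_fin; apply: le_trans (total n); rewrite /Rintegral fineK; last first.
    by apply: integrable_fin_num => //;
      exact: (integrable_abse (integrableB measurableT ap fp)).
  apply: ge0_le_integral => //.
  - by apply/measurable_EFinP; apply: measurableT_comp => //; apply: measurable_funB;
    exact: measurable_funM.
  - apply/measurable_EFinP; apply: measurable_funM => //.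
    by apply: measurableT_comp => //; exact: measurable_funB.
  by move=> x _; rewrite lee_fin -mulrBl normrM distrC (ger0_norm (poisson_rV_ge0 _ _)).
have ccv : \sum_(j < d) c n * pi ^+ d @[n --> \oo] --> (0 : R).
  pose K := 2 * M * (1 + D ^- 2) * pi ^+ d * d%:R.
  have -> : (fun n => \sum_(j < d) c n * pi ^+ d) = fun n => e_ n * K.
    by apply/funext => n; rewrite sumr_const card_ord /c /K -mulr_natr; ring.
  by rewrite -(mul0r K); apply: cvgM; [exact: ecv|exact: cvg_cst].
have /cvgrPdist_le/(_ (eta / 2)) := ccv; rewrite divr_gt0 // => /(_ isT); apply: filterS => n.
rewrite sub0r normrN => cn; apply: le_trans (diff n) _.
rewrite [leRHS]splitr lerD //; last exact: le_trans (ler_norm _) cn.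
rewrite /eta1 (_ : eta / _ * _ = eta / 2) //; field.
by rewrite gt_eqF.
Qed.

End poisson_identity.

Section sine_inversion.
Context (R : realType) (d : nat).
Local Notation rV := 'rV[R]_d.+1.
Local Notation leb := (lebesgue_rV R d.+1).
Implicit Types (x y : rV) (t e : R) (n : nat).

Let e1 : rV := delta_mx 0 ord0.

Let ray t : rV := t *: e1.

Let rayN t : - ray t = ray (- t). Proof. by rewrite /ray scaleNr. Qed.

Let dot_addray x y t : dot y (x + ray t) = dot y x + t * y 0 ord0.
Proof.
rewrite /dot; under eq_bigr do rewrite !mxE mulrDr.
rewrite big_split /=; congr (_ + _).
rewrite (bigD1 ord0) //= big1 => [|i i0]; first by rewrite addr0 mulr1 mulrC.
by rewrite (negPf i0) !mulr0.
Qed.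

Let expN_abs e y := \prod_(i < d.+1) expR (- e * `|y 0 i|).

Let integrable_expN_abs_mul e (p : rV -> R) : 0 < e -> measurable_fun setT p -> (forall y,
  `|p y| <= 1) ->
  leb.-integrable setT (fun y => (expN_abs e y * p y)%:E).
Proof. by move=> e0; exact: (integrable_mul_bounded (integrable_tensor_expN_abs d.+1 e0)). Qed.

Let measurable_sin_coord t : measurable_fun setT (fun y : rV => sin (t * y 0 ord0)).
Proof.
apply: (@measurableT_comp _ _ _ _ _ _ (@sin R)).
  by apply: continuous_measurable_fun; exact: continuous_sin.
by apply: measurable_funM => //; exact: (measurable_rV_coord ord0).
Qed.

Let cos_expN_abs e x : 0 < e ->
  \int[leb]_y (expN_abs e y * cos (dot y x + 0)) = 2 ^+ d.+1 * poisson_rV e x.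
Proof.
move=> e0; under eq_Rintegral do rewrite mulrC.
rewrite /Rintegral integral_cos_tensor_expN_abs //= cos0 mul1r /poisson_rV big_split /=.
by rewrite prodr_const card_ord.
Qed.

(** With u = x.y and v = t y_1, cos(u + pi / 2) sin v = (cos(u + v) - cos(u - v)) / 2, and adding or
    subtracting v means shifting [x] by t along the first axis. *)
Let cosine_transform_damped_sine e t x : 0 < e ->
  cosine_transform (fun y => expN_abs e y * sin (t * y 0 ord0)) x (pi / 2) =
  2^-1 * (2 ^+ d.+1 * poisson_rV e (x - ray (- t)) - 2 ^+ d.+1 * poisson_rV e (x - ray t)).
Proof.
move=> e0; rewrite -!cos_expN_abs //.
have mc z : measurable_fun setT (fun y : rV => cos (dot y z + 0)) by exact: measurable_cos_dot.
have ic z := integrable_expN_abs_mul e0 (mc z) (fun y => cos_max _).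
rewrite -(RintegralB measurableT (ic _) (ic _)).
rewrite -(RintegralZl _ measurableT (integrableB measurableT (ic _) (ic _))).
apply: eq_Rintegral => y _; rewrite !rayN opprK !dot_addray !addr0 cosDpihalf !cosD.
by rewrite mulNr cosN sinN; field.
Qed.

(** The multiplication formula moves the transform from [f] onto the damped sine, so the pairing
    becomes a difference of Poisson averages of [f] around -t e_1 and t e_1. Integrability of the
    transform removes the damping on the other side. *)
Lemma sine_inversion (f : rV -> R) (M t : R) :
  continuous f -> (forall x, `|f x| <= M) -> leb.-integrable setT (EFin \o f) ->
  leb.-integrable setT (fun y => (cosine_transform f y (pi / 2))%:E) ->
  \int[leb]_y (cosine_transform f y (pi / 2) * sin (t * y 0 ord0)) =
  2^-1 * (2 * pi) ^+ d.+1 * (f (- t *: delta_mx 0 ord0) - f (t *: delta_mx 0 ord0)).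
Proof.
move=> cf fM fi; set B := fun y => cosine_transform f y (pi / 2) => iB.
have mB : measurable_fun setT B by apply/measurable_EFinP; exact: measurable_int iB.
pose e_ n : R := n.+1%:R^-1; have e0 n : 0 < e_ n by rewrite invr_gt0.
have ecv : e_ n @[n --> \oo] --> 0 by exact: cvg_harmonic.
pose p n y := expN_abs (e_ n) y * sin (t * y 0 ord0).
have ip n : leb.-integrable setT (EFin \o p n).
  by apply: integrable_expN_abs_mul => // y; exact: sin_max.
have mE n : measurable_fun setT (expN_abs (e_ n)).
  by have := integrable_tensor_expN_abs d.+1 (e0 n) => /measurable_int/measurable_EFinP.
have cvL : \int[leb]_y (p n y * B y) @[n --> \oo] --> \int[leb]_y (B y * sin (t * y 0 ord0)).
  apply: (cvg_Rintegral (g := fun y => `|B y|)).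
  - by move=> n; do 2 apply: measurable_funM => //.
  - exact: measurable_funM.
  - move=> y; rewrite mulrC -[X in _ --> X]mul1r; under eq_fun do rewrite /p -mulrA.
    apply: cvgM; last exact: cvg_cst.
    rewrite (_ : 1 = \prod_(i < d.+1) 1); last by rewrite big1.
    rewrite /expN_abs; apply: (@cvg_big _ _ _ _ _ _ _ (nbhs \oo)); first exact: mul_continuous.
    move=> i _; rewrite -expR0; apply: (@cvg_comp _ _ _ (fun n => - e_ n * `|y 0 i|) (@expR
      R)); last exact: continuous_expR.
    rewrite -(mul0r `|y 0 i|); apply: cvgM; last exact: cvg_cst.
    by rewrite -oppr0; exact: cvgN.
  - exact: (integrable_abse iB).
  move=> n y; rewrite !normrM ler_piMl // mulr_ile1 ?sin_max // normr_prod.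
  apply: prodr_ile1 => i _; rewrite normr_ge0 ger0_norm ?expR_ge0 //= -expR0 ler_expR.
  by rewrite mulNr oppr_le0 mulr_ge0 // ltW.
have cvR : \int[leb]_y (p n y * B y) @[n --> \oo] -->
    2^-1 * (2 * pi) ^+ d.+1 * (f (ray (- t)) - f (ray t)).
  have E n : \int[leb]_y (p n y * B y) = 2^-1 * 2 ^+ d.+1 *
      (\int[leb]_x (f x * poisson_rV (e_ n) (x - ray (- t))) - \int[leb]_x (f x * poisson_rV
        (e_ n) (x - ray t))).
    have iP a : leb.-integrable setT (fun x => (f x * poisson_rV (e_ n) (x - a))%:E).
      by apply: (integrable_mul_poisson_rV _ (e0 n) _ fM); exact: continuous_measurable_rV.
    rewrite -(Rintegral_mul_cosine_transform (pi / 2) fi (ip n)).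
    rewrite -(RintegralB measurableT (iP _) (iP _)).
    rewrite -(RintegralZl _ measurableT (integrableB measurableT (iP _) (iP _))).
    by apply: eq_Rintegral => x _; rewrite cosine_transform_damped_sine //; ring.
  have cP a : \int[leb]_x (f x * poisson_rV (e_ n) (x - a)) @[n --> \oo] --> pi ^+ d.+1 * f a.
    exact: poisson_rV_cvg fM _ _.
  rewrite (_ : _ * (f _ - f _) = 2^-1 * 2 ^+ d.+1 *
      (pi ^+ d.+1 * f (ray (- t)) - pi ^+ d.+1 * f (ray t))); last by rewrite exprMn; ring.
  under eq_fun do rewrite E.
  by apply: cvgM; [exact: cvg_cst|apply: cvgB; exact: cP].
exact: (cvg_unique _ cvL cvR).
Qed.

End sine_inversion.

Section second_difference.
Context (R : realType).
Implicit Types (t y : R).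

Lemma normr_sin_le y : `|sin y| <= `|y|.
Proof.
wlog y0 : y / 0 <= y.
  move=> h; have [|/ltW] := leP 0 y; first exact: h.
  by rewrite -oppr_ge0 => /h; rewrite sinN !normrN.
have [|c _] := @MVT_segment R (@sin R) (@cos R) 0 y y0.
- by apply: continuous_subspaceT; exact: continuous_sin.
by rewrite sin0 !subr0 => ->; rewrite normrM ler_piMl // cos_max.
Qed.

(** From sin 2y - 2 sin y = -4 sin y sin^2(y / 2). The minimum holds two bounds: y^2 supplies the
    dominating function, and |y|^3 the pointwise convergence to 0 after division by t^2. *)
Lemma normr_sin_mul2_sub y : `|sin (2 * y) - 2 * sin y| <= Num.min 1 `|y| * y ^+ 2.
Proof.
have -> : sin (2 * y) - 2 * sin y = - 4 * (sin y * sin (y / 2) ^+ 2).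
  have yE : y = (y / 2) *+ 2 by rewrite -mulr_natr -mulrA mulVf ?mulr1 // pnatr_eq0.
  rewrite mulr_natl sin_mulr2n [X in cos X]yE cos_mulr2n cos2sin2 -mulr_natl; ring.
have h1 : `|sin y| <= Num.min 1 `|y| by rewrite le_min sin_max normr_sin_le.
have h2 : `|sin (y / 2)| ^+ 2 <= `|y / 2| ^+ 2 by rewrite lerXn2r ?nnegrE // normr_sin_le.
rewrite 2!normrM normrX normrN (ger0_norm (ler0n R 4)) mulrCA (_ : y ^+ 2 = 4 * `|y / 2| ^+
  2); last first.
  by rewrite real_normK ?num_real //; field.
by rewrite ler_pM ?mulr_ge0 ?sqr_ge0 // ler_wpM2l.
Qed.

(** At t = 1 / (n + 1) the rescaled integrand is at most |G| xi_1^2 min(1, t |xi_1|): dominated by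
    <xi>^2 |G| and tending to 0 at each point. *)
Lemma cvg_second_difference d (G : 'rV[R]_d.+1 -> R) :
  (lebesgue_rV R d.+1).-integrable setT (fun xi => (japanese xi ^+ 2 * G xi)%:E) ->
  measurable_fun setT G ->
  let F t := \int[lebesgue_rV R d.+1]_xi (G xi * sin (t * xi 0 ord0)) in
  (F (2 * n.+1%:R^-1) - 2 * F n.+1%:R^-1) * n.+1%:R ^+ 2 @[n --> \oo] --> 0.
Proof.
move=> iJG mG F.
pose S n (xi : 'rV[R]_d.+1) := G xi * ((sin (2 * (n.+1%:R^-1 * xi 0 ord0)) - 2 * sin
  (n.+1%:R^-1 * xi 0 ord0)) * n.+1%:R ^+ 2).
have Sle n xi : `|S n xi| <= `|G xi| * (Num.min 1 `|n.+1%:R^-1 * xi 0 ord0| * xi 0 ord0 ^+ 2).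
  rewrite /S 2!normrM ler_wpM2l // [`|_ ^+ 2|]ger0_norm ?sqr_ge0 //.
  apply: (@le_trans _ _ (Num.min 1 `|n.+1%:R^-1 * xi 0 ord0| * (n.+1%:R^-1 * xi 0 ord0) ^+ 2
    * n.+1%:R ^+ 2)).
    by rewrite ler_wpM2r ?sqr_ge0 // normr_sin_mul2_sub.
  by rewrite -mulrA -exprMn mulrAC mulVf ?mul1r ?pnatr_eq0.
have msin t : measurable_fun setT (fun xi : 'rV[R]_d.+1 => sin (t * xi 0 ord0)).
  apply: (@measurableT_comp _ _ _ _ _ _ (@sin R)).
    by apply: continuous_measurable_fun; exact: continuous_sin.
  by apply: measurable_funM => //; exact: (measurable_rV_coord ord0).
have coord_le (xi : 'rV[R]_d.+1) : xi 0 ord0 ^+ 2 <= japanese xi ^+ 2.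
  rewrite -(real_normK (num_real (xi 0 ord0))) lerXn2r ?nnegrE ?normr_coord_le_japanese //.
  exact/ltW/japanese_gt0.
have iG : (lebesgue_rV R d.+1).-integrable setT (EFin \o G).
  apply: (le_integrable measurableT _ _ iJG); first exact/measurable_EFinP.
  move=> xi _ /=; rewrite lee_fin normrM ler_peMl // ger0_norm ?sqr_ge0 //.
  by rewrite expr_ge1 // ?japanese_ge1 // ltW // japanese_gt0.
have iGs t : (lebesgue_rV R d.+1).-integrable setT (fun xi => (G xi * sin (t * xi 0 ord0))%:E).
  by apply: (integrable_mul_bounded iG (msin t)) => xi; exact: sin_max.
have -> : (fun n => (F (2 * n.+1%:R^-1) - 2 * F n.+1%:R^-1) * n.+1%:R ^+ 2) =
    fun n => \int[lebesgue_rV R d.+1]_xi S n xi.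
  apply/funext => n; rewrite /F.
  have i2 := integrableZl measurableT 2 (iGs n.+1%:R^-1).
  rewrite -(RintegralZl 2 measurableT (iGs _)) -(RintegralB measurableT (iGs _) i2) mulrC.
  rewrite -(RintegralZl _ measurableT (integrableB measurableT (iGs _) i2)).
  by apply: eq_Rintegral => xi _; rewrite /S (mulrA 2 n.+1%:R^-1); ring.
have Z : \int[lebesgue_rV R d.+1]_xi (fun=> 0 : R) xi = 0 by rewrite /Rintegral integral0.
rewrite -[X in _ --> X]Z; apply: (cvg_Rintegral (g := fun xi => `|japanese xi ^+ 2 * G xi|)).
- move=> n; apply: measurable_funM => //; apply: measurable_funM => //; apply: measurable_funB.
    by under eq_fun do rewrite mulrA; exact: msin.
  by apply: measurable_funM => //; exact: msin.
- exact: measurable_cst.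
- move=> xi; apply: (@cvg0_le _ _ _ _ _ (fun n => n.+1%:R^-1 * (`|G xi| * (`|xi 0 ord0| * xi
  0 ord0 ^+ 2)))).
    move=> n; rewrite (le_trans (Sle n xi)) // [leRHS]mulrCA ler_wpM2l //
      [leRHS]mulrA ler_wpM2r ?sqr_ge0 //.
    by rewrite ge_min normrM ger0_norm ?lexx ?orbT.
  rewrite -(mul0r (`|G xi| * (`|xi 0 ord0| * xi 0 ord0 ^+ 2))); apply: cvgM;
    last exact: cvg_cst.
  exact: cvg_harmonic.
- exact: (integrable_abse iJG).
move=> n xi; rewrite (le_trans (Sle n xi)) // [leRHS]normrM [leLHS]mulrC ler_wpM2r //
  ger0_norm ?sqr_ge0 //.
rewrite (le_trans _ (coord_le xi)) // ler_piMl ?sqr_ge0 // ge_min lexx //.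
Qed.

End second_difference.

(** * Spectral Barron regularity of [phi2]: below order 2 and at order 2 *)

Section phi2_spectral_barron.
Context (R : realType) (chi h : R -> R) (a b : R).
Hypotheses (b_gt0 : 0 < b) (ab : b < a).
Hypothesis h_smooth : forall n r, derivable (derive1n n h) r 1.
Hypothesis chi_h : forall r, 0 <= r -> chi r = h r.
Hypothesis chi01 : forall r, 0 <= r -> 0 <= chi r <= 1.
Hypothesis chi_eq1 : forall r, 0 <= r <= 1 -> chi r = 1.
Hypothesis chi_eq0 : forall r, 2 <= r -> chi r = 0.
Local Notation leb := (lebesgue_rV R 3).
Local Notation phi := (phi2 a b chi).
Local Notation Im := (@complex.Im R).

Let a_gt0 : 0 < a. Proof. exact: lt_trans ab. Qed.

Let fi := integrable_phi2 a_gt0 b_gt0 h_smooth chi_h chi01 chi_eq1 chi_eq0.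

Let phi2_axis t : 0 <= t <= 1 ->
  phi (t *: delta_mx 0 0) = t * expR ((a - b) * t) /\
  phi (- t *: delta_mx 0 0) = - (t * expR ((a - b) * t)).
Proof.
move=> /andP[t0 t1].
have nE s : enorm (s *: delta_mx 0 0 : 'rV[R]_3) = `|s|.
  rewrite -sqrtr_sqr /enorm /dot (bigD1 0) //= big1 => [|i i0]; last first.
    by rewrite !mxE (negPf i0) andbF mulr0 mul0r.
  by rewrite !mxE eqxx mulr1 addr0 expr2.
have expE : - b * t + a * t = (a - b) * t by ring.
by rewrite /phi2 !nE normrN (ger0_norm t0) !mxE eqxx !mulr1 chi_eq1 ?t0 // mulr1 expE mulNr.
Qed.

Lemma spectral_barron_phi2 s : 0 <= s < 2 ->
  spectral_barron s (regular_distribution (fun x => (phi x)%:C)).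
Proof.
move=> s02; have [C hC] := cosine_transform_phi2_le a_gt0 b_gt0 h_smooth chi_h chi01 chi_eq1
  chi_eq0.
exact: (spectral_barron_of_decay fi hC).
Qed.

Lemma not_spectral_barron_phi2 :
  ~ spectral_barron 2 (regular_distribution (fun x => (phi x)%:C)).
Proof.
move=> [_ [g [[mRe mIm _] rg gfin]]].
have [C hC] := cosine_transform_phi2_le a_gt0 b_gt0 h_smooth chi_h chi01 chi_eq1 chi_eq0.
have cphi : continuous phi by exact: continuous_phi2 h_smooth chi_h.
have [M hM] := phi2_bounded a_gt0 b_gt0 chi01 chi_eq0.
have mJ : measurable_fun setT (fun xi : 'rV[R]_3 => japanese xi ^+ 2).
  under eq_fun do rewrite sqr_japanese; apply: measurable_funD => //.
  by apply: measurable_sum => i; apply: measurable_funX; exact: measurable_rV_coord.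
have powE (xi : 'rV[R]_3) : japanese xi `^ 2 = japanese xi ^+ 2.
  by rewrite powR_mulrn // ltW // japanese_gt0.
have iJ : leb.-integrable setT (fun xi => (japanese xi ^+ 2 * Im (g xi))%:E).
  apply/integrableP; split; first by apply/measurable_EFinP; exact: measurable_funM.
  apply: le_lt_trans gfin; apply: ge0_le_integral => //.
  - apply/measurable_EFinP; apply: measurableT_comp => //; exact: measurable_funM.
  - under eq_fun do rewrite powE; apply/measurable_EFinP; apply: measurable_funM => //.
    exact: measurable_normc.
  move=> xi _; rewrite lee_fin normrM powE (ger0_norm (sqr_ge0 _)).
  by rewrite ler_wpM2l ?sqr_ge0 // normr_Im_le_normc.
have iIm : leb.-integrable setT (EFin \o (Im \o g)).
  apply: (le_integrable measurableT _ _ iJ); first exact/measurable_EFinP.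
  move=> xi _ /=; rewrite lee_fin normrM ler_peMl // ger0_norm ?sqr_ge0 //.
  by rewrite expr_ge1 // ?japanese_ge1 // ltW // japanese_gt0.
have iB : leb.-integrable setT (fun xi => (cosine_transform phi xi (pi / 2))%:E).
  apply: (integrable_cosine_transform (pi / 2) _ hC).
  by apply/measurable_EFinP; exact: measurable_int fi.
pose F t := \int[leb]_xi (Im (g xi) * sin (t * xi 0 ord0)).
(* The arbitrary [g] is exchanged for the explicit transform. Oddness of [phi2] doubles its value on
   the axis, so the factor is (2 pi)^3 = 8 pi^3. *)
have FE t : 0 <= t <= 1 -> F t = - (8 * pi ^+ 3 * t * expR ((a - b) * t)).
  move=> t01; have [E1 E2] := phi2_axis t01.
  have h01 r : 0 <= r -> 0 <= h r <= 1 by move=> r0; rewrite -chi_h // chi01.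
  have h1 r : 0 <= r <= 1 -> h r = 1 by move=> r01; rewrite -chi_h ?chi_eq1 //; case/andP: r01.
  have h0 r : 2 <= r -> h r = 0 by move=> r2; rewrite -chi_h ?chi_eq0 // (le_trans _ r2).
  rewrite /F (represents_sine h_smooth h01 h1 h0 t rg (represents_regular_real fi) iIm iB).
  by rewrite (sine_inversion t cphi hM fi iB) E1 E2; field.
have := cvg_second_difference iJ mIm; rewrite -/F => cv0.
(* [1 <= n] gives 2t <= 1, where [chi] is still 1. With E = e^((a-b)t) the second difference is -16
   pi^3 t E (E - 1), and E - 1 >= (a - b) t; dividing by t^2 leaves a positive constant. *)
have lb n : (1 <= n)%N -> 16 * pi ^+ 3 * (a - b) <= `|(F (2 * n.+1%:R^-1) - 2 * F n.+1%:R^-1)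
  * n.+1%:R ^+ 2|.
  move=> n1; set t := n.+1%:R^-1 : R.
  have t0 : 0 < t by rewrite invr_gt0.
  have t2 : 2 * t <= 1 by rewrite ler_pdivrMr // mul1r ler_nat.
  have -> : n.+1%:R ^+ 2 = t ^- 2 by rewrite /t -exprVn invrK.
  rewrite !FE ?t2 ?mulr_ge0 ?(ltW t0) //=;
    last by rewrite (le_trans _ t2) // ler_peMl ?(ltW t0) // ler1n.
  have c0 : 0 < a - b by rewrite subr_gt0.
  set E := expR ((a - b) * t).
  have -> : expR ((a - b) * (2 * t)) = E ^+ 2 by rewrite -expRM_natl; congr expR; ring.
  have E1 : 1 + (a - b) * t <= E by exact: expR_ge1Dx.
  rewrite normrM [`|t ^- 2|]ger0_norm ?invr_ge0 ?exprn_ge0 ?(ltW t0) //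
    ler_pdivlMr ?exprn_gt0 //.
  rewrite [X in `|X|](_ : _ = - (16 * pi ^+ 3 * t * (E * (E - 1)))); last by ring.
  have E1' : 1 <= E by rewrite (le_trans _ E1) // lerDl mulr_ge0 ?(ltW t0) ?(ltW c0).
  have K0 : 0 <= 16 * pi ^+ 3 * t by rewrite !mulr_ge0 ?exprn_ge0 ?pi_ge0 ?(ltW t0).
  have EE : (a - b) * t <= E * (E - 1).
    by rewrite (@le_trans _ _ (E - 1)) ?lerBrDl // ler_peMl // subr_ge0.
  rewrite normrN ger0_norm; last by rewrite mulr_ge0 // (le_trans _ EE) //
    mulr_ge0 ?(ltW t0) ?(ltW c0).
  rewrite (_ : _ * t ^+ 2 = 16 * pi ^+ 3 * t * ((a - b) * t)); last by ring.
  by rewrite ler_wpM2l.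
have c0 : 0 < 16 * pi ^+ 3 * (a - b) by rewrite !mulr_gt0 ?exprn_gt0 ?pi_gt0 ?subr_gt0.
have /cvgrPdist_lt/(_ _ c0) := cv0 => near0.
have : \forall n \near \oo, False; last by move=> /filter_ex[].
near=> n.
have : 16 * pi ^+ 3 * (a - b) < 16 * pi ^+ 3 * (a - b); last by rewrite ltxx.
apply: (@le_lt_trans _ _ `|(F (2 * n.+1%:R^-1) - 2 * F n.+1%:R^-1) * n.+1%:R ^+ 2|).
  by apply: lb; near: n; exact: nbhs_infty_ge.
by rewrite -normrN -sub0r; near: n.
Unshelve. all: by end_near. Qed.

End phi2_spectral_barron.

Theorem theorem3p3 (R : realType) (Z : R) (chi : R -> R)
    (hZ : 0 < Z) (hchi : cutoff chi) :
  (forall s : R, 0 <= s < 2 ->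
    spectral_barron s (regular_distribution (fun x => (phi2 (Z / 2) (Z / 4) chi x)%:C))) /\
  ~ spectral_barron 2 (regular_distribution (fun x => (phi2 (Z / 2) (Z / 4) chi x)%:C)).
Proof.
have [[[h [h_smooth chi_h]] _] chi01 chi_eq1 chi_eq0] := hchi.
have b_gt0 : 0 < Z / 4 by rewrite divr_gt0.
(* Makes a - b = Z / 4 positive, hence the lower bound on the second difference nonzero. *)
have ab : Z / 4 < Z / 2 by rewrite ltr_pM2l // ltf_pV2 ?posrE // ltr_nat.
split => [s s02|].
  exact: (spectral_barron_phi2 b_gt0 ab h_smooth).
exact: (not_spectral_barron_phi2 b_gt0 ab h_smooth).
Qed.
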